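(* Let $R$ be a discrete valuation ring, $K$ its fraction field, $k$ its residue field. Let $\mathcal{X}$ be a proper flat $R$-scheme. Suppose that the generic fibre $X/K$ is smooth and geometrically integral. Let $Y$ be the special fibre. Suppose that $Y$ is the union $Y=V\cup W$ of two closed subschemes, and let $T=V\cap W$. Suppose $T(k)=\emptyset$, $V_{\mathrm{smooth}}(k)\neq\emptyset$ and $W_{\mathrm{smooth}}(k)\neq\emptyset$. Then the $K$-variety $X$ is not $\mathrm{R}$-trivial, and hence is not retract rational.
   Context: $V_{\mathrm{smooth}}$ denotes the smooth locus of $V$ over $k$ (likewise for $W$). For a field $L$ and an $L$-variety $X$, two points $A,B\in X(L)$ are elementarily $\mathrm{R}$-linked if there exist an open subset $U\subset \mathbb{P}^1_L$ and an $L$-morphism $h: U\to X$ with $A,B\in h(U(L))$. Two points are $\mathrm{R}$-equivalent if they are joined by a finite chain of points of $X(L)$ in which consecutive points are elementarily $\mathrm{R}$-linked; the quotient is $X(L)/\mathrm{R}$. An integral $K$-variety $X$ is $\mathrm{R}$-trivial if for every field $F$ containing $K$ the set $X(F)/\mathrm{R}$ (computed for $X_F$ over $F$) has exactly one element. A geometrically integral $K$-variety $X$ is retract rational if there exist a nonempty Zariski open $U\subset X$, an open $W'\subset\mathbb{P}^n_K$ for some $n$, and $K$-morphisms $f:U\to W'$, $g:W'\to U$ with $g\circ f=\mathrm{id}_U$. *)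

(* Defs.v *)
(* Schemes over a ring R are formalized through their functors of points
   (Demazure-Gabriel): functors on commutative R-algebras that are Zariski
   sheaves and are covered by open subfunctors represented by algebras.
   Base change along R -> S is then restriction to S-algebras. *)
From HB Require Import structures.
From mathcomp Require Import all_boot all_order all_algebra.
From Stdlib Require Import ProofIrrelevance PropExtensionality.
From Stdlib Require Import FunctionalExtensionality Relation_Operators.

Set Implicit Arguments.
Unset Strict Implicit.
Unset Printing Implicit Defensive.

Import GRing.Theory.
Local Open Scope ring_scope.

(** * Rings and algebras *)

(* Algebras carry an explicit structure morphism, so that restriction of
   scalars does not change the underlying ring; the zero ring is allowed. *)
Record algebra (R : comPzRingType) := Alg {
  alg_ring :> comPzRingType;
  alg_map : {rmorphism R -> alg_ring} }.

Record alg_hom (R : comPzRingType) (A B : algebra R) := AlgHom {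
  alg_hom_fun :> {rmorphism A -> B};
  alg_hom_comm : forall r, alg_hom_fun (alg_map A r) = alg_map B r }.

Definition alg_self (R : comPzRingType) : algebra R :=
  Alg (idfun : {rmorphism R -> R}).

Definition restrict (R S : comPzRingType) (phi : {rmorphism R -> S})
    (A : algebra S) : algebra R :=
  Alg (alg_map A \o phi : {rmorphism R -> alg_ring A}).

Definition restrict_hom (R S : comPzRingType) (phi : {rmorphism R -> S})
    (A B : algebra S) (f : alg_hom A B) :
    alg_hom (restrict phi A) (restrict phi B) :=
  @AlgHom R (restrict phi A) (restrict phi B) (alg_hom_fun f)
    (fun r => alg_hom_comm f (phi r)).

Definition generates_unit_ideal (A : comPzRingType) (T : A -> Prop) : Prop :=
  exists n (t b : 'I_n -> A), (forall i, T (t i)) /\ \sum_i b i * t i = 1.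

Definition image_set (A B : Type) (f : A -> B) (T : A -> Prop) : B -> Prop :=
  fun y => exists x, T x /\ y = f x.

(* [l] identifies [B] with the ring of fractions A[1/s]. *)
Definition is_localization (R : comPzRingType) (A B : algebra R)
    (l : alg_hom A B) (s : A) : Prop :=
  [/\ exists v, l s * v = 1,
      forall b, exists a n, b * l s ^+ n = l a
    & forall a, l a = 0 -> exists n, s ^+ n * a = 0].

Definition finitely_generated (R : comPzRingType) (B : algebra R) : Prop :=
  exists n (x : 'I_n -> B), forall S : B -> Prop,
    (forall r, S (alg_map B r)) -> (forall i, S (x i)) ->
    (forall a b, S a -> S b -> S (a + b)) ->
    (forall a b, S a -> S b -> S (a * b)) ->
    forall b, S b.

Definition is_domain (B : comPzRingType) : Prop :=
  (1 : B) <> 0 /\ forall x y : B, x * y = 0 -> x = 0 \/ y = 0.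

Definition is_bilinear (R : comPzRingType) (M : lmodType R) (B : algebra R)
    (P : lmodType R) (beta : M -> B -> P) : Prop :=
  [/\ forall m m' b, beta (m + m') b = beta m b + beta m' b,
      forall m b b', beta m (b + b') = beta m b + beta m b',
      forall r m b, beta (r *: m) b = r *: beta m b
    & forall r m b, beta m (alg_map B r * b) = r *: beta m b].

(* The element \sum_i m_i (x) b_i of the tensor product of [M] and [B] over [R]
   vanishes: the tensor product is used through its universal property. *)
Definition tensor_eq0 (R : comPzRingType) (M : lmodType R) (B : algebra R)
    n (m : 'I_n -> M) (b : 'I_n -> B) : Prop :=
  forall (P : lmodType R) (beta : M -> B -> P),
    is_bilinear beta -> \sum_i beta (m i) (b i) = 0.

Definition flat_algebra (R : comPzRingType) (B : algebra R) : Prop :=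
  forall (M N : lmodType R) (phi : {linear M -> N}), injective phi ->
  forall n (m : 'I_n -> M) (b : 'I_n -> B),
    tensor_eq0 (fun i => phi (m i)) b -> tensor_eq0 m b.

Definition is_discrete_valuation (K : fieldType) (v : K -> int) : Prop :=
  [/\ forall x y, x != 0 -> y != 0 -> v (x * y) = v x + v y,
      forall x y, x != 0 -> y != 0 -> x + y != 0 ->
        Num.min (v x) (v y) <= v (x + y)
    & forall z, exists x, x != 0 /\ v x = z].

Definition is_dvr (R : idomainType) : Prop :=
  exists v : {fraction R} -> int, is_discrete_valuation v /\
    forall x, (exists r : R, x = tofrac r) <-> (x = 0 \/ 0 <= v x).

(* [pi] identifies [k] with the residue field of the local ring [R]. *)
Definition is_residue_map (R : idomainType) (k : fieldType)
    (pi : {rmorphism R -> k}) : Prop :=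
  (forall y, exists r, y = pi r) /\
  (forall r, pi r = 0 <-> ~ (r \is a GRing.unit)).

(** * Functors of points *)

(* The two laws also say that the action depends only on the underlying
   function of an algebra morphism. *)
Record functor (R : comPzRingType) := Functor {
  pts :> algebra R -> Type;
  fmap : forall A B : algebra R, alg_hom A B -> pts A -> pts B;
  fmap_id : forall (A : algebra R) (f : alg_hom A A),
    (forall x, f x = x) -> forall p, fmap f p = p;
  fmap_comp : forall (A B C : algebra R) (f : alg_hom A B) (g : alg_hom B C)
    (h : alg_hom A C), (forall x, h x = g (f x)) ->
    forall p, fmap h p = fmap g (fmap f p) }.

Record morphism (R : comPzRingType) (X Y : functor R) := Morphism {
  app :> forall A : algebra R, X A -> Y A;
  app_nat : forall (A B : algebra R) (f : alg_hom A B) (p : X A),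
    app (fmap f p) = fmap f (app p) }.

Definition base_change (R S : comPzRingType) (phi : {rmorphism R -> S})
    (X : functor R) : functor S :=
  @Functor S (fun A => X (restrict phi A))
    (fun A B f => fmap (restrict_hom phi f))
    (fun A f fE => @fmap_id R X _ (restrict_hom phi f) fE)
    (fun A B C f g h hE => @fmap_comp R X _ _ _
       (restrict_hom phi f) (restrict_hom phi g) (restrict_hom phi h) hE).

Definition square (R : comPzRingType) (X : functor R) : functor R.
Proof.
refine (@Functor R (fun A => (X A * X A)%type)
  (fun A B f p => (fmap f p.1, fmap f p.2)) _ _).
- by move=> A f fE [p q] /=; rewrite !(fmap_id fE).
- by move=> A B C f g h hE [p q] /=; rewrite !(fmap_comp hE).
Defined.

Record subfunctor (R : comPzRingType) (X : functor R) := Subfunctor {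
  lies_in : forall A : algebra R, X A -> Prop;
  lies_in_fmap : forall (A B : algebra R) (f : alg_hom A B) (p : X A),
    lies_in p -> lies_in (fmap f p) }.

Arguments lies_in {R X} _ {A} _.

Definition sub (R : comPzRingType) (X : functor R) (U : subfunctor X) :
  functor R.
Proof.
refine (@Functor R (fun A => {p : X A | lies_in U p})
  (fun A B f p => exist _ (fmap f (sval p)) (lies_in_fmap f (svalP p))) _ _).
- move=> A f fE [p Up]; apply: eq_sig_hprop => /=.
    by move=> q; apply: proof_irrelevance.
  exact: fmap_id.
- move=> A B C f g h hE [p Up]; apply: eq_sig_hprop => /=.
    by move=> q; apply: proof_irrelevance.
  exact: fmap_comp.
Defined.

Definition diagonal (R : comPzRingType) (X : functor R) :
  subfunctor (square X).
Proof.
refine (@Subfunctor R (square X) (fun A p => p.1 = p.2) _).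
by move=> A B f [p q] /= ->.
Defined.

Definition inter (R : comPzRingType) (X : functor R) (V W : subfunctor X) :
  subfunctor X.
Proof.
refine (@Subfunctor R X (fun A p => lies_in V p /\ lies_in W p) _).
by move=> A B f p [Vp Wp]; split; apply: lies_in_fmap.
Defined.

(* The pullback of [U] along any Spec A -> X is D(S), respectively V(S). *)
Definition open_sub (R : comPzRingType) (X : functor R) (U : subfunctor X) :=
  forall (A : algebra R) (p : X A), exists S : A -> Prop,
  forall (B : algebra R) (f : alg_hom A B),
    lies_in U (fmap f p) <-> generates_unit_ideal (image_set f S).

Definition closed_sub (R : comPzRingType) (X : functor R) (Z : subfunctor X) :=
  forall (A : algebra R) (p : X A), exists S : A -> Prop,
  forall (B : algebra R) (f : alg_hom A B),
    lies_in Z (fmap f p) <-> (forall a, S a -> f a = 0).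

Definition represents (R : comPzRingType) (X : functor R)
    (B : algebra R) (u : X B) : Prop :=
  forall (A : algebra R) (p : X A), exists h : alg_hom B A,
    fmap h u = p /\ forall h' : alg_hom B A, fmap h' u = p -> h' =1 h.

Definition affine_open (R : comPzRingType) (X : functor R)
    (U : subfunctor X) (B : algebra R) : Prop :=
  open_sub U /\ exists u : sub U B, represents u.

(** * Schemes *)

(* Two sections over A_i and A_j agree on the overlap if they agree after every
   pair of morphisms to a common algebra that agree on A. *)
Definition zariski_sheaf (R : comPzRingType) (X : functor R) : Prop :=
  forall (A : algebra R) n (s : 'I_n -> A),
  generates_unit_ideal (fun a => exists i, a = s i) ->
  forall (L : 'I_n -> algebra R) (l : forall i, alg_hom A (L i)),
  (forall i, is_localization (l i) (s i)) ->
  forall p : forall i, X (L i),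
  (forall i j (C : algebra R) (g : alg_hom (L i) C) (g' : alg_hom (L j) C),
     (forall a, g (l i a) = g' (l j a)) -> fmap g (p i) = fmap g' (p j)) ->
  exists! q : X A, forall i, fmap (l i) q = p i.

(* Open subfunctors cover X when they do so on points with values in fields. *)
Definition is_scheme (R : comPzRingType) (X : functor R) : Prop :=
  zariski_sheaf X /\
  forall (F : fieldType) (phi : {rmorphism R -> F}) (p : X (Alg phi)),
  exists (U : subfunctor X) (B : algebra R), affine_open U B /\ lies_in U p.

Definition nonempty (R : comPzRingType) (X : functor R) : Prop :=
  exists (F : fieldType) (phi : {rmorphism R -> F}), inhabited (X (Alg phi)).

Definition locally_of_finite_type (R : comPzRingType) (X : functor R) : Prop :=
  forall (F : fieldType) (phi : {rmorphism R -> F}) (p : X (Alg phi)),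
  exists (U : subfunctor X) (B : algebra R),
    [/\ affine_open U B, finitely_generated B & lies_in U p].

Definition of_finite_type (R : comPzRingType) (X : functor R) : Prop :=
  exists n (U : 'I_n -> subfunctor X) (B : 'I_n -> algebra R),
    (forall i, affine_open (U i) (B i) /\ finitely_generated (B i)) /\
    forall (F : fieldType) (phi : {rmorphism R -> F}) (p : X (Alg phi)),
      exists i, lies_in (U i) p.

Definition separated (R : comPzRingType) (X : functor R) : Prop :=
  closed_sub (diagonal X).

(* The map |X| -> Spec R is closed: for every closed Z there is V(S) consisting
   of the primes which are kernels of structure morphisms R -> F' of points of
   Z with values in a field F'. *)
Definition closed_structure_map (R : comPzRingType) (X : functor R) : Prop :=
  forall Z : subfunctor X, closed_sub Z -> exists S : R -> Prop,
  forall (F : fieldType) (phi : {rmorphism R -> F}),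
    (forall a, S a -> phi a = 0) <->
    (exists (F' : fieldType) (phi' : {rmorphism R -> F'}),
       (forall a, phi' a = 0 <-> phi a = 0) /\
       exists z : X (Alg phi'), lies_in Z z).

Definition universally_closed (R : comPzRingType) (X : functor R) : Prop :=
  forall A : algebra R, closed_structure_map (base_change (alg_map A) X).

Definition proper_scheme (R : comPzRingType) (X : functor R) : Prop :=
  [/\ separated X, of_finite_type X & universally_closed X].

Definition flat (R : comPzRingType) (X : functor R) : Prop :=
  forall (U : subfunctor X) (B : algebra R),
    affine_open U B -> flat_algebra B.

Definition formally_smooth (R : comPzRingType) (X : functor R) : Prop :=
  forall (A B : algebra R) (q : alg_hom A B),
  (forall b, exists a, b = q a) ->
  (forall a a', q a = 0 -> q a' = 0 -> a * a' = 0) ->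
  forall p : X B, exists p' : X A, fmap q p' = p.

(* Over a field, finite presentation and finite type coincide. *)
Definition smooth (k : fieldType) (X : functor k) : Prop :=
  locally_of_finite_type X /\ formally_smooth X.

(* [p] lies in the largest open subscheme of X that is smooth over k. *)
Definition in_smooth_locus (k : fieldType) (X : functor k) (A : algebra k)
    (p : X A) : Prop :=
  exists U : subfunctor X, [/\ open_sub U, smooth (sub U) & lies_in U p].

Definition integral (R : comPzRingType) (X : functor R) : Prop :=
  nonempty X /\
  forall (U : subfunctor X) (B : algebra R),
    affine_open U B -> nonempty (sub U) -> is_domain B.

Definition geometrically_integral (K : fieldType) (X : functor K) : Prop :=
  forall (F : fieldType) (phi : {rmorphism K -> F}),
    integral (base_change phi X).

(* X is the scheme-theoretic union of V and W: the smallest closed subscheme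
   of X containing V and W is X. *)
Definition is_union (R : comPzRingType) (X : functor R)
    (V W : subfunctor X) : Prop :=
  forall Z : subfunctor X, closed_sub Z ->
    (forall (A : algebra R) (p : X A), lies_in V p -> lies_in Z p) ->
    (forall (A : algebra R) (p : X A), lies_in W p -> lies_in Z p) ->
    forall (A : algebra R) (p : X A), lies_in Z p.

(** * Projective space *)

Definition row_space (A : comPzRingType) n (E : 'M[A]_n) : 'rV[A]_n -> Prop :=
  fun v => exists w, v = w *m E.

(* [M] is a direct summand of A^n, projective of rank 1: the image of an
   idempotent of A^n which has rank 1 at every point of Spec A. *)
Definition is_line (A : comPzRingType) n (M : 'rV[A]_n -> Prop) : Prop :=
  exists E : 'M[A]_n, [/\ E *m E = E,
    forall v, M v <-> row_space E v
    & forall (F : fieldType) (phi : {rmorphism A -> F}),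
        \rank (map_mx phi E) = 1%N].

Definition push_space (A B : comPzRingType) (f : {rmorphism A -> B}) n
    (M : 'rV[A]_n -> Prop) : 'rV[B]_n -> Prop :=
  fun v => exists m (c : 'I_m -> B) (w : 'I_m -> 'rV[A]_n),
    (forall i, M (w i)) /\ v = \sum_i c i *: map_mx f (w i).

Lemma push_row_space (A B : comPzRingType) (f : {rmorphism A -> B}) n
    (M : 'rV[A]_n -> Prop) (E : 'M[A]_n) :
  (forall v, M v <-> row_space E v) ->
  forall v, push_space f M v <-> row_space (map_mx f E) v.
Proof.
move=> ME v; split.
- case=> m [c [w [Mw ->]]].
  have {}Mw i : exists u, w i = u *m E by case: (ME (w i)) => + _; apply.
  elim: m c w Mw => [|m IH] c w Mw.
    by exists 0; rewrite big_ord0 mul0mx.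
  rewrite big_ord_recl.
  have [|u1 ->] := IH (fun i => c (lift ord0 i)) (fun i => w (lift ord0 i)).
    by move=> i; apply: Mw.
  have [u2 ->] := Mw ord0.
  exists (c ord0 *: map_mx f u2 + u1).
  by rewrite mulmxDl -scalemxAl map_mxM.
- case=> w ->; exists n, (fun i => w 0 i), (fun i => row i E); split.
    by move=> i; apply/ME; exists (delta_mx 0 i); rewrite rowE.
  by rewrite mulmx_sum_row; apply: eq_bigr => i _; rewrite map_row.
Qed.

Lemma is_line_push (A B : comPzRingType) (f : {rmorphism A -> B}) n
    (M : 'rV[A]_n -> Prop) : is_line M -> is_line (push_space f M).
Proof.
case=> E [EE ME rE]; exists (map_mx f E); split.
- by rewrite -map_mxM EE.
- exact: push_row_space.
- move=> F phi; rewrite -(rE F (phi \o f : {rmorphism A -> F})).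
  by congr (\rank _); apply/matrixP => i j; rewrite !mxE.
Qed.

Lemma line_eq (A : comPzRingType) n
    (M N : {M : 'rV[A]_n -> Prop | is_line M}) :
  (forall v, sval M v <-> sval N v) -> M = N.
Proof.
case: M N => [M lM] [N lN] /= MN; apply: eq_sig_hprop => /=.
  by move=> q; apply: proof_irrelevance.
by apply: functional_extensionality => v; apply: propositional_extensionality.
Qed.

Definition projective_space (R : comPzRingType) (n : nat) : functor R.
Proof.
refine (@Functor R (fun A => {M : 'rV[A]_n.+1 -> Prop | is_line M})
  (fun A B f M => exist _ (push_space f (sval M)) (is_line_push f (svalP M)))
  _ _).
- move=> A f fE [M lM]; apply: line_eq => /= v.
  have [E [_ ME _]] := lM; rewrite (push_row_space f ME) ME.
  suff -> : map_mx f E = E by [].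
  by apply/matrixP => i j; rewrite mxE fE.
- move=> A B C f g h hE [M lM]; apply: line_eq => /= v.
  have [E [_ ME _]] := lM.
  rewrite (push_row_space h ME).
  rewrite (push_row_space g (push_row_space f ME)).
  suff -> : map_mx h E = map_mx g (map_mx f E) by [].
  by apply/matrixP => i j; rewrite !mxE hE.
Defined.

(** * R-equivalence and retract rationality *)

Definition rational_point (L : fieldType) (X : functor L) : Type :=
  X (alg_self L).

Definition elementarily_linked (L : fieldType) (X : functor L)
    (P Q : rational_point X) : Prop :=
  exists (U : subfunctor (projective_space L 1)) (h : morphism (sub U) X),
    open_sub U /\
    exists a b : rational_point (sub U), h _ a = P /\ h _ b = Q.

Definition R_equivalent (L : fieldType) (X : functor L) :
    rational_point X -> rational_point X -> Prop :=
  clos_refl_trans (rational_point X) (@elementarily_linked L X).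

Definition is_R_class (L : fieldType) (X : functor L)
    (C : rational_point X -> Prop) : Prop :=
  exists P, C = R_equivalent P.

Definition R_trivial (K : fieldType) (X : functor K) : Prop :=
  forall (F : fieldType) (phi : {rmorphism K -> F}),
  exists! C : rational_point (base_change phi X) -> Prop, is_R_class C.

Definition retract_rational (K : fieldType) (X : functor K) : Prop :=
  exists (U : subfunctor X) (n : nat)
    (W : subfunctor (projective_space K n))
    (f : morphism (sub U) (sub W)) (g : morphism (sub W) (sub U)),
    [/\ open_sub U, nonempty (sub U), open_sub W
      & forall (A : algebra K) (p : sub U A), g A (f A p) = p].

(** * Fibres *)

Definition generic_fibre (R : idomainType) (X : functor R) :
    functor {fraction R} :=
  base_change (@tofrac R : {rmorphism R -> {fraction R}}) X.

Definition special_fibre (R : idomainType) (k : fieldType)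
    (pi : {rmorphism R -> k}) (X : functor R) : functor k :=
  base_change pi X.

(* Main.v *)
(* Let B and C be charts of X at smooth points v in V(k) and w in W(k), and E the
   fraction field of the domain D = B (x)_R C. The two factors give points P and Q
   of X over E which lie in every nonempty open of the generic fibre. By
   smoothness, the special fibre of Spec D is integral near (v, w), so its generic
   point there defines a discrete valuation of E; the residue field kap embeds into
   an iterated Laurent series field over k, hence has a k-valued place and
   T(kap) is empty. The point P specializes into V and Q into W.

   The component on which a point of X(E) specializes does not change along a
   rational curve. A curve is a point x of X over E(t); specialize it with respect
   to the monomial valuations of E(t) extending that of E, ordered by slope. The
   centre of x is constant between consecutive slopes, and the two valuations on
   either side of a wall specialize a common coarser valuation, whose centre lies
   on V or on W: as T(kap) is empty, both lie on the same component. For extreme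
   slopes one gets the specializations of the two ends of the curve.

   So P and Q are not R-equivalent. If g o f = id with f, g through an open of
   projective space, then the line through f(P) and f(Q) would give a rational
   curve from P to Q. *)
Require Import Defs.
From HB Require Import structures.
From mathcomp Require Import all_boot all_order all_algebra.
From mathcomp Require Import boolp ring zify.
From mathcomp Require classical_sets.
From Stdlib Require Import ProofIrrelevance Relation_Operators.
Set Implicit Arguments.
Unset Strict Implicit.
Unset Printing Implicit Defensive.
Import Order.TTheory GRing.Theory Num.Theory.
Local Open Scope ring_scope.

(** * Quotients, fractions and subrings of possibly trivial rings *)

(** As [R] is not assumed henselian, [v] and [w] need not lift to points over K, and a retraction
    only sees some open subset of the generic fibre. Passing to E answers both problems: [v] and [w]
    lift there at once, to points that are generic. The price is a residue field kap larger than k,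
    so that the hypothesis on T(k) has to be transported by properness along a k-valued place.

    The closure of a rational curve over a discrete valuation ring of E is usually controlled by
    blowing up a surface. Monomial valuations of E(t) replace the blow-ups: their residues are read
    off one coefficient and so stay in kap, and only the order of finitely many exponents matters.
    An exponent of degree at most N changes sign at a slope with denominator at most N, so with q =
    N! every wall lies at some n/q.

    Smoothness enters only as a lifting property on thickenings of one rational point. It yields a
    morphism to power series over a polynomial ring, whose kernel is the generic point and whose
    leading coefficients give the place; no theory of regular local rings is involved. *)

Definition ring_hom (A B : comPzRingType) (f : A -> B) : Prop :=
  [/\ forall x y, f (x + y) = f x + f y, forall x y, f (x * y) = f x * f y
    & f 1 = 1].

Lemma rmorphism_of (A B : comPzRingType) (f : A -> B) :
  ring_hom f -> {g : {rmorphism A -> B} | g =1 f}.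
Proof.
case=> fD fM f1.
have fB : {morph f : x y / x - y}.
  by move=> x y; apply: (addIr (f y)); rewrite -fD !subrK.
pose zM := GRing.isZmodMorphism.Build A B f fB.
pose mM := GRing.isMonoidMorphism.Build A B f (conj f1 fM).
by exists (HB.pack_for {rmorphism A -> B} f zM mM).
Qed.

(* Quotients, rings of fractions, subrings and tensor products are all obtained
   as commutative rings up to an equivalence [peq]. *)
Record pre_ring := PreRing {
  pcar :> Type;
  peq : pcar -> pcar -> Prop;
  padd : pcar -> pcar -> pcar;
  pmul : pcar -> pcar -> pcar;
  popp : pcar -> pcar;
  pzero : pcar;
  pone : pcar;
  peqxx : forall x, peq x x;
  peqC : forall x y, peq x y -> peq y x;
  peq_trans : forall x y z, peq x y -> peq y z -> peq x z;
  paddE : forall x x' y y', peq x x' -> peq y y' -> peq (padd x y) (padd x' y');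
  pmulE : forall x x' y y', peq x x' -> peq y y' -> peq (pmul x y) (pmul x' y');
  poppE : forall x x', peq x x' -> peq (popp x) (popp x');
  paddA : forall x y z, peq (padd x (padd y z)) (padd (padd x y) z);
  paddC : forall x y, peq (padd x y) (padd y x);
  padd0 : forall x, peq (padd pzero x) x;
  paddN : forall x, peq (padd (popp x) x) pzero;
  pmulA : forall x y z, peq (pmul x (pmul y z)) (pmul (pmul x y) z);
  pmulC : forall x y, peq (pmul x y) (pmul y x);
  pmul1 : forall x, peq (pmul pone x) x;
  pmulD : forall x y z, peq (pmul (padd x y) z) (padd (pmul x z) (pmul y z)) }.

Section QuotRing.
Variable S : pre_ring.

Definition qring := {c : S -> Prop | exists t, c = peq t}.

Definition qpi (t : S) : qring := exist _ (peq t) (ex_intro _ t erefl).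

Definition qrepr (c : qring) : S := sval (cid (svalP c)).

Lemma qreprK c : qpi (qrepr c) = c.
Proof.
apply: eq_sig_hprop => /=; first by move=> *; apply: proof_irrelevance.
by rewrite -(svalP (cid (svalP c))).
Qed.

Lemma qpiP s t : qpi s = qpi t <-> peq s t.
Proof.
split=> [[st]|st]; first by apply: peqC; rewrite -st; apply: peqxx.
apply: eq_sig_hprop => /=; first by move=> *; apply: proof_irrelevance.
apply/funext => u; apply/propext; split=> [su|tu].
  exact: peq_trans (peqC st) su.
exact: peq_trans st tu.
Qed.

Lemma qind (P : qring -> Prop) : (forall t, P (qpi t)) -> forall c, P c.
Proof. by move=> Pt c; rewrite -(qreprK c). Qed.

Lemma qreprE t : peq (qrepr (qpi t)) t.
Proof. by apply/qpiP; rewrite qreprK. Qed.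

Definition qadd c d := qpi (padd (qrepr c) (qrepr d)).
Definition qmul c d := qpi (pmul (qrepr c) (qrepr d)).
Definition qopp c := qpi (popp (qrepr c)).

Lemma qaddE s t : qadd (qpi s) (qpi t) = qpi (padd s t).
Proof. by apply/qpiP; apply: paddE; apply: qreprE. Qed.
Lemma qmulE s t : qmul (qpi s) (qpi t) = qpi (pmul s t).
Proof. by apply/qpiP; apply: pmulE; apply: qreprE. Qed.
Lemma qoppE s : qopp (qpi s) = qpi (popp s).
Proof. by apply/qpiP; apply: poppE; apply: qreprE. Qed.

HB.instance Definition _ := gen_eqMixin qring.
HB.instance Definition _ := gen_choiceMixin qring.

Fact qaddA : associative qadd.
Proof.
by elim/qind=> x; elim/qind=> y; elim/qind=> z; rewrite !qaddE; apply/qpiP/paddA.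
Qed.
Fact qaddC : commutative qadd.
Proof. by elim/qind=> x; elim/qind=> y; rewrite !qaddE; apply/qpiP/paddC. Qed.
Fact qadd0 : left_id (qpi (pzero S)) qadd.
Proof. by elim/qind=> x; rewrite !qaddE; apply/qpiP/padd0. Qed.
Fact qaddN : left_inverse (qpi (pzero S)) qopp qadd.
Proof. by elim/qind=> x; rewrite qoppE !qaddE; apply/qpiP/paddN. Qed.
HB.instance Definition _ := GRing.isZmodule.Build qring qaddA qaddC qadd0 qaddN.

Fact qmulA : associative qmul.
Proof.
by elim/qind=> x; elim/qind=> y; elim/qind=> z; rewrite !qmulE; apply/qpiP/pmulA.
Qed.
Fact qmulC : commutative qmul.
Proof. by elim/qind=> x; elim/qind=> y; rewrite !qmulE; apply/qpiP/pmulC. Qed.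
Fact qmul1 : left_id (qpi (pone S)) qmul.
Proof. by elim/qind=> x; rewrite !qmulE; apply/qpiP/pmul1. Qed.
Fact qmulD : left_distributive qmul qadd.
Proof.
elim/qind=> x; elim/qind=> y; elim/qind=> z.
by rewrite [qadd (qpi x) _]qaddE !qmulE qaddE; apply/qpiP/pmulD.
Qed.
HB.instance Definition _ :=
  GRing.Zmodule_isComPzRing.Build qring qmulA qmulC qmul1 qmulD.

Lemma qpiD s t : qpi s + qpi t = qpi (padd s t).
Proof. exact: qaddE. Qed.
Lemma qpiM s t : qpi s * qpi t = qpi (pmul s t).
Proof. exact: qmulE. Qed.

End QuotRing.

Definition is_ideal (A : comPzRingType) (I : A -> Prop) : Prop :=
  [/\ I 0, forall x y, I x -> I y -> I (x + y) & forall a x, I x -> I (a * x)].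

Definition is_multiplicative (A : comPzRingType) (M : A -> Prop) : Prop :=
  M 1 /\ forall x y, M x -> M y -> M (x * y).

Lemma ideal_comb (A : comPzRingType) (I : A -> Prop) (a x b y w : A) :
  is_ideal I -> I x -> I y -> w = a * x + b * y -> I w.
Proof. by case=> _ D S Ix Iy ->; apply: D; apply: S. Qed.

Section Fractions.
Variables (A : comPzRingType) (I M : A -> Prop).
Hypotheses (idI : is_ideal I) (mulM : is_multiplicative M).

Let frac := (A * {s : A | M s})%type.
Let feq (x y : frac) := exists u, M u /\ I (u * (x.1 * sval y.2 - y.1 * sval x.2)).
Let fone : {s | M s} := exist _ 1 (proj1 mulM).
Let fprod (x y : {s | M s}) : {s | M s} :=
  exist _ (sval x * sval y) (proj2 mulM _ _ (svalP x) (svalP y)).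

Let feq_of (x y : frac) : x.1 * sval y.2 = y.1 * sval x.2 -> feq x y.
Proof.
move=> xy; exists 1; split; first by case: mulM.
by rewrite xy subrr mulr0; case: idI.
Qed.

(** The ring [A/I] localized at the image of [M]. One construction serves three purposes: [M = {1}]
    gives quotients, [I = 0] gives localizations, and a prime [I] with its complement gives the
    residue field at [I]. *)
Definition frac_pre_ring : pre_ring.
Proof.
refine (@PreRing frac feq
  (fun x y => (x.1 * sval y.2 + y.1 * sval x.2, fprod x.2 y.2))
  (fun x y => (x.1 * y.1, fprod x.2 y.2)) (fun x => (- x.1, x.2))
  (0, fone) (1, fone) _ _ _ _ _ _ _ _ _ _ _ _ _ _).
- by move=> x; apply: feq_of.
- move=> x y [u [Mu Iu]]; exists u; split=> //.
  by apply: (ideal_comb (a := -1) (b := 0) idI Iu Iu); ring.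
- move=> [x [s Ms]] [y [t Mt]] [z [r Mr]] [u [Mu Iu]] [u' [Mu' Iu']] /=.
  exists (u * u' * t); split; first by do 2?[apply: (proj2 mulM)].
  apply: (ideal_comb (a := u' * r) (b := u * s) idI Iu Iu') => /=; ring.
- move=> [x [s Ms]] [x' [s' Ms']] [y [t Mt]] [y' [t' Mt']].
  move=> [u [Mu Iu]] [u' [Mu' Iu']] /=.
  exists (u * u'); split; first by apply: (proj2 mulM).
  apply: (ideal_comb (a := u' * t * t') (b := u * s * s') idI Iu Iu') => /=; ring.
- move=> [x [s Ms]] [x' [s' Ms']] [y [t Mt]] [y' [t' Mt']].
  move=> [u [Mu Iu]] [u' [Mu' Iu']] /=.
  exists (u * u'); split; first by apply: (proj2 mulM).
  apply: (ideal_comb (a := u' * y * t') (b := u * x' * s) idI Iu Iu') => /=; ring.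
- move=> [x [s Ms]] [x' [s' Ms']] [u [Mu Iu]]; exists u; split=> //.
  by apply: (ideal_comb (a := -1) (b := 0) idI Iu Iu) => /=; ring.
- by move=> x y z; apply: feq_of => /=; ring.
- by move=> x y; apply: feq_of => /=; ring.
- by move=> x; apply: feq_of => /=; ring.
- by move=> x; apply: feq_of => /=; ring.
- by move=> x y z; apply: feq_of => /=; ring.
- by move=> x y; apply: feq_of => /=; ring.
- by move=> x; apply: feq_of => /=; ring.
- by move=> x y z; apply: feq_of => /=; ring.
Defined.

Definition frac_ring : comPzRingType := qring frac_pre_ring.

Let to_frac_fun (a : A) : frac_ring := @qpi frac_pre_ring (a, fone).

Let to_frac_hom : ring_hom to_frac_fun.
Proof.
split=> [x y|x y|//].
- by rewrite [RHS]qpiD; apply/qpiP; apply: feq_of => /=; ring.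
- by rewrite [RHS]qpiM; apply/qpiP; apply: feq_of => /=; ring.
Qed.

Definition to_frac : {rmorphism A -> frac_ring} :=
  sval (rmorphism_of to_frac_hom).

Let to_fracE a : to_frac a = @qpi frac_pre_ring (a, fone).
Proof. by rewrite /to_frac; case: rmorphism_of => g /= ->. Qed.

Lemma to_frac0 a : to_frac a = 0 <-> exists u, M u /\ I (u * a).
Proof.
rewrite to_fracE (_ : 0 = @qpi frac_pre_ring (0, fone)) // qpiP.
by split=> -[u [Mu Iu]]; exists u; split=> //; move: Iu;
  rewrite /= mulr1 mul0r subr0.
Qed.

Lemma to_frac_unit s : M s -> exists v, to_frac s * v = 1.
Proof.
move=> Ms; exists (@qpi frac_pre_ring (1, exist _ s Ms)).
rewrite to_fracE [LHS]qpiM; apply/qpiP.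
by apply: feq_of => /=; ring.
Qed.

Lemma frac_ringP c : exists a s, M s /\ c * to_frac s = to_frac a.
Proof.
elim/qind: c => -[a [s Ms]]; exists a, s; split=> //.
rewrite !to_fracE [LHS]qpiM; apply/qpiP.
by apply: feq_of => /=; ring.
Qed.

End Fractions.

Lemma unit_inv_unique (A : comPzRingType) (x y z : A) :
  x * y = 1 -> x * z = 1 -> y = z.
Proof. by move=> xy xz; rewrite -[y]mulr1 -xz mulrA [y * x]mulrC xy mul1r. Qed.

Lemma unit_cancel (A : comPzRingType) (s v x y : A) :
  s * v = 1 -> x * s = y * s -> x = y.
Proof. by move=> sv xy; rewrite -[x]mulr1 -sv mulrA xy -mulrA sv mulr1. Qed.

Lemma frac_univ (A : comPzRingType) (I M : A -> Prop) (idI : is_ideal I)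
    (mulM : is_multiplicative M) (B : comPzRingType) (f : {rmorphism A -> B}) :
  (forall a, I a -> f a = 0) -> (forall s, M s -> exists v, f s * v = 1) ->
  {g : {rmorphism frac_ring idI mulM -> B} | forall a, g (to_frac idI mulM a) = f a}.
Proof.
move=> fI fM; set F := frac_ring idI mulM; set i := to_frac idI mulM.
have num (c : F) : {b : B | exists a s, [/\ M s, c * i s = i a & b * f s = f a]}.
  apply: cid; have [a [s [Ms cs]]] := frac_ringP c.
  have [v sv] := fM s Ms; exists (f a * v), a, s; split=> //.
  by rewrite -mulrA [v * _]mulrC sv mulr1.
pose g c := sval (num c).
have gP c a s : M s -> c * i s = i a -> g c * f s = f a.
  move=> Ms cs; rewrite /g; case: (num c) => b [a' [s' [Ms' cs' bs']]] /=.
  have : i (a * s' - a' * s) = 0.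
    by rewrite rmorphB !rmorphM -cs -cs' /=; ring.
  case/to_frac0 => u [Mu /fI]; rewrite rmorphM rmorphB !rmorphM => /= E.
  have [v uv] := fM u Mu; have [v' sv'] := fM s' Ms'.
  apply: (unit_cancel sv'); apply: (unit_cancel uv).
  by apply/eqP; rewrite -subr_eq0 -[_ * f s * _]mulrAC bs' -oppr_eq0 -E; apply/eqP; ring.
have g_hom : ring_hom g.
  split=> [x y|x y|].
  - have [a [s [Ms xs]]] := frac_ringP x; have [b [t [Mt yt]]] := frac_ringP y.
    have Mst : M (s * t) by apply: (proj2 mulM).
    have [v sv] := fM _ Mst; apply: (unit_cancel sv).
    rewrite (gP _ (a * t + b * s)) //; last first.
      by rewrite rmorphD !rmorphM -xs -yt /=; ring.
    by rewrite rmorphD !rmorphM -(gP _ _ _ Ms xs) -(gP _ _ _ Mt yt) /=; ring.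
  - have [a [s [Ms xs]]] := frac_ringP x; have [b [t [Mt yt]]] := frac_ringP y.
    have Mst : M (s * t) by apply: (proj2 mulM).
    have [v sv] := fM _ Mst; apply: (unit_cancel sv).
    rewrite (gP _ (a * b)) //; last by rewrite !rmorphM -xs -yt /=; ring.
    by rewrite !rmorphM -(gP _ _ _ Ms xs) -(gP _ _ _ Mt yt) /=; ring.
  - have M1 := proj1 mulM; have := gP 1 1 1 M1.
    by rewrite !rmorph1 !mulr1; apply.
have [h hE] := rmorphism_of g_hom; exists h => a; rewrite hE.
have M1 := proj1 mulM; have := gP (i a) a 1 M1.
by rewrite !rmorph1 !mulr1; apply.
Qed.

Section FieldOf.
Variables (A : comPzRingType).
Hypothesis A_field : (1 : A) <> 0 /\ forall x : A, x <> 0 -> exists y, x * y = 1.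

(* The proof is kept in the type, so that the instances below can depend on it. *)
Definition field_of : Type := let _ := A_field in A.

HB.instance Definition _ := GRing.ComPzRing.on field_of.

Fact field_of_neq0 : (1 : field_of) != 0.
Proof. by apply/eqP; case: A_field. Qed.
HB.instance Definition _ := GRing.PzSemiRing_isNonZero.Build field_of field_of_neq0.

Definition field_of_inv (x : field_of) : field_of :=
  match pselect (exists y : A, x * y = 1) with
  | left xy => sval (cid xy)
  | right _ => 0
  end.

Fact field_of_mulVf (x : field_of) : x != 0 -> field_of_inv x * x = 1.
Proof.
move/eqP=> x0; rewrite /field_of_inv; case: pselect => [xy|[]].
  by rewrite mulrC; case: cid.
by case: A_field => _; apply.
Qed.

Fact field_of_inv0 : field_of_inv 0 = 0.
Proof.
rewrite /field_of_inv; case: pselect => // xy; case: (A_field) => -[].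
by case: (xy) => y <-; rewrite mul0r.
Qed.
HB.instance Definition _ :=
  GRing.ComNzRing_isField.Build field_of field_of_mulVf field_of_inv0.

End FieldOf.

(** * Ideals, residue fields and localizations *)

Definition is_prime (A : comPzRingType) (P : A -> Prop) : Prop :=
  [/\ is_ideal P, ~ P 1 & forall x y, P (x * y) -> P x \/ P y].

Lemma ideal0 (A : comPzRingType) (I : A -> Prop) : is_ideal I -> I 0.
Proof. by case. Qed.

Lemma idealD (A : comPzRingType) (I : A -> Prop) x y :
  is_ideal I -> I x -> I y -> I (x + y).
Proof. by case=> _ D _; apply: D. Qed.

Lemma idealMl (A : comPzRingType) (I : A -> Prop) a x :
  is_ideal I -> I x -> I (a * x).
Proof. by case=> _ _; apply. Qed.

Lemma idealMr (A : comPzRingType) (I : A -> Prop) a x :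
  is_ideal I -> I x -> I (x * a).
Proof. by move=> idI Ix; rewrite mulrC; apply: idealMl. Qed.

Lemma ideal_sum (A : comPzRingType) (I : A -> Prop) (T : Type) (r : seq T)
    (P : pred T) (F : T -> A) :
  is_ideal I -> (forall i, P i -> I (F i)) -> I (\sum_(i <- r | P i) F i).
Proof.
by move=> idI IF; elim/big_ind: _ => //;
  [apply: ideal0 | move=> x y; apply: idealD].
Qed.

Lemma prime_residue_field (A : comPzRingType) (P : A -> Prop) : is_prime P ->
  exists (K : fieldType) (f : {rmorphism A -> K}),
    (forall a, f a = 0 <-> P a) /\
    (forall c, exists a s, f s <> 0 /\ c = f a / f s).
Proof.
case=> idP P1 primeP.
have mulM : is_multiplicative (fun s => ~ P s).
  by split=> // x y Px Py /primeP [].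
pose Q := frac_ring idP mulM; pose i := to_frac idP mulM.
have i0 a : i a = 0 <-> P a.
  rewrite to_frac0; split=> [[u [Pu /primeP []//]]|Pa].
  by exists 1; rewrite mul1r.
have Q_field : (1 : Q) <> 0 /\ forall x : Q, x <> 0 -> exists y, x * y = 1.
  split; first by rewrite -(rmorph1 i) i0.
  move=> x x0; have [a [s [Ms xs]]] := frac_ringP x.
  have [v sv] := to_frac_unit idP mulM Ms.
  have Ma : ~ P a.
    by move/i0; rewrite -/i -xs => /(congr1 ( *%R^~ v)); rewrite -mulrA sv mulr1 mul0r.
  have [w aw] := to_frac_unit idP mulM Ma.
  by exists (to_frac idP mulM s * w); rewrite mulrA xs.
exists (field_of Q_field), (i : {rmorphism A -> field_of Q_field}); split=> // c.
have [a [s [Ms xs]]] := @frac_ringP _ _ _ idP mulM c.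
have s0 : (i s : field_of Q_field) <> 0 by move/i0.
exists a, s; split=> //.
by apply: (mulIf (introN eqP s0)); rewrite mulfVK //; apply/eqP.
Qed.

Section Subring.
Variables (A : comPzRingType) (P : A -> Prop).
Hypotheses (P1 : P 1) (PB : forall x y, P x -> P y -> P (x - y))
  (PM : forall x y, P x -> P y -> P (x * y)).

Let P0 : P 0. Proof. by rewrite -(subrr 1); apply: PB. Qed.
Let PN x : P x -> P (- x). Proof. by rewrite -sub0r; apply: PB. Qed.
Let PD x y : P x -> P y -> P (x + y).
Proof. by move=> Px Py; rewrite -[y]opprK; apply: PB => //; apply: PN. Qed.

Definition sub_pre_ring : pre_ring.
Proof.
refine (@PreRing {x | P x} (fun x y => sval x = sval y)
  (fun x y => exist _ (sval x + sval y) (PD (svalP x) (svalP y)))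
  (fun x y => exist _ (sval x * sval y) (PM (svalP x) (svalP y)))
  (fun x => exist _ (- sval x) (PN (svalP x)))
  (exist _ 0 P0) (exist _ 1 P1) _ _ _ _ _ _ _ _ _ _ _ _ _ _) => //=.
- by move=> x y z -> ->.
- by move=> x x' y y' -> ->.
- by move=> x x' y y' -> ->.
- by move=> x x' ->.
- by move=> x y z; rewrite addrA.
- by move=> x y; rewrite addrC.
- by move=> x; rewrite add0r.
- by move=> x; rewrite addNr.
- by move=> x y z; rewrite mulrA.
- by move=> x y; rewrite mulrC.
- by move=> x; rewrite mul1r.
- by move=> x y z; rewrite mulrDl.
Defined.

Lemma subring_exists : exists (S : comPzRingType) (i : {rmorphism S -> A}),
  injective i /\ forall x, P x <-> exists s, i s = x.
Proof.
pose S := sub_pre_ring; pose f (c : qring S) : A := sval (qrepr c).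
have fE x : f (qpi x) = sval x by rewrite /f (qreprE x).
have f_hom : ring_hom f.
  split.
  - by elim/qind=> x; elim/qind=> y; rewrite qpiD !fE.
  - by elim/qind=> x; elim/qind=> y; rewrite qpiM !fE.
  - by rewrite fE.
have [i iE] := rmorphism_of f_hom; exists (qring S), i; split.
  elim/qind=> x; elim/qind=> y; rewrite !iE !fE => xy; exact/qpiP.
move=> x; split=> [Px|[s <-]].
  by exists (qpi (exist P x Px : S)); rewrite iE fE.
by rewrite iE /f; apply: (svalP (qrepr s)).
Qed.

End Subring.

(** Membership is impredicative, so that [ideal_gen_min] acts as an induction principle; finite
    combinations are recovered in [ideal_gen_sum]. *)
Variant ideal_gen (A : comPzRingType) (T : A -> Prop) (x : A) : Prop :=
  IdealGen of forall I : A -> Prop, is_ideal I -> (forall t, T t -> I t) -> I x.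

Lemma ideal_gen_min (A : comPzRingType) (T I : A -> Prop) x :
  ideal_gen T x -> is_ideal I -> (forall t, T t -> I t) -> I x.
Proof. by case=> H idI TI; apply: H. Qed.

Lemma ideal_gen_ideal (A : comPzRingType) (T : A -> Prop) :
  is_ideal (ideal_gen T).
Proof.
split=> [|x y [xT] [yT]|a x [xT]]; split=> I idI TI; first exact: ideal0.
  by apply: idealD => //; [apply: xT | apply: yT].
by apply: idealMl => //; apply: xT.
Qed.

Lemma ideal_gen_sub (A : comPzRingType) (T : A -> Prop) x : T x -> ideal_gen T x.
Proof. by move=> Tx; split=> I _; apply. Qed.

Lemma ideal_gen_sum (A : comPzRingType) (T : A -> Prop) x :
  ideal_gen T x ->
  exists n (t b : 'I_n -> A), (forall i, T (t i)) /\ \sum_i b i * t i = x.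
Proof.
pose J y := exists n (t b : 'I_n -> A), (forall i, T (t i)) /\ \sum_i b i * t i = y.
move/(@ideal_gen_min _ _ J); apply=> [|t Tt]; last first.
  by exists 1%N, (fun=> t), (fun=> 1); rewrite big_ord1 mul1r.
split.
- by exists 0%N, (fun=> 0), (fun=> 0); split; [case | rewrite big_ord0].
- move=> _ _ [n [t [b [Tt <-]]]] [m [u [c [Tu <-]]]].
  exists (n + m)%N, (fun i => match split i with inl j => t j | inr j => u j end),
    (fun i => match split i with inl j => b j | inr j => c j end); split.
    by move=> i; case: split.
  rewrite big_split_ord /=; congr (_ + _); apply: eq_bigr => i _.
    by rewrite (unsplitK (inl i)).
  by rewrite (unsplitK (inr i)).
- move=> a _ [n [t [b [Tt <-]]]]; exists n, t, (fun i => a * b i); split=> //.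
  by rewrite mulr_sumr; apply: eq_bigr => i _; rewrite mulrA.
Qed.

Lemma unit_idealP (A : comPzRingType) (T : A -> Prop) :
  generates_unit_ideal T <-> ideal_gen T 1.
Proof.
split=> [[n [t [b [Tt <-]]]]|]; last exact: ideal_gen_sum.
apply: ideal_sum; first exact: ideal_gen_ideal.
move=> i _; apply: idealMl; first exact: ideal_gen_ideal.
exact: ideal_gen_sub.
Qed.

Lemma ideal_preim (A B : comPzRingType) (f : {rmorphism A -> B}) (I : B -> Prop) :
  is_ideal I -> is_ideal (fun a => I (f a)).
Proof.
move=> idI; split=> [|x y Ix Iy|a x Ix]; first by rewrite rmorph0; apply: ideal0.
  by rewrite rmorphD; apply: idealD.
by rewrite rmorphM; apply: idealMl.
Qed.

Lemma ideal_gen_image (A B : comPzRingType) (f : {rmorphism A -> B}) T x :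
  ideal_gen T x -> ideal_gen (image_set f T) (f x).
Proof.
move=> xT; apply: (ideal_gen_min xT (I := fun a => ideal_gen _ (f a))).
  exact/ideal_preim/ideal_gen_ideal.
by move=> t Tt; apply: ideal_gen_sub; exists t.
Qed.

Lemma zero_ideal (A : comPzRingType) : is_ideal (fun a : A => a = 0).
Proof.
by split=> [//|x y -> ->|a x ->]; rewrite ?addr0 ?mulr0.
Qed.

Lemma ideal_gen_kill (A B : comPzRingType) (f : {rmorphism A -> B}) T x :
  (forall t, T t -> f t = 0) -> ideal_gen T x -> f x = 0.
Proof.
move=> fT /(@ideal_gen_min _ _ (fun a => f a = 0)); apply=> //.
exact: (ideal_preim f (@zero_ideal B)).
Qed.

Lemma ideal_quotient (A : comPzRingType) (I : A -> Prop) : is_ideal I ->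
  exists (B : comPzRingType) (f : {rmorphism A -> B}),
    [/\ forall b, exists a, b = f a, forall a, f a = 0 <-> I a
      & forall (C : comPzRingType) (g : {rmorphism A -> C}),
          (forall a, I a -> g a = 0) ->
          exists h : {rmorphism B -> C}, forall a, h (f a) = g a].
Proof.
move=> idI; have mul1 : is_multiplicative (fun s : A => s = 1).
  by split=> // x y -> ->; rewrite mul1r.
exists (frac_ring idI mul1), (to_frac idI mul1); split.
- move=> b; have [a [s [-> E]]] := frac_ringP b.
  by exists a; rewrite -E rmorph1 mulr1.
- move=> a; rewrite to_frac0; split=> [[u [->]]|Ia]; first by rewrite mul1r.
  by exists 1; rewrite mul1r.
- move=> C g gI; have [s ->|h hE] := frac_univ idI mul1 gI; last by exists h.
  by exists 1; rewrite rmorph1 mul1r.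
Qed.

Lemma powers_multiplicative (A : comPzRingType) (s : A) :
  is_multiplicative (fun x => exists n, x = s ^+ n).
Proof.
split=> [|_ _ [n ->] [m ->]]; first by exists 0%N; rewrite expr0.
by exists (n + m)%N; rewrite exprD.
Qed.

Lemma localization (A : comPzRingType) (s : A) :
  exists (B : comPzRingType) (f : {rmorphism A -> B}),
    [/\ exists v, f s * v = 1, forall b, exists a n, b * f s ^+ n = f a,
        forall a, f a = 0 -> exists n, s ^+ n * a = 0
      & forall (C : comPzRingType) (g : {rmorphism A -> C}),
          (exists v, g s * v = 1) ->
          exists h : {rmorphism B -> C}, forall a, h (f a) = g a].
Proof.
pose I0 := @zero_ideal A; pose Ms := powers_multiplicative s.
exists (frac_ring I0 Ms), (to_frac I0 Ms); split.
- by apply: to_frac_unit; exists 1%N; rewrite expr1.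
- move=> b; have [a [_ [[n ->] E]]] := frac_ringP b.
  by exists a, n; rewrite -rmorphXn.
- by move=> a /to_frac0 [_ [[n ->] E]]; exists n.
- move=> C g [v sv].
  have [_ ->|_ [n ->]|h hE] := frac_univ I0 Ms (f := g); last by exists h.
    by rewrite rmorph0.
  by exists (v ^+ n); rewrite rmorphXn -exprMn sv expr1n.
Qed.

Lemma nilpotent_kill_ideal (A : comPzRingType) (I : A -> Prop) : is_ideal I ->
  is_ideal (fun x => exists n, I (x ^+ n)).
Proof.
move=> idI; split=> [|x y [n xn] [m ym]|c x [n xn]].
- by exists 1%N; rewrite expr1; apply: ideal0.
- exists (n + m)%N; rewrite exprDn; apply: ideal_sum => // -[i /= le_i] _.
  rewrite -mulr_natl; apply: idealMl => //; case: (leqP m i) => [mi|im].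
    by rewrite -(subnK mi) exprD mulrA; apply: idealMl.
  have ni : (n <= n + m - i)%N by rewrite -addnBA ?leq_addr // ltnW.
  by rewrite -(subnK ni) exprD -mulrA mulrCA; apply: idealMr.
- by exists n; rewrite exprMn; apply: idealMl.
Qed.

Lemma annihilator_ideal (A : comPzRingType) (a : A) : is_ideal (fun x => x * a = 0).
Proof.
split=> [|x y xa ya|c x xa]; first by rewrite mul0r.
  by rewrite mulrDl xa ya addr0.
by rewrite -mulrA xa mulr0.
Qed.

(** Vanishing is local on the cover by the D(t): the elements a power of which kills [a] form an
    ideal, which contains [T] and hence 1. *)
Lemma unit_ideal_exp (A : comPzRingType) (T : A -> Prop) (a : A) :
  ideal_gen T 1 -> (forall t, T t -> exists n, t ^+ n * a = 0) -> a = 0.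
Proof.
move=> T1 kill; have idA := annihilator_ideal a.
have [n] : exists n, (1 : A) ^+ n * a = 0.
  exact: (ideal_gen_min T1 (nilpotent_kill_ideal idA)).
by rewrite expr1n mul1r.
Qed.

(** If [a] in the ideal of [T] maps to 1, then [1 - a] is nilpotent and [a] is a unit.
    Geometrically, an open set that contains the reduction of a thickening contains the
    thickening. *)
Lemma unit_ideal_lift (A B : comPzRingType) (f : {rmorphism A -> B}) T :
  (forall b, exists a, f a = b) -> (forall a, f a = 0 -> exists n, a ^+ n = 0) ->
  ideal_gen (image_set f T) 1 -> ideal_gen T 1.
Proof.
have idT := ideal_gen_ideal T; move=> f_surj nil.
move/(@ideal_gen_min _ _ (fun b => exists a, ideal_gen T a /\ f a = b)).
case=> [|t [a [Ta ->]]|a [Ia fa]].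
- split=> [|x y [a [Ta <-]] [b [Tb <-]]|c x [a [Ta <-]]].
  + by exists 0; rewrite rmorph0; split=> //; apply: ideal0.
  + by exists (a + b); rewrite rmorphD; split=> //; apply: idealD.
  + have [d <-] := f_surj c; exists (d * a); rewrite rmorphM; split=> //.
    by apply: idealMl.
- by exists a; split=> //; apply: ideal_gen_sub.
- have [|n n0] := nil (1 - a); first by rewrite rmorphB rmorph1 fa subrr.
  have : (1 - a) ^+ n - 1 = - a * \sum_(i < n) (1 - a) ^+ i.
    by rewrite subrX1; congr (_ * _); ring.
  by rewrite n0 sub0r mulNr => /oppr_inj ->; apply: idealMr.
Qed.

Lemma maximal_residue_field (A : comPzRingType) (I : A -> Prop) :
  is_ideal I -> ~ I 1 ->
  exists (K : fieldType) (f : {rmorphism A -> K}), forall a, I a -> f a = 0.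
Proof.
move=> idI I1.
pose gen (X : A -> Prop) := ideal_gen (fun a => I a \/ X a).
have gen_mono (X Y : A -> Prop) a : (forall x, X x -> Y x) -> gen X a -> gen Y a.
  move=> XY [Xa]; split=> J idJ XJ; apply: Xa => // t [It|Xt]; apply: XJ.
    by left.
  by right; apply: XY.
have [F FP totF|J [J1 Jmax]] :=
    @classical_sets.Zorn_bigcup A (fun X => ~ gen X 1).
  move=> F1.
  (* The union of the ideals along the chain; the first disjunct is there for the empty chain. *)
  pose G a := gen (fun=> False) a \/ exists X, F X /\ gen X a.
  have idX X : is_ideal (gen X) by apply: ideal_gen_ideal.
  have idG : is_ideal G.
    split=> [|x y|a x].
    - by left; apply: ideal0.
    - case=> [Gx|[X [FX Gx]]] [Gy|[Y [FY Gy]]].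
      + by left; apply: idealD.
      + right; exists Y; split=> //; apply: idealD => //.
        by apply: gen_mono Gx => z [].
      + right; exists X; split=> //; apply: idealD => //.
        by apply: gen_mono Gy => z [].
      + have [XY|YX] := totF _ _ FX FY; right.
          exists Y; split=> //; apply: idealD => //.
          by apply: gen_mono Gx.
        exists X; split=> //; apply: idealD => //.
        by apply: gen_mono Gy.
    - case=> [Gx|[X [FX Gx]]].
        by left; apply: idealMl.
      by right; exists X; split=> //; apply: idealMl.
  have [t|G1|[X [FX /FP]]//] := ideal_gen_min F1 idG.
    move=> [It|[X FX Xt]]; first by left; apply: ideal_gen_sub; left.
    by right; exists X; split=> //; apply: ideal_gen_sub; right.
  by apply: I1; apply: (ideal_gen_min G1 idI) => t [].
have idJ : is_ideal (gen J) by apply: ideal_gen_ideal.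
have max a : ~ gen J a -> exists b c, gen J b /\ 1 = b + c * a.
  move=> Ja; have idJa : is_ideal (fun x => exists b c, gen J b /\ x = b + c * a).
    split=> [|_ _ [b [c [Jb ->]]] [b' [c' [Jb' ->]]]|d _ [b [c [Jb ->]]]].
    - by exists 0, 0; rewrite mul0r addr0; split=> //; apply: ideal0.
    - exists (b + b'), (c + c'); split; first exact: idealD.
      by rewrite mulrDl addrACA.
    - by exists (d * b), (d * c); rewrite mulrDr mulrA; split=> //; apply: idealMl.
  apply: contrapT => no; apply: (Jmax (fun x => J x \/ x = a)).
    split; last by move=> H; apply: Ja; apply: ideal_gen_sub; right; apply: H; right.
    by move=> x; left.
  move=> H; apply: no; apply: (ideal_gen_min H idJa) => t [It|[Jt|->]].
  - by exists t, 0; rewrite mul0r addr0; split=> //; apply: ideal_gen_sub; left.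
  - by exists t, 0; rewrite mul0r addr0; split=> //; apply: ideal_gen_sub; right.
  - by exists 0, 1; rewrite mul1r add0r; split=> //; apply: ideal0.
have primeJ : is_prime (gen J).
  split=> // x y Jxy; have [Jx|/max [b [c [Jb E]]]] := EM (gen J x); first by left.
  right; rewrite -[y]mul1r E mulrDl; apply: idealD => //; first exact: idealMr.
  by rewrite -mulrA; apply: idealMl.
have [K [f [f0 _]]] := prime_residue_field primeJ.
by exists K, f => a Ia; apply/f0; apply: ideal_gen_sub; left.
Qed.

(** * Algebras, open and closed subfunctors *)

Definition push_alg (R : comPzRingType) (A : algebra R) (B : comPzRingType)
    (f : {rmorphism A -> B}) : algebra R :=
  Alg (f \o alg_map A : {rmorphism R -> B}).

Definition push_hom (R : comPzRingType) (A : algebra R) (B : comPzRingType)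
    (f : {rmorphism A -> B}) : alg_hom A (push_alg f) :=
  @AlgHom R A (push_alg f) f (fun r => erefl).

Definition comp_hom (R : comPzRingType) (A B C : algebra R)
    (g : alg_hom B C) (f : alg_hom A B) : alg_hom A C.
Proof.
by exists (g \o f : {rmorphism A -> C}) => r /=; rewrite !alg_hom_comm.
Defined.

Definition id_hom (R : comPzRingType) (A : algebra R) : alg_hom A A :=
  @AlgHom R A A (idfun : {rmorphism A -> A}) (fun r => erefl).

Lemma fmap_compE (R : comPzRingType) (X : functor R) (A B C : algebra R)
    (g : alg_hom B C) (f : alg_hom A B) (p : X A) :
  fmap g (fmap f p) = fmap (comp_hom g f) p.
Proof. by symmetry; apply: fmap_comp. Qed.

Lemma fmap_idE (R : comPzRingType) (X : functor R) (A : algebra R) (p : X A) :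
  fmap (id_hom A) p = p.
Proof. exact: fmap_id. Qed.

Lemma eq_fmap (R : comPzRingType) (X : functor R) (A B : algebra R)
    (f g : alg_hom A B) (p : X A) : f =1 g -> fmap f p = fmap g p.
Proof.
by move=> fg; rewrite -[RHS]fmap_idE; apply: fmap_comp => a /=; apply: fg.
Qed.

Lemma fmap_restrict_id (R S : comPzRingType) (phi : {rmorphism R -> S})
    (X : functor R) (A : algebra S) (p : X (restrict phi A)) :
  fmap (restrict_hom phi (id_hom A)) p = p.
Proof. exact: fmap_id. Qed.

Lemma fmap_restrict_comp (R S : comPzRingType) (phi : {rmorphism R -> S})
    (X : functor R) (A B C : algebra S) (g : alg_hom B C) (f : alg_hom A B)
    (p : X (restrict phi A)) :
  fmap (restrict_hom phi g) (fmap (restrict_hom phi f) p) =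
  fmap (restrict_hom phi (comp_hom g f)) p.
Proof. by symmetry; apply: fmap_comp. Qed.

Lemma alg_localization (R : comPzRingType) (A : algebra R) (s : A) :
  exists (B : algebra R) (l : alg_hom A B),
    [/\ exists v, l s * v = 1, forall b, exists a n, b * l s ^+ n = l a,
        forall a, l a = 0 -> exists n, s ^+ n * a = 0
      & forall (C : algebra R) (g : alg_hom A C), (exists v, g s * v = 1) ->
          exists h : alg_hom B C, forall a, h (l a) = g a].
Proof.
have [B [f [f_unit f_frac f_ker f_univ]]] := localization s.
exists (push_alg f), (push_hom f); split=> // C g /f_univ [h hE].
by exists (@AlgHom R (push_alg f) C h (fun r => etrans (hE _) (alg_hom_comm g r))).
Qed.

Lemma alg_quotient (R : comPzRingType) (A : algebra R) (I : A -> Prop) :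
  is_ideal I ->
  exists (B : algebra R) (q : alg_hom A B),
    [/\ forall b, exists a, b = q a, forall a, q a = 0 <-> I a
      & forall (C : algebra R) (g : alg_hom A C), (forall a, I a -> g a = 0) ->
          exists h : alg_hom B C, forall a, h (q a) = g a].
Proof.
case/ideal_quotient=> B [f [f_surj f_ker f_univ]].
exists (push_alg f), (push_hom f); split=> // C g /f_univ [h hE].
by exists (@AlgHom R (push_alg f) C h (fun r => etrans (hE _) (alg_hom_comm g r))).
Qed.

Section Carving.
Variables (R : comPzRingType) (X : functor R).

Definition carves (Z : subfunctor X) (A : algebra R) (p : X A) (S : A -> Prop) :=
  forall (B : algebra R) (f : alg_hom A B),
    lies_in Z (fmap f p) <-> (forall a, S a -> f a = 0).

Definition opens (U : subfunctor X) (A : algebra R) (p : X A) (S : A -> Prop) :=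
  forall (B : algebra R) (f : alg_hom A B),
    lies_in U (fmap f p) <-> ideal_gen (image_set f S) 1.

Lemma opens_exists (U : subfunctor X) (A : algebra R) (p : X A) :
  open_sub U -> exists S, opens U p S.
Proof.
move=> /(_ A p) [S SP]; exists S => B f.
by rewrite SP; split=> /unit_idealP.
Qed.

Lemma carves_lies Z A (p : X A) S :
  carves Z p S -> (lies_in Z p <-> forall a, S a -> a = 0).
Proof. by move=> /(_ A (id_hom A)); rewrite fmap_idE. Qed.

Lemma opens_lies U A (p : X A) S :
  opens U p S -> (lies_in U p <-> ideal_gen S 1).
Proof.
move=> /(_ A (id_hom A)); rewrite fmap_idE => ->.
suff -> : image_set (id_hom A) S = S by [].
apply/funext => a; apply/propext; split=> [[b [Sb ->]]//|Sa]; by exists a.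
Qed.

Lemma carves_fmap Z A B (p : X A) S (f : alg_hom A B) :
  carves Z p S -> carves Z (fmap f p) (image_set f S).
Proof.
move=> pS C g; rewrite fmap_compE pS; split=> [H _ [a [Sa ->]]|H a Sa].
  exact: H.
by apply: H; exists a.
Qed.

(** The quotient by the ideal of [S] is a test algebra where the point lies in [Z], so [S'] vanishes
    there: the ideal cut out by [Z] is well defined. *)
Lemma carves_ideal Z A (p : X A) S S' a :
  carves Z p S -> carves Z p S' -> S' a -> ideal_gen S a.
Proof.
move=> pS pS' Sa.
have [B [q [_ q_ker _]]] := alg_quotient (ideal_gen_ideal S).
apply/q_ker; apply/pS': a Sa; apply/pS => a Sa.
by apply/q_ker/ideal_gen_sub.
Qed.

(** An injective ring morphism detects the vanishing of every equation of [Z]. This is how closed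
    conditions pass from a generic point to its specializations. *)
Lemma closed_inj Z A B (p : X A) (f : alg_hom A B) :
  closed_sub Z -> injective f -> lies_in Z (fmap f p) -> lies_in Z p.
Proof.
move=> /(_ A p) [S pS] inj_f; move/pS=> fS.
apply/(carves_lies pS) => a /fS; rewrite -(rmorph0 f); exact: inj_f.
Qed.

End Carving.

Lemma separated_inj (R : comPzRingType) (X : functor R) (A B : algebra R)
    (p q : X A) (f : alg_hom A B) :
  separated X -> injective f -> fmap f p = fmap f q -> p = q.
Proof.
move=> sepX inj_f pq.
exact: (@closed_inj _ _ (diagonal X) A B (p, q) f sepX inj_f pq).
Qed.

Lemma field_unit_ideal (F : fieldType) (T : F -> Prop) :
  ideal_gen T 1 <-> exists2 t, T t & t <> 0.
Proof.
split=> [T1|[t Tt /eqP t0]]; last first.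
  rewrite -(mulVf t0); apply: idealMl; first exact: ideal_gen_ideal.
  exact: ideal_gen_sub.
apply: contrapT => no; have := oner_neq0 F; move/eqP; apply.
apply: (ideal_gen_min T1 (@zero_ideal F)) => t Tt.
by apply: contrapT => t0; apply: no; exists t.
Qed.

Lemma affine_openP (R : comPzRingType) (X : functor R) (U : subfunctor X) B :
  affine_open U B <-> open_sub U /\ exists u : X B, lies_in U u /\
    forall (A : algebra R) (p : X A), lies_in U p ->
      exists h : alg_hom B A, fmap h u = p /\
        forall h' : alg_hom B A, fmap h' u = p -> h' =1 h.
Proof.
split=> -[oU]; last first.
  case=> u [Uu uP]; split=> //; exists (exist _ u Uu) => A [p Up] /=.
  have [h [hp h_uniq]] := uP A p Up; exists h; split.
    by apply: eq_sig_hprop => //= *; apply: proof_irrelevance.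
  by move=> h' /(congr1 sval) /=; apply: h_uniq.
case=> -[u Uu] uP; split=> //; exists u; split=> // A p Up.
have [h [hp h_uniq]] := uP A (exist _ p Up); exists h; split.
  exact: (congr1 sval hp).
move=> h' h'p; apply: h_uniq.
by apply: eq_sig_hprop => //= *; apply: proof_irrelevance.
Qed.

Section ClosedLocal.
Variables (R : comPzRingType) (X : functor R) (Z : subfunctor X).

Hypothesis Z_local : forall (A : algebra R) (p : X A) (T : A -> Prop),
  ideal_gen T 1 ->
  (forall s, T s -> forall (B : algebra R) (l : alg_hom A B),
     (exists v, l s * v = 1) -> lies_in Z (fmap l p)) ->
  lies_in Z p.

Hypothesis Z_carved : forall (A : algebra R) (p : X A),
  exists2 T : A -> Prop, ideal_gen T 1 &
  forall s, T s -> forall (B : algebra R) (l : alg_hom A B),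
    (exists v, l s * v = 1) -> exists S, carves Z (fmap l p) S.

(** Over D(st) the equations of [Z] found on D(s) and on D(t) generate the same ideal, so an
    equation [a / s^n] on D(s) becomes, times a power of [s], an equation on D(t). The exponent [m]
    does not depend on the test algebra, whereas [k] does. *)
Let spread (A : algebra R) (p : X A) (s t : A) (L : algebra R)
    (l : alg_hom A L) (S : L -> Prop) (a : A) (c : L) n :
  (forall (C : algebra R) (g : alg_hom A C), (exists v, g s * v = 1) ->
     exists h : alg_hom L C, forall a, h (l a) = g a) ->
  carves Z (fmap l p) S -> S c -> c * l s ^+ n = l a ->
  (forall (B : algebra R) (l : alg_hom A B),
    (exists v, l t * v = 1) -> exists S, carves Z (fmap l p) S) ->
  exists m, forall (B : algebra R) (f : alg_hom A B), lies_in Z (fmap f p) ->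
    exists k, f t ^+ k * f (s ^+ m * a) = 0.
Proof.
move=> l_univ lS Sc ca carved_t.
have [L' [l' [l'_unit _ _ l'_univ]]] := alg_localization t.
have [S' lS'] := carved_t _ _ l'_unit.
have [Q [q [_ q_ker _]]] := alg_quotient (ideal_gen_ideal S').
have [Q' [r [r_unit _ r_ker _]]] := alg_localization (q (l' s)).
have [h hE] := l_univ _ (comp_hom r (comp_hom q l')) r_unit.
have hE' : fmap h (fmap l p) = fmap r (fmap q (fmap l' p)).
  by rewrite !fmap_compE; apply: eq_fmap.
have hc : h c = 0.
  apply: (proj1 (lS _ h) _ c Sc); rewrite hE'; apply/lies_in_fmap/lS' => a' S'a.
  exact/q_ker/ideal_gen_sub.
have [m] : exists m, q (l' s) ^+ m * q (l' a) = 0.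
  by apply: r_ker; rewrite -[LHS]hE -ca rmorphM hc mul0r.
rewrite -rmorphXn -rmorphM => /q_ker {hE}; rewrite -rmorphXn -rmorphM => S'a.
exists m => B f Zfp.
have [L2 [l2 [l2_unit _ l2_ker _]]] := alg_localization (f t).
have [g gE] := l'_univ _ (comp_hom l2 f) l2_unit.
apply: l2_ker; rewrite -[LHS]gE; apply: ideal_gen_kill S'a.
apply/(lS' _ g); have -> : fmap g (fmap l' p) = fmap l2 (fmap f p).
  by rewrite !fmap_compE; apply: eq_fmap.
exact: lies_in_fmap.
Qed.

Lemma closed_sub_local : closed_sub Z.
Proof.
move=> A p; have [T T1 carved] := Z_carved p.
(* The largest candidate: all functions vanishing wherever the point lies in [Z]. What has to be
   shown is that there are enough of them. *)
exists (fun a => forall (B : algebra R) (f : alg_hom A B),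
  lies_in Z (fmap f p) -> f a = 0) => B f.
split=> [Zfp a|f0]; first by apply.
have fT1 := ideal_gen_image f T1; rewrite rmorph1 in fT1.
apply: (Z_local fT1) => _ [s [Ts ->]] B' l' l's_unit.
have [L [l [l_unit l_frac _ l_univ]]] := alg_localization s.
have [S lS] := carved s Ts L l l_unit.
have [g gE] := l_univ _ (comp_hom l' f) l's_unit.
have -> : fmap l' (fmap f p) = fmap g (fmap l p).
  by rewrite !fmap_compE; apply: eq_fmap => a /=; rewrite gE.
apply/lS => c Sc; have [a [n ca]] := l_frac c.
have [m sma] : exists m, forall (C : algebra R) (e : alg_hom A C),
    lies_in Z (fmap e p) -> e (s ^+ m * a) = 0.
  have [N [t [b [Tt sum1]]]] := ideal_gen_sum T1.
  have /choice[m mP] : forall i, exists m, forall (C : algebra R) (e : alg_hom A C),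
      lies_in Z (fmap e p) -> exists k, e (t i) ^+ k * e (s ^+ m * a) = 0.
    move=> i; have [m mP] := spread l_univ lS Sc ca (carved _ (Tt i)).
    by exists m.
  (* A finite subcover makes the exponent of [s] uniform. *)
  exists (\max_i m i)%N => C e Zep.
  apply: (@unit_ideal_exp _ (fun y => exists i, y = e (t i))).
    rewrite -(rmorph1 e) -sum1 rmorph_sum; apply: ideal_sum => [|i _].
      exact: ideal_gen_ideal.
    rewrite rmorphM; apply: idealMl; first exact: ideal_gen_ideal.
    by apply: ideal_gen_sub; exists i.
  move=> _ [i ->]; have [k kP] := mP i C e Zep; exists k.
  have le_m : (m i <= \max_i m i)%N by apply: leq_bigmax.
  rewrite -(subnK le_m) exprD -mulrA rmorphM mulrCA.
  by rewrite kP mulr0.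
have : f (s ^+ m * a) = 0 by apply: f0 => C e; apply: sma.
have [v sv] := l's_unit; move/(congr1 l'); rewrite rmorph0 !rmorphM !rmorphXn /=.
have gla : g (l a) = l' (f a) by rewrite gE.
have gls : g (l s) = l' (f s) by rewrite gE.
rewrite -gla -ca rmorphM rmorphXn gls /= => E.
have: v ^+ m * v ^+ n * (l' (f s) ^+ m * (g c * l' (f s) ^+ n)) = 0.
  by rewrite E mulr0.
have -> : v ^+ m * v ^+ n * (l' (f s) ^+ m * (g c * l' (f s) ^+ n)) =
  (l' (f s) * v) ^+ m * (l' (f s) * v) ^+ n * g c by rewrite !exprMn; ring.
by rewrite sv !expr1n !mul1r.
Qed.

End ClosedLocal.

(** * The valuative criterion *)

(** The map [res] is only required to be local, not surjective: [kap] may be larger than the residue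
    field. *)
Definition valuation_ring (Ov : comPzRingType) (F kap : fieldType)
    (i : {rmorphism Ov -> F}) (res : {rmorphism Ov -> kap}) : Prop :=
  [/\ injective i, forall y, (exists o, i o = y) \/ (exists o, i o * y = 1)
    & forall o, res o <> 0 -> exists o', o * o' = 1].

Section ValuativeCriterion.
Variables (R : comPzRingType) (X : functor R) (Ov : algebra R) (F kap : fieldType).
Variables (i : {rmorphism Ov -> F}) (res : {rmorphism Ov -> kap}).
Hypothesis val : valuation_ring i res.
Variable x : X (push_alg i).
Variables (N : nat) (U : 'I_N -> subfunctor X) (C : 'I_N -> algebra R)
  (u : forall j, X (C j)).
Hypothesis U_open : forall j, open_sub (U j).
Hypothesis U_u : forall j, lies_in (U j) (u j).
Hypothesis u_univ : forall j (A : algebra R) (p : X A), lies_in (U j) p ->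
  exists h : alg_hom (C j) A, fmap h (u j) = p /\
    forall h' : alg_hom (C j) A, fmap h' (u j) = p -> h' =1 h.
Hypothesis U_cover : forall (K : fieldType) (phi : {rmorphism R -> K})
  (p : X (Alg phi)), exists j, lies_in (U j) p.

Let XO := base_change (alg_map Ov) X.

(* Relations over [Ov] between functions on the chart [C j] that hold at the
   point [x]: an element of [Ov (x) C j] is written as a formal sum. *)
Let relation j (s : seq (Ov * C j)) : Prop :=
  forall g : alg_hom (C j) (push_alg i), fmap g (u j) = x ->
    \sum_(oc <- s) i oc.1 * g oc.2 = 0.

Let vanishes (A : algebra Ov) (p : XO A) : Prop :=
  forall j (B : algebra Ov) (f : alg_hom A B)
    (h : alg_hom (C j) (restrict (alg_map Ov) B)),
  fmap h (u j) = fmap (restrict_hom (alg_map Ov) f) p ->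
  forall s, relation s -> \sum_(oc <- s) alg_map B oc.1 * h oc.2 = 0.

(** The scheme-theoretic closure of [x] in [X] over [Ov]. Testing the relations on all charts at
    once makes it functorial without gluing; [closure_closed] shows that locally one chart
    suffices. *)
Definition closure_of_point : subfunctor XO.
Proof.
refine (@Subfunctor _ XO vanishes _) => A B f p p0 j B' f' h E s rel_s.
apply: (p0 j B' (comp_hom f' f) h) => //; rewrite E.
exact: fmap_restrict_comp.
Defined.

Let closure_local (A : algebra Ov) (p : XO A) (T : A -> Prop) :
  ideal_gen T 1 ->
  (forall s, T s -> forall (B : algebra Ov) (l : alg_hom A B),
     (exists v, l s * v = 1) -> lies_in closure_of_point (fmap l p)) ->
  lies_in closure_of_point p.
Proof.
move=> T1 Tp j B f h E s rel_s.
have fT1 := ideal_gen_image f T1; rewrite rmorph1 in fT1.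
apply: (unit_ideal_exp fT1) => _ [t [Tt ->]].
have [B' [l [l_unit _ l_ker _]]] := alg_localization (f t).
apply: l_ker; rewrite rmorph_sum.
have := Tp t Tt B' (comp_hom l f) l_unit j B' (id_hom B')
  (comp_hom (restrict_hom (alg_map Ov) l) h).
rewrite -fmap_compE E => /(_ _ s rel_s) H.
rewrite -[RHS]H; first by apply: eq_bigr => oc _; rewrite rmorphM /= alg_hom_comm.
rewrite fmap_restrict_id; exact: fmap_restrict_comp.
Qed.

Let U_at (A : algebra Ov) (p : XO A) : A -> Prop := fun s =>
  exists j, forall (B : algebra Ov) (l : alg_hom A B), (exists v, l s * v = 1) ->
    lies_in (U j) (fmap (restrict_hom (alg_map Ov) l) p).

Let U_at1 (A : algebra Ov) (p : XO A) : ideal_gen (U_at p) 1.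
Proof.
apply: contrapT => no.
have [K [f f0]] := maximal_residue_field (@ideal_gen_ideal _ (U_at p)) no.
pose fh := push_hom f.
have [j Uj] := U_cover (fmap (restrict_hom (alg_map Ov) fh) p).
have [S pS] := opens_exists (U := U j) p (U_open j).
move/pS/field_unit_ideal: Uj => [_ [s [Ss ->]]]; apply; apply: f0.
apply: ideal_gen_sub; exists j => B l [v lsv]; apply/pS.
rewrite -lsv; apply: idealMr; first exact: ideal_gen_ideal.
by apply: ideal_gen_sub; exists s.
Qed.

Let u_inj j (A : algebra R) (g g' : alg_hom (C j) A) :
  fmap g (u j) = fmap g' (u j) -> g =1 g'.
Proof.
move=> E c; have Ug : lies_in (U j) (fmap g (u j)) by apply: lies_in_fmap.
by have [e [_ e_uniq]] := u_univ Ug; rewrite (e_uniq g) // (e_uniq g').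
Qed.

Let common_denominator (A G : comPzRingType) (l : {rmorphism A -> G}) (g : A)
    (T : Type) (s : seq (T * G)) :
  (forall b, exists a n, b * l g ^+ n = l a) ->
  exists N (s' : seq (T * A)),
    [seq (oc.1, oc.2 * l g ^+ N) | oc <- s] = [seq (oc.1, l oc.2) | oc <- s'].
Proof.
move=> l_frac; elim: s => [|[o c] s [n [s' E]]]; first by exists 0%N, [::].
have [a [m ca]] := l_frac c.
exists (n + m)%N, ((o, a * g ^+ n) :: [seq (oc.1, oc.2 * g ^+ m) | oc <- s']) => /=.
rewrite rmorphM rmorphXn -ca -mulrA -exprD addnC; congr cons.
elim: s s' E => [|[o1 c1] s IH] [|[o2 c2] s'] //= [-> E1 E2].
by rewrite (IH s') // rmorphM rmorphXn -E1 -mulrA -exprD (addnC n).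
Qed.

(** A relation on the chart [j'] is moved to the part D(g) of the chart [j], which maps to both. The
    extra factor [g] makes it hold also when [x] lies in the chart [j] but outside D(g). *)
Let relation_transfer j j' (G : algebra R) (l : alg_hom (C j) G) (g : C j)
    (h : alg_hom (C j') G) (s' : seq (Ov * C j')) (s : seq (Ov * C j)) n :
  (forall (D : algebra R) (e : alg_hom (C j) D), (exists v, e g * v = 1) ->
     exists e' : alg_hom G D, forall a, e' (l a) = e a) ->
  fmap h (u j') = fmap l (u j) ->
  [seq (oc.1, h oc.2 * l g ^+ n) | oc <- s'] = [seq (oc.1, l oc.2) | oc <- s] ->
  relation s' -> relation [seq (oc.1, g * oc.2) | oc <- s].
Proof.
move=> l_univ E es rel_s' e ex.
have [eg0|eg0] := EM (e g = 0).
  by rewrite big_map big1 // => oc _ /=; rewrite rmorphM eg0 mul0r mulr0.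
have [|e' e'E] := l_univ _ e.
  by exists (e g)^-1; rewrite mulfV //; apply/eqP.
have /rel_s' : fmap (comp_hom e' h) (u j') = x.
  by rewrite -ex -fmap_compE E fmap_compE; apply: eq_fmap.
move/(congr1 ( *%R^~ (e g ^+ n.+1))); rewrite mul0r mulr_suml => E0.
rewrite -[RHS]E0 big_map /=.
transitivity (e g * \sum_(oc <- [seq (oc.1, l oc.2) | oc <- s]) i oc.1 * e' oc.2).
  by rewrite big_map mulr_sumr; apply: eq_bigr => oc _ /=; rewrite rmorphM e'E; ring.
rewrite -es big_map mulr_sumr; apply: eq_bigr => oc _ /=.
rewrite rmorphM rmorphXn e'E exprS; ring.
Qed.

Let closure_closed : closed_sub closure_of_point.
Proof.
apply: closed_sub_local closure_local _ => A p; exists (U_at p); first exact: U_at1.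
move=> t [j Uj] B l l_unit.
have [h [hE _]] := u_univ (Uj B l l_unit).
exists (fun b => exists2 s : seq (Ov * C j), relation s &
  b = \sum_(oc <- s) alg_map B oc.1 * h oc.2) => B2 f2; split.
  move=> Z2 _ [s rel_s ->]; rewrite rmorph_sum.
  rewrite -[RHS](Z2 j B2 (id_hom _) (comp_hom (restrict_hom (alg_map Ov) f2) h) _ s rel_s).
    by apply: eq_bigr => oc _; rewrite rmorphM /= alg_hom_comm.
  by rewrite fmap_restrict_id -fmap_compE hE.
move=> S0 j' B3 f3 h' h'E s' rel_s'.
pose H := comp_hom (restrict_hom (alg_map Ov) f3)
  (comp_hom (restrict_hom (alg_map Ov) f2) h).
have HE : fmap H (u j) = fmap h' (u j').
  by rewrite h'E -!fmap_compE hE.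
have [S' uS'] := opens_exists (U := U j') (u j) (U_open j').
have HS' : ideal_gen (image_set H S') 1.
  by apply/uS'; rewrite HE; apply: lies_in_fmap.
apply: (unit_ideal_exp HS') => _ [g [S'g ->]].
have [G [lg [lg_unit lg_frac _ lg_univ]]] := alg_localization g.
have Ug : lies_in (U j') (fmap lg (u j)).
  apply/uS'; have [v <-] := lg_unit; apply: idealMr; first exact: ideal_gen_ideal.
  by apply: ideal_gen_sub; exists g.
have [h2 [h2E _]] := u_univ Ug.
have [n [s es]] := common_denominator [seq (oc.1, h2 oc.2) | oc <- s'] lg_frac.
rewrite -map_comp in es.
have rel_s : relation [seq (oc.1, g * oc.2) | oc <- s].
  exact: (relation_transfer lg_univ h2E es rel_s').
have [B4 [l4 [l4_unit _ l4_ker _]]] := alg_localization (H g : B3).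
suff : l4 (H g ^+ n.+1 * \sum_(oc <- s') alg_map B3 oc.1 * h' oc.2) = 0.
  move/l4_ker=> [m]; rewrite mulrA -exprD => E; by exists (m + n.+1)%N.
have [m mE] := lg_univ _ (comp_hom (restrict_hom (alg_map Ov) l4) H) l4_unit.
have mh c : m (h2 c) = l4 (h' c).
  apply: (u_inj (g := comp_hom m h2) (g' := comp_hom (restrict_hom (alg_map Ov) l4) h')).
  rewrite -[RHS]fmap_compE -HE -fmap_compE h2E !fmap_compE.
  by apply: eq_fmap => a; rewrite /= mE.
have -> : l4 (H g ^+ n.+1 * \sum_(oc <- s') alg_map B3 oc.1 * h' oc.2) =
    l4 (f3 (f2 (\sum_(oc <- [seq (oc.1, g * oc.2) | oc <- s])
      alg_map B oc.1 * h oc.2))).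
  rewrite rmorphM rmorphXn !rmorph_sum big_map.
  transitivity (m (lg g) * \sum_(oc <- [seq (oc.1, lg oc.2) | oc <- s])
      alg_map B4 oc.1 * m oc.2).
    rewrite -es big_map mE /= exprS -mulrA; congr (_ * _); rewrite mulr_sumr.
    apply: eq_bigr => oc _ /=; rewrite !rmorphM rmorphXn -mh mE /= alg_hom_comm; ring.
  rewrite big_map mulr_sumr; apply: eq_bigr => oc _ /=.
  by rewrite !rmorphM /= !mE /= !alg_hom_comm; ring.
by rewrite S0 ?rmorph0 //; exists [seq (oc.1, g * oc.2) | oc <- s].
Qed.

(** The image in Spec [Ov] of the closure of [x] is closed and contains the generic point, hence the
    closed point too: the closure has a point [z] there. Every relation of [x] holds at [z], and
    this forces the coordinates of [x] on a chart around [z] into [Ov]. *)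
Lemma valuative_lift : universally_closed X ->
  exists x' : X Ov, fmap (push_hom i) x' = x.
Proof.
case: val => inj_i total res_unit /(_ Ov closure_of_point closure_closed) [S0 S0P].
have xZ : lies_in (closure_of_point) (x : XO (Alg i)).
  move=> j B f h hE s rel_s.
  have [B1|B1] := EM ((1 : B) = 0).
    by rewrite -[LHS]mul1r B1 mul0r.
  have Uj : lies_in (U j) x.
    have [S uS] := opens_exists (U := U j) (x : X (push_alg i)) (U_open j).
    apply/(opens_lies uS)/field_unit_ideal.
    have : lies_in (U j) (fmap h (u j)) by apply: lies_in_fmap.
    rewrite hE => /(uS _ (restrict_hom (alg_map Ov) f)) => unitS.
    apply: contrapT => no; apply: B1.
    apply: (ideal_gen_min unitS (@zero_ideal _)) => _ [t [St ->]].
    have [->|t0] := EM (t = 0); first exact: rmorph0.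
    by case: no; exists t.
  have [g [gE _]] := u_univ Uj.
  have hg c : h c = f (g c).
    apply: (u_inj (g' := comp_hom (restrict_hom (alg_map Ov) f) g)).
    by rewrite -fmap_compE gE hE.
  rewrite -[RHS](rmorph0 f) -[in RHS](rel_s g gE) rmorph_sum.
  apply: eq_bigr => oc _.
  by rewrite rmorphM hg /= -[alg_map B _](alg_hom_comm f).
have S0_0 a : S0 a -> a = 0.
  move=> S0a; have /(_ a S0a) : forall a, S0 a -> i a = 0.
    by apply/S0P; exists F, i; split=> //; exists x.
  by rewrite -(rmorph0 i); apply: inj_i.
have [|F' [phi' [ker_phi' [z zZ]]]] := proj1 (S0P kap res).
  by move=> a /S0_0 ->; rewrite rmorph0.
have [j Uj] := U_cover (z : X (Alg (phi' \o alg_map Ov : {rmorphism R -> F'}))).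
have [h [hE _]] := u_univ Uj.
have relE s : relation s -> \sum_(oc <- s) phi' oc.1 * h oc.2 = 0.
  apply: (zZ j (Alg phi') (id_hom _) h).
  by rewrite hE fmap_restrict_id.
(* If [x] were outside the chart, every formal sum, 1 included, would vacuously be a relation. *)
have [g gE] : exists g : alg_hom (C j) (push_alg i), fmap g (u j) = x.
  apply: contrapT => no; have := relE [:: (1, 1)]; rewrite big_seq1 !rmorph1 mulr1.
  move=> H; have := oner_neq0 F'; move/eqP; apply; apply: H => g gE.
  by case: no; exists g.
have g_uniq (g' : alg_hom (C j) (push_alg i)) : fmap g' (u j) = x -> g' =1 g.
  by move=> g'E; apply: u_inj; rewrite g'E gE.
have gO c : exists o, i o = g c.
  have [//|[o oc]] := total (g c).
  have [res0|/eqP res0] := EM (res o = 0); last first.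
    have [o' oo'] := res_unit o (elimN eqP res0); exists o'.
    have := congr1 i oo'; rewrite rmorphM rmorph1 => ioo'.
    by apply: (unit_inv_unique ioo').
  (* A coordinate whose inverse [o] is in the maximal ideal satisfies [o c = 1], which reads 0 = 1
     at [z]. *)
  have := relE [:: (o, c); (- 1, 1)]; rewrite big_cons big_seq1 /=.
  rewrite (proj2 (ker_phi' o) res0) mul0r add0r !rmorph1 mulr1 rmorphN1.
  move=> H; have := oner_neq0 F'; rewrite -oppr_eq0 => /eqP; case; apply: H => g' g'E.
  rewrite big_cons big_seq1 /= (g_uniq g' g'E) oc rmorphN1 rmorph1 mulr1.
  exact: subrr.
have [G GE] := choice gO.
have G_hom : ring_hom G.
  by split=> [a b|a b|]; apply: inj_i; rewrite !(rmorphD, rmorphM, rmorph1) ?GE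
    ?(rmorphD, rmorphM, rmorph1) //.
have [G' G'E] := rmorphism_of G_hom.
have G'_comm r : G' (alg_map (C j) r) = alg_map Ov r.
  by apply: inj_i; rewrite G'E GE alg_hom_comm.
exists (fmap (AlgHom G'_comm) (u j)); rewrite -gE fmap_compE.
by apply: eq_fmap => c /=; rewrite G'E GE.
Qed.

End ValuativeCriterion.

Lemma valuative_criterion (R : comPzRingType) (X : functor R) (Ov : algebra R)
    (F kap : fieldType) (i : {rmorphism Ov -> F}) (res : {rmorphism Ov -> kap}) :
  proper_scheme X -> valuation_ring i res ->
  forall x : X (push_alg i), exists x' : X Ov, fmap (push_hom i) x' = x.
Proof.
case=> _ [N [U [C [UC cover]]]] uclosed val x.
have U_open j : open_sub (U j) by have [/affine_openP [] ] := UC j.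
have uP j : exists u : X (C j), lies_in (U j) u /\
    forall (A : algebra R) (p : X A), lies_in (U j) p ->
      exists h : alg_hom (C j) A, fmap h u = p /\
        forall h' : alg_hom (C j) A, fmap h' u = p -> h' =1 h.
  by have [/affine_openP [_ H]] := UC j.
pose u j := sval (cid (uP j)).
apply: (valuative_lift val (u := u) x U_open) => // [j|j A p].
  by have [] := svalP (cid (uP j)).
by have [_] := svalP (cid (uP j)); apply.
Qed.

(** * Unions and smooth points of the special fibre *)

Section Union.
Variables (k : comPzRingType) (Y : functor k) (V W : subfunctor Y).
Hypotheses (V_closed : closed_sub V) (W_closed : closed_sub W).
Hypothesis VW : is_union V W.

(** The closed subscheme whose ideal is the product of those of [V] and [W]. It contains both, so
    minimality of the union makes this product zero, which is the usable form of the hypothesis. *)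
Definition product_sub : subfunctor Y.
Proof.
refine (@Subfunctor _ Y (fun A p => forall S S', carves V p S -> carves W p S' ->
  forall s s', S s -> S' s' -> s * s' = 0) _).
move=> A B f p H S S' pS pS' s s' Ss Ss'.
have [S0 pS0] := V_closed p; have [S0' pS0'] := W_closed p.
have fS0 := carves_fmap f pS0; have fS0' := carves_fmap f pS0'.
apply: (ideal_gen_min (carves_ideal fS0 pS Ss) (annihilator_ideal _)).
move=> _ [t [S0t ->]]; rewrite mulrC.
apply: (ideal_gen_min (carves_ideal fS0' pS' Ss') (annihilator_ideal _)).
move=> _ [t' [S0t' ->]]; rewrite -rmorphM mulrC.
by rewrite (H _ _ pS0 pS0') // rmorph0.
Defined.

Lemma union_product (A : algebra k) (p : Y A) S S' :
  carves V p S -> carves W p S' -> forall s s', S s -> S' s' -> s * s' = 0.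
Proof.
move=> pS pS'; suff : lies_in product_sub p by apply.
apply: VW => {A p S S' pS pS'} [A p|B q Vq|B q Wq].
- have [S pS] := V_closed p; have [S' pS'] := W_closed p.
  exists (fun a => exists s s', [/\ S s, S' s' & a = s * s']) => B f; split.
    move=> H _ [s [s' [Ss Ss' ->]]]; rewrite rmorphM.
    by apply: (H _ _ (carves_fmap f pS) (carves_fmap f pS')); [exists s | exists s'].
  move=> H T T' pT pT' t t' Tt Tt'.
  apply: (ideal_gen_min (carves_ideal (carves_fmap f pS) pT Tt) (annihilator_ideal _)).
  move=> _ [s [Ss ->]]; rewrite mulrC.
  apply: (ideal_gen_min (carves_ideal (carves_fmap f pS') pT' Tt') (annihilator_ideal _)).
  by move=> _ [s' [Ss' ->]]; rewrite -rmorphM mulrC; apply: H; exists s, s'.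
- move=> S S' qS _ s s' Ss _.
  by rewrite (proj1 (carves_lies qS) Vq s Ss) mul0r.
- move=> S S' _ qS' s s' _ Ss'.
  by rewrite (proj1 (carves_lies qS') Wq s' Ss') mulr0.
Qed.

Lemma union_field (K : fieldType) (phi : {rmorphism k -> K}) (p : Y (Alg phi)) :
  lies_in V p \/ lies_in W p.
Proof.
have [S pS] := V_closed p; have [S' pS'] := W_closed p.
have SS' := union_product pS pS'.
have [Vp|Vp] := EM (lies_in V p); [by left | right].
apply/(carves_lies pS') => s' Ss'; apply: contrapT => /eqP s'0; apply: Vp.
apply/(carves_lies pS) => s Ss.
by have /eqP := SS' s s' Ss Ss'; rewrite mulf_eq0 (negPf s'0) orbF => /eqP.
Qed.

(** The ideal of [V] is killed by that of [W], here the unit ideal. Hence a thickening of a point of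
    [V] off [W] stays in [V], and smoothness of [V] there is smoothness of the special fibre. *)
Lemma union_away (A : algebra k) (p : Y A) S' :
  carves W p S' -> ideal_gen S' 1 -> lies_in V p.
Proof.
move=> pS' S'1; have [S pS] := V_closed p.
apply/(carves_lies pS) => s Ss; rewrite -[s]mul1r.
apply: (ideal_gen_min S'1 (annihilator_ideal _)).
by move=> s' Ss'; rewrite mulrC; apply: (union_product pS pS').
Qed.

End Union.

Definition struct_hom (k : comPzRingType) (M : algebra k) : alg_hom (alg_self k) M :=
  @AlgHom k (alg_self k) M (alg_map M) (fun r => erefl).

(* [B] satisfies the infinitesimal lifting property at the point [hv], tested on
   thickenings whose reduction is constant equal to [hv]. *)
Definition smooth_lifting (R k : comPzRingType) (pi : {rmorphism R -> k})
    (B : algebra R) (hv : B -> k) : Prop :=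
  forall (A A' M : algebra k) (q : alg_hom A A') (e : alg_hom A' M),
  (forall b, exists a, b = q a) ->
  (forall a a', q a = 0 -> q a' = 0 -> a * a' = 0) ->
  (forall b, exists a, e a = b) -> (forall a, e a = 0 -> exists n, a ^+ n = 0) ->
  forall g : alg_hom B (restrict pi A'), (forall b, e (g b) = alg_map M (hv b)) ->
  exists g' : alg_hom B (restrict pi A), forall b, q (g' b) = g b.

(** Lying off [W], in the smooth locus of [V] and in the chart are open conditions, so they hold on
    a thickening whose reduction is the constant point [v]. Off [W] the special fibre is [V], and
    formal smoothness of the smooth locus applies. *)
Lemma smooth_point_lifting (R : comPzRingType) (k : fieldType)
    (pi : {rmorphism R -> k}) (X : functor R) (V W : subfunctor (base_change pi X))
    (U : subfunctor X) (B : algebra R) (u : X B)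
    (v : rational_point (sub V)) (hv : alg_hom B (restrict pi (alg_self k))) :
  closed_sub V -> closed_sub W -> is_union V W -> open_sub U -> lies_in U u ->
  (forall (A : algebra R) (p : X A), lies_in U p -> exists h : alg_hom B A,
     fmap h u = p /\ forall h' : alg_hom B A, fmap h' u = p -> h' =1 h) ->
  in_smooth_locus v -> ~ lies_in W (sval v) -> fmap hv u = sval v ->
  smooth_lifting pi hv.
Proof.
move=> V_closed W_closed VW U_open Uu u_univ [Us [Us_open [_ Us_smooth] Us_v]] Wv hvu.
move=> A A' M q e q_surj q_sq0 e_surj e_nil g eg.
pose p' : base_change pi X A' := fmap g u.
have ep' : fmap e p' = fmap (struct_hom M) (sval v).
  rewrite -hvu /p' /= !fmap_compE; apply: eq_fmap => b; exact: eg.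
have Vp' : lies_in V p'.
  have [S pS] := W_closed _ p'; have [T vT] := W_closed _ (sval v).
  apply: (union_away V_closed W_closed VW pS).
  apply: (unit_ideal_lift e_surj e_nil).
  have [t Tt t0] : exists2 t : k, T t & t <> 0.
    apply: contrapT => no; apply: Wv; apply/(carves_lies vT) => t Tt.
    by apply: contrapT => t0; apply: no; exists t.
  have vT' := carves_fmap (struct_hom M) vT; rewrite -ep' in vT'.
  have := carves_ideal (carves_fmap e pS) vT' (ex_intro _ t (conj Tt erefl)).
  move=> /(idealMl (alg_map M t^-1) (ideal_gen_ideal _)).
  by rewrite /= -rmorphM mulVf ?rmorph1 //; apply/eqP.
pose p1 : sub V A' := exist _ p' Vp'.
have Us_p1 : lies_in Us p1.
  have [S pS] := opens_exists p1 Us_open; apply/(opens_lies pS).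
  apply: (unit_ideal_lift e_surj e_nil); apply/pS.
  have -> : fmap e p1 = fmap (struct_hom M) v.
    by apply: eq_sig_hprop => //= *; apply: proof_irrelevance.
  exact: lies_in_fmap.
have [[[p2 Vp2] Us_p2] /(congr1 (fun z => sval (sval z))) /= qp2] :=
  Us_smooth A A' q q_surj q_sq0 (exist _ p1 Us_p1).
have Up2 : lies_in U (p2 : X (restrict pi A)).
  have [S pS] := opens_exists (p2 : X (restrict pi A)) U_open.
  apply/(opens_lies pS).
  apply: (unit_ideal_lift (f := q)) => [b|a qa|].
  - by have [a ->] := q_surj b; exists a.
  - by exists 2%N; apply: q_sq0.
  - apply/(pS _ (restrict_hom pi q)); rewrite qp2; exact: lies_in_fmap.
have [g' [g'u _]] := u_univ _ _ Up2; exists g' => b.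
have [h [_ h_uniq]] := u_univ _ _ (lies_in_fmap g Uu).
rewrite (h_uniq g) // -(h_uniq (comp_hom (restrict_hom pi q) g')) //.
by rewrite -fmap_compE g'u.
Qed.

(** * Tensor products of algebras *)

Definition lmod_of (R : comPzRingType) (A : algebra R) : Type := alg_ring A.

Section LmodOf.
Variables (R : comPzRingType) (A : algebra R).

HB.instance Definition _ := GRing.Zmodule.on (lmod_of A).

Definition alg_scale (r : R) (a : lmod_of A) : lmod_of A := alg_map A r * (a : A).

Fact alg_scaleA r s a : alg_scale r (alg_scale s a) = alg_scale (r * s) a.
Proof. by rewrite /alg_scale rmorphM mulrA. Qed.
Fact alg_scale1 : left_id 1 alg_scale.
Proof. by move=> a; rewrite /alg_scale rmorph1 mul1r. Qed.
Fact alg_scaleDr : right_distributive alg_scale +%R.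
Proof. by move=> r a b; rewrite /alg_scale mulrDr. Qed.
Fact alg_scaleDl a : {morph alg_scale^~ a : r s / r + s}.
Proof. by move=> r s; rewrite /alg_scale rmorphD mulrDl. Qed.
HB.instance Definition _ := GRing.Zmodule_isLmodule.Build R (lmod_of A)
  alg_scaleA alg_scale1 alg_scaleDr alg_scaleDl.

Lemma alg_scaleE r (a : lmod_of A) : r *: a = alg_map A r * (a : A).
Proof. by []. Qed.

End LmodOf.

Lemma linear_of_hom (R : comPzRingType) (A B : algebra R) (f : alg_hom A B) :
  {g : {linear lmod_of A -> lmod_of B} | forall a, g a = f a}.
Proof.
have f_lin : linear (f : lmod_of A -> lmod_of B).
  by move=> r a b; rewrite rmorphD rmorphM alg_hom_comm.
pose m := GRing.isLinear.Build R (lmod_of A) (lmod_of B) _ f f_lin.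
by exists (HB.pack_for {linear lmod_of A -> lmod_of B} (f : lmod_of A -> lmod_of B) m).
Qed.

Section Tensor.
Variables (R : comPzRingType) (A B : algebra R).

Let formal := seq (lmod_of A * B).
Let eval (P : lmodType R) (beta : lmod_of A -> B -> P) (l : formal) : P :=
  \sum_(x <- l) beta x.1 x.2.
Let teq (l l' : formal) := forall (P : lmodType R) (beta : lmod_of A -> B -> P),
  is_bilinear beta -> eval beta l = eval beta l'.
Let tmul (l l' : formal) : formal :=
  [seq ((x.1 : A) * (y.1 : A), x.2 * y.2) | x <- l, y <- l'].

Let eval_cat (P : lmodType R) (beta : lmod_of A -> B -> P) l l' :
  eval beta (l ++ l') = eval beta l + eval beta l'.
Proof. exact: big_cat. Qed.

Let eval_mul (P : lmodType R) (beta : lmod_of A -> B -> P) l l' : eval beta (tmul l l') =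
  \sum_(x <- l) \sum_(y <- l') beta ((x.1 : A) * (y.1 : A)) (x.2 * y.2).
Proof. by rewrite /eval /tmul big_allpairs_dep. Qed.

Let bilinearM (P : lmodType R) (beta : lmod_of A -> B -> P) (a : A) (b : B) :
  is_bilinear beta -> is_bilinear (fun (a' : lmod_of A) b' => beta ((a' : A) * a) (b' * b)).
Proof.
case=> Dl Dr Zl Zr; split=> [m m' c|m c c'|r m c|r m c].
- by rewrite mulrDl Dl.
- by rewrite mulrDl Dr.
- by rewrite -Zl !alg_scaleE mulrA.
- by rewrite -mulrA Zr.
Qed.

Let bilinear0l (P : lmodType R) (beta : lmod_of A -> B -> P) (b : B) :
  is_bilinear beta -> beta 0 b = 0.
Proof. by case=> _ _ Zl _; rewrite -(scale0r 0) Zl scale0r. Qed.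

Let bilinearN (P : lmodType R) (beta : lmod_of A -> B -> P) (a : lmod_of A) (b : B) :
  is_bilinear beta -> beta (- a) b = - beta a b.
Proof.
by move=> bil; apply: (addIr (beta a b)); case: (bil) => Dl _ _ _;
  rewrite -Dl !addNr bilinear0l.
Qed.

Let tmulC l l' : teq (tmul l l') (tmul l' l).
Proof.
move=> P beta _; rewrite !eval_mul exchange_big.
by apply: eq_bigr => y _; apply: eq_bigr => x _; rewrite [_ * y.1]mulrC [_ * y.2]mulrC.
Qed.

Let tmulE l l1 l' : teq l l1 -> teq (tmul l l') (tmul l1 l').
Proof.
move=> E P beta bil; rewrite !eval_mul exchange_big [RHS]exchange_big.
by apply: eq_bigr => y _; apply: (E P _ (bilinearM y.1 y.2 bil)).
Qed.

(** Two formal sums are identified when no bilinear map separates them, which is the equality that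
    [tensor_eq0] speaks of. *)
Definition tensor_pre_ring : pre_ring.
Proof.
refine (@PreRing formal teq cat tmul
  (map (fun x => (- x.1, x.2))) [::] [:: ((1 : A), 1)] _ _ _ _ _ _ _ _ _ _ _ _ _ _).
- by [].
- by move=> x y E P beta bil; rewrite E.
- by move=> x y z E E' P beta bil; rewrite E // E'.
- by move=> x x' y y' E E' P beta bil; rewrite !eval_cat E // E'.
- move=> x x' y y' E E' P beta bil; rewrite (tmulE _ E) // tmulC //.
  by rewrite (tmulE _ E') // tmulC.
- move=> x x' E P beta bil; rewrite /eval !big_map.
  under eq_bigr do rewrite bilinearN //.
  under [RHS]eq_bigr do rewrite bilinearN //.
  by rewrite !sumrN; congr (- _); apply: E.
- by move=> x y z P beta bil; rewrite catA.
- by move=> x y P beta bil; rewrite !eval_cat addrC.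
- by [].
- move=> x P beta bil; rewrite eval_cat /eval big_map big_nil.
  by under eq_bigr do rewrite bilinearN //; rewrite sumrN addNr.
- move=> x y z P beta bil; rewrite !eval_mul.
  rewrite /tmul big_allpairs_dep /=; apply: eq_bigr => a _.
  rewrite big_allpairs_dep /=; apply: eq_bigr => b _; apply: eq_bigr => c _.
  by rewrite !mulrA.
- by move=> x y; apply: tmulC.
- move=> x P beta bil; rewrite eval_mul big_seq1.
  by apply: eq_bigr => y _; rewrite !mul1r.
- by move=> x y z P beta bil; rewrite eval_mul big_cat eval_cat !eval_mul.
Defined.

Let T : comPzRingType := qring tensor_pre_ring.
Let pure a b : T := @qpi tensor_pre_ring [:: (a, b)].

Let pureDl a a' b : pure (a + a') b = pure a b + pure a' b.
Proof.
rewrite [RHS]qpiD; apply/qpiP => P beta bil.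
by rewrite /eval !big_cons big_nil /= !addr0; case: bil => ->.
Qed.

Let pureDr a b b' : pure a (b + b') = pure a b + pure a b'.
Proof.
rewrite [RHS]qpiD; apply/qpiP => P beta bil.
by rewrite /eval !big_cons big_nil /= !addr0; case: bil => _ ->.
Qed.

Let pureM (a a' : A) b b' : pure (a * a') (b * b') = pure a b * pure a' b'.
Proof. by rewrite [RHS]qpiM; apply/qpiP => P beta bil. Qed.

Let pureZ r (a : A) b : pure (alg_map A r * a) b = pure a (alg_map B r * b).
Proof.
apply/qpiP => P beta bil; rewrite /eval !big_cons big_nil /= !addr0.
by case: bil => _ _ Zl Zr; rewrite Zr -Zl.
Qed.

Let pi_sum (l : formal) : @qpi tensor_pre_ring l = \sum_(x <- l) pure x.1 x.2.
Proof.
elim: l => [|[a b] l IH]; first by rewrite big_nil.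
rewrite big_cons -IH /= [RHS]qpiD; exact/qpiP.
Qed.

Let sum_pure0 (l : formal) : \sum_(x <- l) pure x.1 x.2 = 0 <->
  forall (P : lmodType R) (beta : lmod_of A -> B -> P), is_bilinear beta ->
  eval beta l = 0.
Proof.
rewrite -pi_sum (_ : 0 = @qpi tensor_pre_ring [::]) // qpiP.
by split=> H P beta bil; rewrite [LHS]H // /eval big_nil.
Qed.

Lemma tensor_product : exists (T : comPzRingType) (i : {rmorphism A -> T})
    (j : {rmorphism B -> T}),
  [/\ forall r, i (alg_map A r) = j (alg_map B r),
      forall (C : comPzRingType) (f : {rmorphism A -> C}) (g : {rmorphism B -> C}),
        (forall r, f (alg_map A r) = g (alg_map B r)) ->
        exists h : {rmorphism T -> C}, (forall a, h (i a) = f a) /\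
          forall b, h (j b) = g b,
      forall t, exists s : seq (A * B), t = \sum_(x <- s) i x.1 * j x.2
    & forall n (a : 'I_n -> A) (b : 'I_n -> B),
        \sum_x i (a x) * j (b x) = 0 <-> tensor_eq0 (a : 'I_n -> lmod_of A) b].
Proof.
have i_hom : ring_hom (fun a : A => pure a 1).
  by split=> [a a'|a a'|]; [exact: pureDl | rewrite -pureM mulr1 |].
have j_hom : ring_hom (fun b : B => pure (1 : A) b).
  by split=> [b b'|b b'|]; [exact: pureDr | rewrite -pureM mulr1 |].
have [i iE] := rmorphism_of i_hom; have [j jE] := rmorphism_of j_hom.
have ijE a b : i a * j b = pure a b by rewrite iE jE -pureM mulr1 mul1r.
exists T, i, j; split.
- by move=> r; rewrite iE jE -[alg_map A r]mulr1 pureZ mulr1.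
- move=> C f g fg; pose CA := Alg (f \o alg_map A : {rmorphism R -> C}).
  pose beta (a : lmod_of A) (b : B) : lmod_of CA := f a * g b.
  have bil : is_bilinear beta.
    rewrite /beta; split=> [m m' c|m c c'|r m c|r m c].
    - by rewrite rmorphD mulrDl.
    - by rewrite rmorphD mulrDr.
    - by rewrite alg_scaleE rmorphM -mulrA.
    - by rewrite alg_scaleE rmorphM -fg /= mulrCA.
  pose h (t : T) : C := eval beta (qrepr t).
  have hE l : h (@qpi tensor_pre_ring l) = eval beta l.
    by have E : teq (qrepr (@qpi tensor_pre_ring l)) l := @qreprE tensor_pre_ring l;
      apply: E bil.
  have h_hom : ring_hom h.
    split.
    - elim/(@qind tensor_pre_ring) => l; elim/(@qind tensor_pre_ring) => l'.
      by rewrite qpiD !hE eval_cat.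
    - elim/(@qind tensor_pre_ring) => l; elim/(@qind tensor_pre_ring) => l'.
      rewrite qpiM !hE eval_mul mulr_suml; apply: eq_bigr => x _.
      rewrite mulr_sumr; apply: eq_bigr => y _; rewrite /beta !rmorphM; ring.
    - by rewrite [LHS]hE /eval big_seq1 /beta !rmorph1 mulr1.
  have [h' h'E] := rmorphism_of h_hom; exists h'; split=> [a|b].
    by rewrite h'E iE [LHS]hE /eval big_seq1 /beta rmorph1 mulr1.
  by rewrite h'E jE [LHS]hE /eval big_seq1 /beta rmorph1 mul1r.
- elim/(@qind tensor_pre_ring) => l; exists l; rewrite pi_sum.
  by apply: eq_bigr => x _; rewrite ijE.
- move=> n a b; pose l : formal := [seq (a x, b x) | x <- enum 'I_n].
  have sumE (V : zmodType) (F : lmod_of A -> B -> V) :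
      \sum_(x <- l) F x.1 x.2 = \sum_x F (a x) (b x).
    by rewrite big_map big_enum.
  rewrite (_ : \sum_x i (a x) * j (b x) = \sum_(x <- l) pure x.1 x.2); last first.
    by rewrite sumE; apply: eq_bigr => x _; rewrite ijE.
  rewrite sum_pure0; split=> H P beta bil; first by rewrite -sumE; apply: H.
  by rewrite /eval sumE; apply: H.
Qed.

End Tensor.

(** A kernel element is a formal sum that vanishes in [A' (x) B], the situation in which flatness is
    stated. The properties of [T] are separate hypotheses so that [T = B], over the base itself, is
    covered as well. *)
Lemma flat_tensor_injective (R : comPzRingType) (A A' B : algebra R)
    (phi : alg_hom A A') (T T' : comPzRingType)
    (i : {rmorphism A -> T}) (j : {rmorphism B -> T})
    (i' : {rmorphism A' -> T'}) (j' : {rmorphism B -> T'}) (h : {rmorphism T -> T'}) :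
  flat_algebra B -> injective phi ->
  (forall t, exists s : seq (A * B), t = \sum_(x <- s) i x.1 * j x.2) ->
  (forall n (a : 'I_n -> A) (b : 'I_n -> B), tensor_eq0 (a : 'I_n -> lmod_of A) b ->
     \sum_x i (a x) * j (b x) = 0) ->
  (forall n (a : 'I_n -> A') (b : 'I_n -> B), \sum_x i' (a x) * j' (b x) = 0 ->
     tensor_eq0 (a : 'I_n -> lmod_of A') b) ->
  (forall a, h (i a) = i' (phi a)) -> (forall b, h (j b) = j' b) ->
  injective h.
Proof.
move=> flatB inj_phi span T0 T'0 hi hj.
suff h0 t : h t = 0 -> t = 0.
  by move=> t t' E; apply/eqP; rewrite -subr_eq0; apply/eqP/h0; rewrite rmorphB E subrr.
have [s ->] := span t; rewrite rmorph_sum => E.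
have [f fE] := linear_of_hom phi.
have inj_f : injective f by move=> a b; rewrite !fE => /inj_phi.
pose a x : lmod_of A := (nth (0, 0) s x).1; pose b (x : 'I_(size s)) := (nth (0, 0) s x).2.
have := flatB _ _ f inj_f _ (fun x : 'I_(size s) => a x) b.
have sumE (V : zmodType) (F : A * B -> V) :
    \sum_(x <- s) F x = \sum_(x < size s) F (nth (0, 0) s x).
  by rewrite (big_nth (0, 0)) big_mkord.
rewrite sumE => H; apply: T0; apply: H; apply: T'0; rewrite -[RHS]E sumE.
by apply: eq_bigr => x _; rewrite rmorphM hi hj fE.
Qed.

(** * Noetherian rings *)

Definition noetherian (A : comPzRingType) : Prop :=
  forall I : A -> Prop, is_ideal I -> exists s : seq A,
    (forall x, x \in s -> I x) /\ forall a, I a -> ideal_gen (fun y => y \in s) a.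

Lemma noetherian_image (A B : comPzRingType) (f : {rmorphism A -> B}) :
  (forall b, exists a, b = f a) -> noetherian A -> noetherian B.
Proof.
move=> f_surj noethA I idI; have [s [sI Is]] := noethA _ (ideal_preim f idI).
exists (map f s); split=> [_ /mapP[x /sI Ix ->]//|b Ib].
have [a Ea] := f_surj b; rewrite Ea in Ib *.
apply: (ideal_gen_min (Is a Ib) (I := fun a => ideal_gen _ (f a))).
  exact/ideal_preim/ideal_gen_ideal.
by move=> y sy; apply/ideal_gen_sub/map_f.
Qed.

Lemma noetherian_acc (A : comPzRingType) (J : nat -> A -> Prop) :
  noetherian A -> (forall n, is_ideal (J n)) ->
  (forall n a, J n a -> J n.+1 a) -> exists n, forall m a, J m a -> J n a.
Proof.
move=> noethA idJ incr.
have mono n m a : (n <= m)%N -> J n a -> J m a.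
  by move=> /subnK <- Ja; elim: (m - n)%N => // d; apply: incr.
have idU : is_ideal (fun a => exists n, J n a).
  split=> [|x y [n Jx] [m Jy]|a x [n Jx]].
  - by exists 0%N; apply: ideal0.
  - exists (maxn n m); apply: idealD => //.
      by apply: mono Jx; apply: leq_maxl.
    by apply: mono Jy; apply: leq_maxr.
  - by exists n; apply: idealMl.
have [s [sU Us]] := noethA _ idU.
have [n sn] : exists n, forall x, x \in s -> J n x.
  elim: s sU {Us} => [|x s IH] sU; first by exists 0%N.
  have [|n sn] := IH; first by move=> y ys; apply: sU; rewrite inE ys orbT.
  have [m Jx] := sU x (mem_head _ _); exists (maxn n m) => y.
  rewrite inE => /predU1P[->|/sn Jy].
    by apply: mono Jx; apply: leq_maxr.
  by apply: mono Jy; apply: leq_maxl.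
by exists n => m a Ja; apply: (ideal_gen_min (Us a (ex_intro _ m Ja))).
Qed.

Lemma noetherian_max (A : comPzRingType) (P : (A -> Prop) -> Prop) I0 :
  noetherian A -> (forall I, P I -> is_ideal I) -> P I0 ->
  exists I, P I /\ forall J, P J -> (forall a, I a -> J a) -> forall a, J a -> I a.
Proof.
move=> noethA idP PI0; apply: contrapT => no.
have next (I : {I | P I}) : exists J : {J | P J},
    (forall a, sval I a -> sval J a) /\ exists a, sval J a /\ ~ sval I a.
  apply: contrapT => max; apply: no; exists (sval I); split; first exact: (svalP I).
  move=> J PJ IJ a Ja; apply: contrapT => Ia; apply: max.
  by exists (exist _ J PJ); split=> //; exists a.
have [f fP] := choice next.
pose J n := iter n f (exist _ I0 PI0).
have [||n nP] := noetherian_acc (J := fun n => sval (J n)) noethA.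
- by move=> n; apply: idP; apply: svalP.
- by move=> n; have [] := fP (J n).
- by have [_ [a [Ja]]] := fP (J n); apply; apply: (nP n.+1).
Qed.

Lemma hilbert_basis (A : comNzRingType) : noetherian A -> noetherian {poly A}.
Proof.
move=> noethA I idI.
pose lead (J : {poly A} -> Prop) n (a : A) :=
  exists2 p, J p & (size p <= n.+1)%N /\ p`_n = a.
have id_lead J n : is_ideal J -> is_ideal (lead J n).
  move=> idJ; split=> [|x y [p Ip [sp <-]] [q Iq [sq <-]]|a x [p Ip [sp <-]]].
  - by exists 0; [apply: ideal0 | rewrite size_poly0 coef0].
  - exists (p + q); first exact: idealD.
    by rewrite coefD (leq_trans (size_polyD _ _)) // geq_max sp.
  - exists (a%:P * p); first exact: idealMl.
    by rewrite coefCM mul_polyC (leq_trans (size_scale_leq _ _)).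
have [n a [p Ip [sp pa]]|N LN] := noetherian_acc noethA (fun n => id_lead I n idI).
  exists (p * 'X); first by apply: idealMr.
  by rewrite coefMX; split=> //; rewrite (leq_trans (size_polyMleq _ _)) // size_polyX addn2.
have gens n : exists G : seq {poly A}, (forall p, p \in G -> I p) /\
    forall a, lead I n a -> lead (ideal_gen (fun y => y \in G)) n a.
  have [s [sL Ls]] := noethA _ (id_lead I n idI).
  have [G [GI Gs]] : exists G : seq {poly A}, (forall p, p \in G -> I p) /\
      forall a, a \in s -> exists2 q, q \in G & (size q <= n.+1)%N /\ q`_n = a.
    elim: s sL {Ls} => [|x s IH] sL; first by exists [::].
    have [|G [GI Gs]] := IH; first by move=> y ys; apply: sL; rewrite inE ys orbT.
    have [p Ip pP] := sL x (mem_head _ _); exists (p :: G); split=> y.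
      by rewrite inE => /predU1P[->//|]; apply: GI.
    rewrite inE => /predU1P[->|/Gs[q qG qP]]; first by exists p; rewrite ?mem_head.
    by exists q; rewrite // inE qG orbT.
  exists G; split=> // a /Ls /ideal_gen_min; apply.
    exact/id_lead/ideal_gen_ideal.
  by move=> t /Gs [q qG qP]; exists q => //; apply: ideal_gen_sub.
have [G GP] := choice gens.
pose H := flatten [seq G n | n <- iota 0 N.+1].
have HI p : p \in H -> I p.
  by case/flattenP=> _ /mapP[n _ ->] pG; have [GI _] := GP n; apply: GI.
have idH : is_ideal (ideal_gen (fun y => y \in H)) by apply: ideal_gen_ideal.
have genHI p : ideal_gen (fun y => y \in H) p -> I p.
  by move=> Hp; apply: (ideal_gen_min Hp idI).
exists H; split=> // p Ip.
elim: {p}(size p) {-2}p (leqnn (size p)) Ip => [|m IH] p sp Ip.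
  by move: sp; rewrite leqn0 size_poly_eq0 => /eqP ->; apply: ideal0.
(* Above degree [N] the ideals of leading coefficients are constant, so a generator of degree [N]
   times a power of X suffices. *)
pose n := minn m N.
have La : lead I n p`_m.
  have : lead I m p`_m by exists p.
  by rewrite /n; case: leqP => // _ /LN.
have [_ /(_ _ La) [q Gq [sq qn]]] := GP n.
have Hq : ideal_gen (fun y => y \in H) q.
  apply: (ideal_gen_min Gq idH) => y yG; apply: ideal_gen_sub.
  apply/flattenP; exists (G n) => //; apply/mapP; exists n => //.
  by rewrite mem_iota add0n ltnS geq_minr.
have nm : (n <= m)%N by apply: geq_minl.
have HqX : ideal_gen (fun y => y \in H) (q * 'X^(m - n)) by apply: idealMr.
rewrite -[p](subrK (q * 'X^(m - n))); apply: idealD => //; apply: IH; last first.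
  by apply: idealD => //; rewrite -mulN1r; apply: idealMl => //; apply: genHI.
apply/leq_sizeP => j mj; rewrite coefB coefMXn.
have -> : (j < m - n)%N = false by apply/negbTE; rewrite -leqNgt (leq_trans (leq_subr _ _)).
case: (ltngtP m j) mj => // [mj|<-] _; last by rewrite subKn // qn subrr.
rewrite !nth_default ?subrr //; last exact: leq_trans sp mj.
rewrite (leq_trans sq) // ltn_subRL -addSn; lia.
Qed.

Definition nonzero_ring (A : comPzRingType) (A1 : (1 : A) <> 0) : Type := A.
HB.instance Definition _ (A : comPzRingType) (A1 : (1 : A) <> 0) :=
  GRing.ComPzRing.on (nonzero_ring A1).
Fact nonzero_ring_neq0 (A : comPzRingType) (A1 : (1 : A) <> 0) :
  (1 : nonzero_ring A1) != 0.
Proof. exact/eqP. Qed.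
HB.instance Definition _ (A : comPzRingType) (A1 : (1 : A) <> 0) :=
  GRing.PzSemiRing_isNonZero.Build (nonzero_ring A1) (nonzero_ring_neq0 A1).

Lemma poly_evaluation (S : comNzRingType) (D : comPzRingType)
    (f : {rmorphism S -> D}) (x : D) : (1 : D) <> 0 ->
  exists g : {rmorphism {poly S} -> D}, (forall c, g c%:P = f c) /\ g 'X = x.
Proof.
move=> D1; pose f' : {rmorphism S -> nonzero_ring D1} := f.
have cfx : commr_rmorph f' (x : nonzero_ring D1) by move=> c; apply: mulrC.
pose g : {rmorphism {poly S} -> nonzero_ring D1} := horner_morph cfx.
have g_hom : ring_hom (g : {poly S} -> D).
  split=> [p q|p q|]; [exact: (rmorphD g) | exact: (rmorphM g) |].
  exact: (rmorph1 g).
have [h hE] := rmorphism_of g_hom; exists h.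
by split=> [c|]; rewrite hE; [exact: (horner_morphC cfx) | exact: (horner_morphX cfx)].
Qed.

Fixpoint iter_poly (R : comNzRingType) (n : nat) : comNzRingType :=
  if n is m.+1 then {poly (iter_poly R m)} else R.

Lemma finitely_generated_noetherian (R : comNzRingType) (D : algebra R) :
  noetherian R -> finitely_generated D -> noetherian D.
Proof.
move=> noethR [n [x x_gen]]; have [D1|D1] := EM ((1 : D) = 0).
  move=> I idI; exists [::]; split=> // a _.
  by rewrite -[a]mul1r D1 mul0r; apply: ideal0 (ideal_gen_ideal _).
have noeth m : noetherian (iter_poly R m).
  by elim: m => //= m; apply: hilbert_basis.
have [m [g [gR gx]]] : exists m (g : {rmorphism iter_poly R m -> D}),
    (forall r, exists p, alg_map D r = g p) /\
    forall y, y \in codom x -> exists p, y = g p.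
  elim: (codom x) => [|y s [m [g [gR gs]]]].
    by exists 0%N, (alg_map D); split=> // r; exists r.
  have [h [hC hX]] := poly_evaluation g y D1; exists m.+1, h; split=> [r|z].
    by have [p ->] := gR r; exists p%:P.
  rewrite inE => /predU1P[->|/gs[p ->]]; first by exists 'X.
  by exists p%:P.
apply: (noetherian_image (f := g)) => //.
apply: x_gen => // [i|a b [p ->] [q ->]|a b [p ->] [q ->]].
- by apply: gx; apply: codom_f.
- by exists (p + q); rewrite rmorphD.
- by exists (p * q); rewrite rmorphM.
Qed.

(** * Powers of an ideal and Krull's intersection theorem *)

Fixpoint ideal_power (A : comPzRingType) (I : A -> Prop) (n : nat) : A -> Prop :=
  if n is m.+1 then
    ideal_gen (fun x => exists a b, [/\ I a, ideal_power I m b & x = a * b])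
  else fun=> True.

Lemma ideal_power_ideal (A : comPzRingType) (I : A -> Prop) n :
  is_ideal (ideal_power I n).
Proof. by case: n => [|n]; [split | apply: ideal_gen_ideal]. Qed.

Section Krull.
Variables (A : comPzRingType) (k : fieldType) (h : {rmorphism A -> k}).
Hypothesis noethA : noetherian A.
Let m a := h a = 0.

Let id_m : is_ideal m.
Proof. exact: (ideal_preim h (@zero_ideal k)). Qed.

Let m_times (N : A -> Prop) := ideal_gen (fun x => exists a b, [/\ m a, N b & x = a * b]).

(** The ring is not localized at [m], so units of the local ring appear as elements with [h u = 1].
    The first generator is eliminated by means of its own equation, and induction does the rest. *)
Let nakayama (g : seq A) :
  (forall y, y \in g -> exists u, h u = 1 /\ m_times (fun z => z \in g) (u * y)) ->
  exists s, h s = 1 /\ forall y, y \in g -> s * y = 0.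
Proof.
elim: g => [|x g IH] gP; first by exists 1; rewrite rmorph1.
have split_head z : m_times (fun z => z \in x :: g) z ->
    exists a z', [/\ m a, m_times (fun z => z \in g) z' & z = a * x + z'].
  have idg : is_ideal (m_times (fun z => z \in g)) by apply: ideal_gen_ideal.
  pose J z := exists a z', [/\ m a, m_times (fun z => z \in g) z' & z = a * x + z'].
  move/(@ideal_gen_min _ _ J); apply.
    split=> [|_ _ [a [z1 [ma Z1 ->]]] [b [z2 [mb Z2 ->]]]|c _ [a [z1 [ma Z1 ->]]]].
    - by exists 0, 0; rewrite mul0r addr0; split=> //; apply: ideal0.
    - by exists (a + b), (z1 + z2); rewrite mulrDl addrACA; split=> //; apply: idealD.
    - exists (c * a), (c * z1); rewrite mulrDr mulrA.
      by split=> //; apply: idealMl.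
  move=> t [a [b [ma]]]; rewrite inE => /predU1P[->|bg] -> {t}.
    by exists a, 0; rewrite addr0; split=> //; apply: ideal0.
  exists 0, (a * b); rewrite mul0r add0r; split=> //; first exact: ideal0.
  by apply: ideal_gen_sub; exists a, b.
have [u [hu /split_head[a [z [ma Zz uxE]]]]] := gP x (mem_head _ _).
have hua : h (u - a) = 1 by rewrite rmorphB ma subr0.
have uax : (u - a) * x = z by rewrite mulrBl uxE addrC addKr.
have [|s [hs sg]] := IH.
  move=> y yg; have [|v [hv /split_head[b [z' [mb Zz' vyE]]]]] := gP y.
    by rewrite inE yg orbT.
  exists ((u - a) * v); rewrite rmorphM hua hv mulr1; split=> //.
  rewrite -mulrA vyE mulrDr mulrCA uax; apply: idealD; try exact: ideal_gen_ideal.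
    by apply: idealMl => //; apply: ideal_gen_ideal.
  by apply: idealMl => //; apply: ideal_gen_ideal.
have sz : s * z = 0.
  rewrite mulrC; apply: (ideal_gen_min Zz (annihilator_ideal s)).
  by move=> _ [b [y [_ yg ->]]]; rewrite -mulrA [y * s]mulrC sg ?mulr0.
exists (s * (u - a)); rewrite rmorphM hs hua mulr1; split=> // y.
rewrite inE => /predU1P[->|yg]; first by rewrite -mulrA uax.
by rewrite mulrAC sg ?mul0r.
Qed.

Let word_count (x : A) (w : seq A) :
  \prod_(y <- w) y = x ^+ count_mem x w * \prod_(y <- [seq y <- w | y != x]) y.
Proof.
elim: w => [|y w IH]; first by rewrite !big_nil mulr1.
rewrite big_cons IH /=; have [->|yx] := eqVneq y x; first by rewrite exprS mulrA.
by rewrite big_cons mulrCA.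
Qed.

(** In a long word either [x] occurs often or the remaining letters form a long word. It follows
    that a power of [m] lies in [J]. *)
Let long_words (s : seq A) (J : A -> Prop) : is_ideal J ->
  (forall x, x \in s -> exists t, J (x ^+ t)) ->
  exists M, forall w : seq A, {subset w <= s} -> (M <= size w)%N -> J (\prod_(y <- w) y).
Proof.
elim: s J => [|x s IH] J idJ sJ.
  exists 1%N => -[|y w] // /(_ y); rewrite mem_head => /(_ isT).
  by rewrite in_nil.
have [t xt] := sJ x (mem_head _ _).
have /choice[M MP] : forall i, exists M, forall w : seq A, {subset w <= s} ->
    (M <= size w)%N -> J (x ^+ i * \prod_(y <- w) y).
  move=> i; apply: (IH (fun z => J (x ^+ i * z))).
    split=> [|a b Ja Jb|a b Jb]; first by rewrite mulr0; apply: ideal0.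
      by rewrite mulrDr; apply: idealD.
    by rewrite mulrCA; apply: idealMl.
  move=> y ys; have [|t' yt'] := sJ y; first by rewrite inE ys orbT.
  by exists t'; apply: idealMl.
exists (t + \max_(i < t) M i)%N => w ws sw; rewrite (word_count x).
have [ct|ct] := leqP t (count_mem x w).
  by rewrite -(subnK ct) exprD -mulrA mulrCA; apply: idealMr.
apply: MP => [y|].
  by rewrite mem_filter => /andP[yx /ws]; rewrite inE (negPf yx).
have := leq_bigmax (F := fun i : 'I_t => M i) (Ordinal ct) => /= Mc.
rewrite (leq_trans Mc) // size_filter -(leq_add2l (count_mem x w)).
rewrite (count_predC (pred1 x) w) (leq_trans _ sw) // leq_add2r ltnW //.
Qed.

Let power_of_words (s : seq A) (J : A -> Prop) M c z :
  is_ideal J -> (forall a, m a -> ideal_gen (fun y => y \in s) a) ->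
  (forall w : seq A, {subset w <= s} -> size w = M -> J (c * \prod_(y <- w) y)) ->
  ideal_power m M z -> J (c * z).
Proof.
move=> idJ ms; have idJc d : is_ideal (fun z => J (d * z)).
  split=> [|a b Ja Jb|a b Jb]; first by rewrite mulr0; apply: ideal0.
    by rewrite mulrDr; apply: idealD.
  by rewrite mulrCA; apply: idealMl.
elim: M c z => [|M IH] c z wP /=.
  by move=> _; apply: idealMr => //; have := wP [::]; rewrite big_nil mulr1; apply.
move=> zM; apply: (ideal_gen_min zM (idJc c)) => _ [a [b [ma bM ->]]].
rewrite [a * b]mulrC mulrA; apply: (ideal_gen_min (ms a ma) (idJc (c * b))) => y ys.
rewrite mulrAC; apply: IH bM => w ws sw.
have := wP (y :: w); rewrite big_cons mulrA; apply; last by rewrite /= sw.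
by move=> x; rewrite inE => /predU1P[->//|/ws].
Qed.

(** Let [J] be maximal among the ideals that meet [N] in [m N]. It contains a power of [m], hence
    [N], so [N = m N] and Nakayama applies. This bypasses the Artin-Rees lemma. *)
Lemma krull_intersection (x : A) :
  (forall n, ideal_power m n x) -> exists s, h s = 1 /\ s * x = 0.
Proof.
pose N y := forall n, ideal_power m n y.
have idN : is_ideal N.
  split=> [n|a b Na Nb n|a b Nb n]; first exact: ideal0 (ideal_power_ideal _ _).
    by apply: idealD => //; apply: ideal_power_ideal.
  by apply: idealMl => //; apply: ideal_power_ideal.
have idmN : is_ideal (m_times N) by apply: ideal_gen_ideal.
pose P (J : A -> Prop) := [/\ is_ideal J, forall a, m_times N a -> J a
  & forall a, J a -> N a -> m_times N a].
have [||J [[idJ mNJ JN] Jmax]] := noetherian_max (P := P) (I0 := m_times N) noethA.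
- by move=> I [].
- by split.
have pow a : m a -> exists t, J (a ^+ t).
  (* The chain of ideals [J : a^t] stabilizes. At such a [t], adding [a^t] to [J] does not enlarge
     its intersection with [N], so maximality puts [a^t] in [J]. *)
  move=> ma; have [||t tP] := noetherian_acc (J := fun t y => J (a ^+ t * y)) noethA.
  - move=> t; split=> [|b c Jb Jc|b c Jc]; first by rewrite mulr0; apply: ideal0.
      by rewrite mulrDr; apply: idealD.
    by rewrite mulrCA; apply: idealMl.
  - by move=> t y Jy; rewrite exprS -mulrA; apply: idealMl.
  exists t; apply: (Jmax (fun z => exists j r, J j /\ z = j + a ^+ t * r)); last first.
  - by exists 0, 1; rewrite add0r mulr1; split=> //; apply: ideal0.
  - by move=> j Jj; exists j, 0; rewrite mulr0 addr0.
  split=> [|z Nz|_ [j [r [Jj ->]]] Nz].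
  - split=> [|_ _ [j [r [Jj ->]]] [j' [r' [Jj' ->]]]|c _ [j [r [Jj ->]]]].
    + by exists 0, 0; rewrite mulr0 addr0; split=> //; apply: ideal0.
    + by exists (j + j'), (r + r'); rewrite mulrDr addrACA; split=> //; apply: idealD.
    + exists (c * j), (c * r); rewrite mulrDr [c * (_ * _)]mulrCA.
      by split=> //; apply: idealMl.
  - by exists z, 0; rewrite mulr0 addr0; split=> //; apply: mNJ.
  - apply: (JN) => //; apply: idealD => //; apply: (tP t.+1).
    have -> : a ^+ t.+1 * r = a * (j + a ^+ t * r) - a * j by rewrite exprS; ring.
    apply: idealD => //; last by rewrite -mulrN; apply: idealMl => //;
      rewrite -mulN1r; apply: idealMl.
    by apply: mNJ; apply: ideal_gen_sub; exists a, (j + a ^+ t * r).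
have [s [sm ms]] := noethA id_m.
have [M MP] := long_words idJ (fun x xs => pow x (sm x xs)).
have NmN z : N z -> m_times N z.
  move=> Nz; apply: JN => //; rewrite -[z]mul1r.
  apply: (power_of_words (s := s) (M := M)) => // w ws sw.
  by rewrite mul1r; apply: MP; rewrite // sw.
move=> Nx; have [g [gN Ng]] := noethA idN.
have [y yg|u [hu ug]] := nakayama (g := g).
  exists 1; rewrite rmorph1 mul1r; split=> //.
  apply: (ideal_gen_min (NmN y (gN y yg))); first exact: ideal_gen_ideal.
  move=> _ [a [b [ma Nb ->]]].
  apply: (ideal_gen_min (Ng b Nb) (I := fun b => m_times (fun z => z \in g) (a * b))).
    have idg : is_ideal (m_times (fun z => z \in g)) by apply: ideal_gen_ideal.
    split=> [|c d Gc Gd|c d Gd]; first by rewrite mulr0; apply: ideal0.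
      by rewrite mulrDr; apply: idealD.
    by rewrite mulrCA; apply: idealMl.
  by move=> c cg; apply: ideal_gen_sub; exists a, c.
exists u; split=> //; rewrite mulrC.
apply: (ideal_gen_min (Ng x Nx) (annihilator_ideal u)) => y yg.
by rewrite mulrC ug.
Qed.

End Krull.

(** * Valuation rings from gradings *)

Lemma div_sub (F : fieldType) (a b c d : F) : b <> 0 -> d <> 0 ->
  a / b - c / d = (a * d - b * c) / (b * d).
Proof.
by move=> /eqP b0 /eqP d0; rewrite -mulNr addf_div // mulNr [b * c]mulrC.
Qed.

Section GradedValuation.
Variables (A : comPzRingType) (F kap : fieldType) (iota : {rmorphism A -> F}).
(* [w g a] reads "[a] has value at least [g]", and [r g a] is the coefficient of
   [a] in degree [g]. *)
Variables (G : Type) (mulG : G -> G -> G) (w : G -> A -> Prop) (r : G -> A -> kap).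

Hypothesis fracP : forall y, exists a b, iota b <> 0 /\ y = iota a / iota b.
Hypothesis w0 : forall g a, iota a = 0 -> w g a /\ r g a = 0.
Hypothesis wB : forall g a b, w g a -> w g b ->
  w g (a - b) /\ r g (a - b) = r g a - r g b.
Hypothesis wM : forall g h a b, w g a -> w h b ->
  w (mulG g h) (a * b) /\ r (mulG g h) (a * b) = r g a * r h b.
Hypothesis w_lead : forall a, iota a <> 0 -> exists g, w g a /\ r g a <> 0.
Hypothesis w_total : forall g h a b, w g a -> r g a <> 0 -> w h b -> r h b <> 0 ->
  w g b \/ w h a.

(** Encodes that [y] is in the valuation ring with residue [c]: the denominator has value exactly
    [g], the numerator at least [g]. *)
Definition graded_value (y : F) (c : kap) : Prop :=
  exists g a b, [/\ w g a, w g b, r g b <> 0, y = iota a / iota b & c = r g a / r g b].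

Let r_neq0 g b : r g b <> 0 -> iota b <> 0.
Proof. by move=> rb ib; have [] := w0 g ib. Qed.

Lemma graded_value_inj y c c' : graded_value y c -> graded_value y c' -> c = c'.
Proof.
move=> [g [a [b [wa wb rb -> ->]]]] [h [a' [b' [wa' wb' rb' E ->]]]].
have ib := r_neq0 rb; have ib' := r_neq0 rb'.
have [w1 r1] := wM wa wb'; have [w2 r2] := wM wb wa'.
have [_] := wB w1 w2; rewrite r1 r2.
have [|_ ->] := w0 (mulG g h) (a := a * b' - b * a').
  rewrite rmorphB !rmorphM; apply/eqP; rewrite subr_eq0 [iota b * _]mulrC.
  by rewrite -eqr_div ?E; apply/eqP.
move/esym/eqP; rewrite subr_eq0 [r g b * _]mulrC => /eqP E'.
by apply/eqP; rewrite eqr_div ?E'; apply/eqP.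
Qed.

Let value1 : graded_value 1 1.
Proof.
have [|g [w1 r1]] := w_lead (a := 1); first by rewrite rmorph1; apply/eqP/oner_neq0.
exists g, 1, 1; split=> //; first by rewrite rmorph1 divr1.
by rewrite divff //; apply/eqP.
Qed.

Let valueB y c y' c' : graded_value y c -> graded_value y' c' ->
  graded_value (y - y') (c - c').
Proof.
move=> [g [a [b [wa wb rb -> ->]]]] [h [a' [b' [wa' wb' rb' -> ->]]]].
have ib := r_neq0 rb; have ib' := r_neq0 rb'.
have [w1 r1] := wM wa wb'; have [w2 r2] := wM wb wa'; have [w3 r3] := wM wb wb'.
have [w4 r4] := wB w1 w2.
exists (mulG g h), (a * b' - b * a'), (b * b'); split=> //.
- by rewrite r3; apply/eqP/mulf_neq0; apply/eqP.
- by rewrite rmorphB !rmorphM div_sub.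
- by rewrite r4 r1 r2 r3 div_sub.
Qed.

Lemma graded_valueM y c y' c' : graded_value y c -> graded_value y' c' ->
  graded_value (y * y') (c * c').
Proof.
move=> [g [a [b [wa wb rb -> ->]]]] [h [a' [b' [wa' wb' rb' -> ->]]]].
have [w1 r1] := wM wa wa'; have [w3 r3] := wM wb wb'.
exists (mulG g h), (a * a'), (b * b'); split=> //.
- by rewrite r3; apply/eqP/mulf_neq0; apply/eqP.
- by rewrite !rmorphM mulf_div.
- by rewrite r1 r3 mulf_div.
Qed.

(** Degrees carry neither an order nor inverses; values are compared through [w_total] only. This
    lets monomials, or pairs built from other gradings, serve as degrees. *)
Lemma graded_valuation : exists (Ov : comPzRingType) (i : {rmorphism Ov -> F})
    (res : {rmorphism Ov -> kap}),
  [/\ valuation_ring i res, forall o, graded_value (i o) (res o)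
    & forall y c, graded_value y c -> exists o, i o = y].
Proof.
have [|||Ov [i [inj_i iP]]] := @subring_exists F (fun y => exists c, graded_value y c).
- by exists 1.
- by move=> x y [c xc] [d yd]; exists (c - d); apply: valueB.
- by move=> x y [c xc] [d yd]; exists (c * d); apply: graded_valueM.
have /choice[f fP] : forall o, exists c, graded_value (i o) c.
  by move=> o; apply/iP; exists o.
have f_hom : ring_hom f.
  split=> [o o'|o o'|].
  - apply: (graded_value_inj (fP _)); rewrite rmorphD -[i o']opprK -[f o']opprK.
    apply: valueB => //; rewrite -[- i o']sub0r -[- f o']sub0r; apply: valueB => //.
    by rewrite -(subrr (1 : F)) -(subrr (1 : kap)); apply: valueB.
  - by apply: (graded_value_inj (fP _)); rewrite rmorphM; apply: graded_valueM.
  - by apply: (graded_value_inj (fP _)); rewrite rmorph1.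
have [res resE] := rmorphism_of f_hom.
have total y : (exists o, i o = y) \/ (exists o, i o * y = 1).
  have [a [b [ib ->]]] := fracP y.
  have [ia|ia] := EM (iota a = 0).
    by left; exists 0; rewrite ia mul0r rmorph0.
  have [g [wa ra]] := w_lead ia; have [h [wb rb]] := w_lead ib.
  have [wgb|wha] := w_total wa ra wb rb; [right|left]; last first.
    by apply/iP; exists (r h a / r h b), h, a, b.
  have [|o oE] := proj1 (iP (iota b / iota a)).
    by exists (r g b / r g a), g, b, a.
  by exists o; rewrite oE mulf_div [iota a * _]mulrC divff //; apply/mulf_neq0; apply/eqP.
exists Ov, i, res; split=> [|o|y c yc]; last 1 first.
- by apply/iP; exists c.
- split=> // o; rewrite resE; have [g [a [b [wa wb rb E ->]]]] := fP o => rab.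
  have ra : r g a <> 0 by move=> ra; apply: rab; rewrite ra mul0r.
  have [|o' o'E] := proj1 (iP (iota b / iota a)).
    by exists (r g b / r g a), g, b, a.
  exists o'; apply: inj_i; rewrite rmorphM E o'E rmorph1 mulf_div [iota b * _]mulrC divff //.
  by apply/mulf_neq0; apply/eqP; apply: r_neq0; eassumption.
- by rewrite resE.
Qed.

End GradedValuation.

(** * Monomial valuations of a rational function field *)

(* [v] is only meaningful away from 0, and [rho] on the ring of the valuation. *)
Record place (E kap : fieldType) (v : E -> int) (rho : E -> kap) : Prop := Place {
  placeM : forall a b, a != 0 -> b != 0 -> v (a * b) = v a + v b;
  placeD : forall a b n, (a = 0 \/ n <= v a) -> (b = 0 \/ n <= v b) ->
    a + b = 0 \/ n <= v (a + b);
  place1 : rho 1 = 1;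
  place_resD : forall a b, (a = 0 \/ 0 <= v a) -> (b = 0 \/ 0 <= v b) ->
    rho (a + b) = rho a + rho b;
  place_resM : forall a b, (a = 0 \/ 0 <= v a) -> (b = 0 \/ 0 <= v b) ->
    rho (a * b) = rho a * rho b;
  place_res0 : forall a, (a = 0 \/ 0 <= v a) -> (rho a = 0 <-> a = 0 \/ 0 < v a) }.

(* The exponent of a monomial [a t^d] is [(v a, d)]; a cone is the set of positive
   elements of a group order on exponents. *)
Record cone (C : int -> int -> Prop) : Prop := Cone {
  coneD : forall x i y j, C x i -> C y j -> C (x + y) (i + j);
  cone0 : ~ C 0 0;
  cone_pos : forall x, 0 < x -> C x 0;
  cone_total : forall x i, (x = 0 /\ i = 0) \/ C x i \/ C (- x) (- i) }.

Definition weak_cone (C : int -> int -> Prop) (x i : int) : Prop :=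
  C x i \/ (x = 0 /\ i = 0).

Section Cones.
Variables (C : int -> int -> Prop).
Hypothesis coneC : cone C.

Lemma weak_coneDl x i y j : weak_cone C x i -> C y j -> C (x + y) (i + j).
Proof. by case=> [Cx|[-> ->]] Cy; [apply: coneD | rewrite !add0r]. Qed.

Lemma weak_coneD x i y j : weak_cone C x i -> weak_cone C y j -> weak_cone C (x + y) (i + j).
Proof.
move=> Cx [Cy|[-> ->]]; last by rewrite !addr0.
by left; apply: weak_coneDl.
Qed.

Lemma weak_cone_le x y i : x <= y -> weak_cone C x i -> weak_cone C y i.
Proof.
move=> xy Cx; have [->//|yx] := eqVneq y x.
rewrite -[y](subrK x) addrC -[i]addr0; left; apply: weak_coneDl => //.
by apply: (cone_pos coneC); lia.
Qed.

Lemma cone_pos_inv x : C x 0 -> 0 < x.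
Proof.
move=> Cx; case: (ltrgtP 0 x) => // [x0|x0]; case: (cone0 coneC).
  have := coneD coneC Cx (cone_pos coneC (x := - x) _); rewrite addrN addr0; apply; lia.
by rewrite {1}x0.
Qed.

Lemma weak_cone_nneg x : weak_cone C x 0 -> 0 <= x.
Proof. by case=> [/cone_pos_inv/ltW //|[-> _]]. Qed.

Lemma weak_cone_total x i : weak_cone C x i \/ C (- x) (- i).
Proof.
by have [H|[H|H]] := cone_total coneC x i; [left; right | left; left | right].
Qed.

End Cones.

Section Place.
Variables (E kap : fieldType) (v : E -> int) (rho : E -> kap).
Hypothesis pl : place v rho.

Lemma place_v1 : v 1 = 0.
Proof.
have H : v (1 * 1) = v 1 + v 1 by apply: (placeM pl); apply: oner_neq0.
by move: H; rewrite mulr1; lia.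
Qed.

Lemma placeN a : v (- a) = v a.
Proof.
have [->|a0] := eqVneq a 0; first by rewrite oppr0.
have N10 : (-1 : E) != 0 by rewrite oppr_eq0 oner_neq0.
have := placeM pl N10 N10; rewrite mulrNN mulr1 place_v1 => H.
by rewrite -mulN1r (placeM pl N10 a0); lia.
Qed.

Lemma placeV a : a != 0 -> v a^-1 = - v a.
Proof.
move=> a0; have a'0 : a^-1 != 0 by rewrite invr_eq0.
by have := placeM pl a0 a'0; rewrite mulfV // place_v1; lia.
Qed.

Lemma place_div a b : a != 0 -> b != 0 -> v (a / b) = v a - v b.
Proof. by move=> a0 b0; rewrite (placeM pl) ?invr_eq0 // placeV. Qed.

Lemma place_rho0 : rho 0 = 0.
Proof. by apply/(place_res0 pl); left. Qed.

Lemma place_rhoN a : (a = 0 \/ 0 <= v a) -> rho (- a) = - rho a.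
Proof.
move=> Oa; apply: (addIr (rho a)); rewrite -(place_resD pl) // ?addNr ?place_rho0 //.
by case: Oa => [->|Oa]; [left; rewrite oppr0 | right; rewrite placeN].
Qed.

Definition up_closed (P : int -> Prop) := forall x y, x <= y -> P x -> P y.

Lemma place_up_sum (P : int -> Prop) (T : Type) (s : seq T) (Q : pred T) (F : T -> E) :
  up_closed P -> (forall i, Q i -> F i = 0 \/ P (v (F i))) ->
  \sum_(i <- s | Q i) F i = 0 \/ P (v (\sum_(i <- s | Q i) F i)).
Proof.
move=> upP PF; elim/big_ind: _ => [|a b|//]; first by left.
case=> [->|Pa]; first by rewrite add0r.
case=> [->|Pb]; first by rewrite addr0; right.
case: (leP (v a) (v b)) => [ab|/ltW ba].
  case: (placeD pl (a := a) (b := b) (n := v a)); [by right | by right | by left |].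
  by move=> H; right; apply: upP H Pa.
case: (placeD pl (a := a) (b := b) (n := v b)); [by right | by right | by left |].
by move=> H; right; apply: upP H Pb.
Qed.

Lemma place_up_sub (P : int -> Prop) a b : up_closed P ->
  a = 0 \/ P (v a) -> b = 0 \/ P (v b) -> a - b = 0 \/ P (v (a - b)).
Proof.
move=> upP Pa Pb.
have := @place_up_sum P bool [:: true; false] xpredT (fun i => if i then a else - b) upP.
rewrite !big_cons big_nil addr0; apply=> -[] // _; case: Pb => [->|Pb].
  by left; rewrite oppr0.
by right; rewrite placeN.
Qed.

Variables (C : int -> int -> Prop).
Hypothesis coneC : cone C.

(** The degree [(b, j)] stands for the value of the monomial [b t^j]. Keeping [b] itself, and not
    only [v b], turns the coefficient [p_j / b] into an element with a residue in [kap]. *)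
Let deg := ({b : E | b != 0} * nat)%type.
Let deg_mul (g h : deg) : deg :=
  (exist _ (sval g.1 * sval h.1) (mulf_neq0 (svalP g.1) (svalP h.1)), (g.2 + h.2)%N).

Let above (g : deg) (p : {poly E}) : Prop := forall i,
  p`_i = 0 \/ weak_cone C (v p`_i - v (sval g.1)) (i%:Z - g.2%:Z).
(** Exponents are totally ordered by the cone, so a monomial with the value of [b t^j] has degree
    [j]: a single coefficient determines the residue. *)
Let coef_at (g : deg) (p : {poly E}) : kap := rho (p`_(g.2) / sval g.1).

Let up_weak x i : up_closed (fun y => weak_cone C (y - x) i).
Proof. by move=> y z yz; apply: weak_cone_le => //; lia. Qed.

Let up_gt0 (x : int) : up_closed (fun y => x < y).
Proof. by move=> y z yz xy; apply: lt_le_trans yz. Qed.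

Let above_int (g : deg) p : above g p -> p`_(g.2) / sval g.1 = 0 \/ 0 <= v (p`_(g.2) / sval g.1).
Proof.
move=> /(_ g.2); case: g => [[b b0] j] /=; rewrite subrr => -[->|].
  by left; rewrite mul0r.
have [->|pj] := eqVneq p`_j 0; first by left; rewrite mul0r.
by rewrite place_div // => /(weak_cone_nneg coneC); right.
Qed.

Let aboveB g p q : above g p -> above g q ->
  above g (p - q) /\ coef_at g (p - q) = coef_at g p - coef_at g q.
Proof.
move=> wp wq; split.
  by move=> i; rewrite coefB; apply: (place_up_sub (@up_weak _ _)); [apply: wp | apply: wq].
have Op := above_int wp; have Oq := above_int wq.
rewrite /coef_at coefB mulrBl (place_resD pl) //.
  by rewrite place_rhoN.
by case: Oq => [->|Oq]; [left; rewrite oppr0 | right; rewrite placeN].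
Qed.

Let aboveM g h p q : above g p -> above h q ->
  above (deg_mul g h) (p * q) /\ coef_at (deg_mul g h) (p * q) = coef_at g p * coef_at h q.
Proof.
move=> wp wq; have b0 := svalP g.1; have c0 := svalP h.1.
split.
  move=> l; rewrite coefM; apply: place_up_sum (@up_weak _ _) _ => -[i il] _ /=.
  have [->|pi0] := eqVneq p`_i 0; first by left; rewrite mul0r.
  have [->|qi0] := eqVneq q`_(l - i) 0; first by left; rewrite mulr0.
  right; rewrite !(placeM pl) //.
  have := weak_coneD coneC (or_ind (fun e => False_ind _ (elimN eqP pi0 e)) id (wp i))
    (or_ind (fun e => False_ind _ (elimN eqP qi0 e)) id (wq (l - i)%N)).
  by congr weak_cone; [ring | move: il; rewrite ltnS; lia].
have Op := above_int wp; have Oq := above_int wq.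
rewrite /coef_at -(place_resM pl) //=.
have ltj : (g.2 < (g.2 + h.2).+1)%N by rewrite ltnS leq_addr.
rewrite coefM (bigD1 (Ordinal ltj)) //= addKn mulrDl -mulf_div.
(* The terms of the convolution with [i != g.2] lie strictly above the product of the two
   degrees. *)
set z := (\sum_(_ < _ | _) _) / _.
have zP : z = 0 \/ 0 < v z.
  have bc0 := mulf_neq0 b0 c0.
  rewrite /z; set y := \sum_(_ < _ | _) _.
  suff [->|Hy] : y = 0 \/ v (sval g.1 * sval h.1) < v y.
  - by left; rewrite mul0r.
  - have [y0|y0] := eqVneq y 0; first by left; rewrite y0 mul0r.
    by right; rewrite place_div //; lia.
  - apply: place_up_sum (@up_gt0 _) _ => -[i il] ij /=.
    have [->|pi0] := eqVneq p`_i 0; first by left; rewrite mul0r.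
    have [->|qi0] := eqVneq q`_(g.2 + h.2 - i) 0; first by left; rewrite mulr0.
    right; rewrite !(placeM pl) //.
    have {}ij : i != g.2 by apply: contraNneq ij => ij; apply/eqP/val_inj.
    case: (wp i) => [/eqP|Ci]; first by rewrite (negPf pi0).
    case: (wq (g.2 + h.2 - i)%N) => [/eqP|Cj]; first by rewrite (negPf qi0).
    case: Cj => [Cj|[_ Ej]]; last by move: ij Ej => /eqP; lia.
    have := weak_coneDl coneC Ci Cj.
    have -> : (i%:Z - g.2%:Z + ((g.2 + h.2 - i)%N%:Z - h.2%:Z) = 0)%R by lia.
    move/(cone_pos_inv coneC); rewrite -(subr_gt0 (_ + _)).
    by congr (is_true (0 < _)); ring.
rewrite (place_resD pl); last 2 first.
- case: Op => [->|Op]; first by left; rewrite mul0r.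
  case: Oq => [->|Oq]; first by left; rewrite mulr0.
  have [->|p0] := eqVneq (p`_(g.2) / sval g.1) 0; first by left; rewrite mul0r.
  have [->|q0] := eqVneq (q`_(h.2) / sval h.1) 0; first by left; rewrite mulr0.
  by right; rewrite (placeM pl) // addr_ge0.
- by case: zP => [->|zP]; [left | right; apply: ltW].
have -> : rho z = 0.
  by apply/(place_res0 pl) => //; case: zP => [->|zP]; [left | right; apply: ltW].
by rewrite addr0.
Qed.

Let min_term (p : {poly E}) n : (exists2 i, (i < n)%N & p`_i != 0) ->
  exists2 j, p`_j != 0 & forall i, (i < n)%N -> p`_i = 0 \/
    weak_cone C (v p`_i - v p`_j) (i%:Z - j%:Z).
Proof.
elim: n => [[]//|n IH] [i0 in0 pi0].
have [pn|pn] := eqVneq p`_n 0.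
  have [|j pj jP] := IH.
    exists i0 => //; move: in0; rewrite ltnS leq_eqVlt => /predU1P[E0|//].
    by rewrite E0 pn eqxx in pi0.
  exists j => // i; rewrite ltnS leq_eqVlt => /predU1P[->|/jP//]; by left.
have [ex|no] := EM (exists2 i, (i < n)%N & p`_i != 0); last first.
  exists n => // i; rewrite ltnS leq_eqVlt => /predU1P[->|lt_in].
    by right; right; rewrite !subrr.
  by left; apply/eqP; apply: contrapT => /negP pi; apply: no; exists i.
have [j pj jP] := IH ex.
have [Cnj|Cjn] := weak_cone_total coneC (v p`_n - v p`_j) (n%:Z - j%:Z).
  by exists j => // i; rewrite ltnS leq_eqVlt => /predU1P[->|/jP//]; right.
exists n => // i; rewrite ltnS leq_eqVlt => /predU1P[->|/jP [->|Cij]]; try by [left].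
  by right; right; rewrite !subrr.
right; left; have := weak_coneDl coneC Cij Cjn.
by congr C; lia.
Qed.

Let above_lead p : p <> 0 -> exists g, above g p /\ coef_at g p <> 0.
Proof.
move/eqP=> p0; have [|j pj jP] := @min_term p (size p).
  exists (size p).-1; first by rewrite prednK // size_poly_gt0.
  by rewrite -lead_coefE lead_coef_eq0.
exists (exist _ p`_j pj, j); split; last first.
  by rewrite /coef_at /= divff // (place1 pl); apply/eqP/oner_neq0.
move=> i /=; have [/jP//|sp] := ltnP i (size p).
by left; rewrite nth_default.
Qed.

Let above_trans g h p : above g p -> weak_cone C (v (sval g.1) - v (sval h.1)) (g.2%:Z - h.2%:Z) ->
  above h p.
Proof.
move=> wp gh i; case: (wp i) => [->|Ci]; [by left | right].
by have := weak_coneD coneC Ci gh; congr weak_cone; lia.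
Qed.

Let above_total g h p q : above g p -> coef_at g p <> 0 -> above h q -> coef_at h q <> 0 ->
  above g q \/ above h p.
Proof.
move=> wp _ wq _.
have [gh|hg] :=
  weak_cone_total coneC (v (sval g.1) - v (sval h.1)) (g.2%:Z - h.2%:Z).
  by right; apply: above_trans gh.
left; apply: above_trans wq _; left; move: hg.
by congr C; ring.
Qed.

Variables (F : fieldType) (iota : {rmorphism {poly E} -> F}).
Hypothesis iota_inj : injective iota.
Hypothesis iota_frac : forall y, exists a b, iota b <> 0 /\ y = iota a / iota b.

Let iota0 p : iota p = 0 -> p = 0.
Proof. by rewrite -(rmorph0 iota) => /iota_inj. Qed.

Let above0 g p : iota p = 0 -> above g p /\ coef_at g p = 0.
Proof.
move=> /iota0 ->; split; first by move=> i; left; rewrite coef0.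
by rewrite /coef_at coef0 mul0r place_rho0.
Qed.

Definition mono_value (y : F) (c : kap) : Prop :=
  graded_value iota above coef_at y c.

Lemma mono_valuation : exists (Ov : comPzRingType) (i : {rmorphism Ov -> F})
    (res : {rmorphism Ov -> kap}),
  [/\ valuation_ring i res, forall o, mono_value (i o) (res o)
    & forall y c, mono_value y c -> exists o, i o = y].
Proof.
apply: (graded_valuation (mulG := deg_mul)) => // p ip.
by apply: above_lead => p0; apply: ip; rewrite p0 rmorph0.
Qed.

Lemma mono_value_inj y c c' : mono_value y c -> mono_value y c' -> c = c'.
Proof. exact: (graded_value_inj above0 aboveB aboveM). Qed.

Definition leading (q : {poly E}) j := q`_j != 0 /\ forall i,
  q`_i = 0 \/ weak_cone C (v q`_i - v q`_j) (i%:Z - j%:Z).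

Lemma leading_exists (q : {poly E}) : q != 0 -> exists j, leading q j.
Proof.
move=> q0; have [|j qj jP] := @min_term q (size q).
  exists (size q).-1; first by rewrite prednK // size_poly_gt0.
  by rewrite -lead_coefE lead_coef_eq0.
exists j; split=> // i; have [/jP//|sq] := ltnP i (size q).
by left; rewrite nth_default.
Qed.

Lemma mono_value_of (p q : {poly E}) j : leading q j ->
  (forall i, p`_i = 0 \/ weak_cone C (v p`_i - v q`_j) (i%:Z - j%:Z)) ->
  mono_value (iota p / iota q) (rho (p`_j / q`_j)).
Proof.
move=> [qj jq] jp; exists (exist _ q`_j qj, j), p, q; split=> //.
  by rewrite /coef_at /= divff // (place1 pl); apply/eqP/oner_neq0.
by rewrite /coef_at /= divff // (place1 pl) divr1.
Qed.

(** Any representation of the fraction computes the residue. Were the leading term of [p] below that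
    of [q], then [q/p] would have residue 0, and its product with [p/q] would give 1 the residue
    0. *)
Lemma mono_value_rep (p q : {poly E}) c : q != 0 -> mono_value (iota p / iota q) c ->
  exists j, [/\ leading q j,
    forall i, p`_i = 0 \/ weak_cone C (v p`_i - v q`_j) (i%:Z - j%:Z)
    & c = rho (p`_j / q`_j)].
Proof.
move=> q0 pqc; have [j jq] := leading_exists q0.
suff jp : forall i, p`_i = 0 \/ weak_cone C (v p`_i - v q`_j) (i%:Z - j%:Z).
  by exists j; split=> //; apply: (mono_value_inj pqc); apply: mono_value_of.
have [->|p0] := eqVneq p 0; first by move=> i; left; rewrite coef0.
have [l [pl0 lp]] := leading_exists p0; have [qj0 jq'] := jq.
have [lj|jl] := weak_cone_total coneC (v p`_l - v q`_j) (l%:Z - j%:Z).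
  move=> i; case: (lp i) => [->|il]; [by left | right].
  have := weak_coneD coneC il lj.
  by congr weak_cone; ring.
have lq i : q`_i = 0 \/ C (v q`_i - v p`_l) (i%:Z - l%:Z).
  case: (jq' i) => [->|ij]; [by left | right].
  by have := weak_coneDl coneC ij jl; congr C; ring.
have qp : mono_value (iota q / iota p) (rho (q`_l / p`_l)).
  apply: mono_value_of => // i; case: (lq i) => [->|il]; [by left | by right; left].
have rho_ql : rho (q`_l / p`_l) = 0.
  have P : q`_l / p`_l = 0 \/ 0 < v (q`_l / p`_l).
    case: (lq l) => [->|]; first by left; rewrite mul0r.
    rewrite subrr => /(cone_pos_inv coneC) H.
    have [->|ql0] := eqVneq q`_l 0; first by left; rewrite mul0r.
    by right; rewrite place_div.
  by apply/(place_res0 pl) => //; case: P => [->|/ltW]; [left | right].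
have ip0 : iota p != 0 by apply: contraNneq p0 => /iota0 ->.
have iq0 : iota q != 0 by apply: contraNneq q0 => /iota0 ->.
have := graded_valueM aboveM pqc qp; rewrite rho_ql mulr0.
rewrite mulf_div [iota q * _]mulrC divff ?mulf_neq0 // => one0.
have one1 : mono_value 1 1.
  rewrite -[X in mono_value X](divff iq0); have := @mono_value_of q q j jq jq'.
  by rewrite (divff qj0) (place1 pl).
by have /eqP := mono_value_inj one1 one0; rewrite oner_eq0.
Qed.

Lemma mono_value_const a : (a = 0 \/ 0 <= v a) -> mono_value (iota a%:P) (rho a).
Proof.
move=> Oa; have := @mono_value_of a%:P 1 0%N; rewrite rmorph1 !divr1 coefC coefC eqxx divr1.
apply=> [|i].
  split=> [|i]; first by rewrite coefC oner_neq0.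
  rewrite !coefC; case: i => [|i]; [right; right; by rewrite !subrr | by left].
rewrite coefC; case: i => [|i]; last by left.
case: Oa => [->|Oa]; [by left | right].
rewrite /= place_v1 subr0; case: (ltrgtP 0 (v a)) Oa => // [va|<-] _; last by right.
by left; apply: cone_pos.
Qed.

Lemma mono_value_monomial a m n : a != 0 -> C (v a) (m%:Z - n%:Z) ->
  mono_value (iota (a *: 'X^m) / iota 'X^n) 0.
Proof.
move=> a0 Ca; have XnE i : ('X^n : {poly E})`_i = (i == n)%:R by rewrite coefXn.
have lX : leading 'X^n n.
  split=> [|i]; first by rewrite XnE eqxx oner_neq0.
  rewrite !XnE eqxx; case: eqP => [->|_]; [right; right; by rewrite !subrr | by left].
have <- : rho ((a *: 'X^m)`_n / ('X^n)`_n) = 0.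
  rewrite coefZ coefXn XnE eqxx divr1.
  case: eqP => [nm|_]; last by rewrite mulr0 place_rho0.
  rewrite nm subrr in Ca; have va := cone_pos_inv coneC Ca.
  by rewrite mulr1; apply/(place_res0 pl); right; rewrite // ltW.
apply: mono_value_of => // i; rewrite coefZ coefXn XnE eqxx.
case: eqP => [->|_]; last by left; rewrite mulr0.
by right; left; rewrite mulr1 place_v1 subr0.
Qed.

End Place.

(** Exponents are ordered by the weight [q x + n i], that is at slope [n/q], with ties broken by the
    sign of [e i]: the two orders infinitely close to the wall, one on each side. *)
Definition wall_cone (q n e : int) (x i : int) : Prop :=
  0 < q * x + n * i \/ (q * x + n * i = 0 /\ 0 < e * i).

(** The order at infinite slope, where the degree decides before the value. It belongs to the
    valuation at [t = 0] or [t = oo] followed by [v]. *)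
Definition end_cone (e : int) (x i : int) : Prop :=
  0 < e * i \/ (i = 0 /\ 0 < x).

Lemma wall_coneP q n e : 0 < q -> e != 0 -> cone (wall_cone q n e).
Proof.
move=> q0 e0; split; rewrite /wall_cone.
- move=> x i y j H1 H2; rewrite !mulrDr addrACA.
  by case: H1 H2 => [H1|[E1 H1]] [H2|[E2 H2]]; lia.
- by rewrite !mulr0 addr0 ltxx; case=> [|[]].
- by move=> x x0; left; rewrite mulr0 addr0 mulr_gt0.
- move=> x i; rewrite !mulrN -opprD oppr_gt0.
  case: (ltrgtP 0 (q * x + n * i)) => [H|H|/esym H].
  + by right; left; left.
  + by right; right; left.
  + case: (ltrgtP 0 (e * i)) => [H'|H'|/esym H'].
    * by right; left; right.
    * by right; right; right; rewrite H oppr0 oppr_gt0.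
    * move/eqP: H'; rewrite mulf_eq0 (negPf e0) => /eqP i0; left; split=> //.
      move/eqP: H; rewrite i0 mulr0 addr0 mulf_eq0 => /orP[/eqP|/eqP//].
      by move: q0 => /[swap] ->; rewrite ltxx.
Qed.

Lemma end_coneP e : e != 0 -> cone (end_cone e).
Proof.
move=> e0; split; rewrite /end_cone.
- move=> x i y j H1 H2; rewrite mulrDr.
  by case: H1 H2 => [H1|[E1 H1]] [H2|[E2 H2]]; subst; rewrite ?mulr0 ?addr0 ?add0r;
    by [left; rewrite ?addr_gt0 | right; rewrite addr_gt0].
- by rewrite mulr0 ltxx; case=> [|[]].
- by move=> x x0; right.
- move=> x i; rewrite mulrN oppr_gt0; case: (ltrgtP 0 (e * i)) => [H|H|/esym /eqP H].
  + by right; left; left.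
  + by right; right; left.
  + move: H; rewrite mulf_eq0 (negPf e0) => /eqP ->.
    case: (ltrgtP 0 x) => [H|H|->].
    * by right; left; right.
    * by right; right; right; rewrite oppr0 oppr_gt0.
    * by left.
Qed.

Definition cones_agree (N H : nat) (C C' : int -> int -> Prop) : Prop :=
  forall x d, `|x| <= H%:Z -> `|d| <= N%:Z -> C x d -> C' x d.

(* Between two consecutive integral slopes no exponent of degree at most [N]
   vanishes, provided [q] is divisible by all integers up to [N]. *)
Lemma wall_agree N H q n : (forall d : nat, (0 < d <= N)%N -> (d%:Z %| q)%Z) ->
  cones_agree N H (wall_cone q n 1) (wall_cone q (n + 1) (-1)).
Proof.
move=> qN x d _ dN; rewrite /wall_cone mulrDl !mul1r mulN1r.
case: (ltrgtP d 0) => d0.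
- move=> Hx; have /qN/dvdzP[m qE] : (0 < absz d <= N)%N by lia.
  (* As [d] divides [q], the weight is a multiple of [|d|]. Being positive it is at least [|d|], so
     it stays nonnegative when [n] grows by 1, and the tie-break -1 settles the case of zero. *)
  have [r rE] : exists r, q * x + n * d = r * (absz d)%:Z.
    by exists (m * x - n); rewrite qE; nia.
  have pos : 0 < q * x + n * d by case: Hx => // -[_]; lia.
  have r0 : 1 <= r by nia.
  have : (absz d)%:Z <= q * x + n * d by rewrite rE; nia.
  move=> le; case: (ltrgtP (q * x + n * d) (absz d)%:Z) => cmp; [lia | left; lia | right; lia].
- by case=> [Hx|[Hx _]]; left; lia.
- by rewrite d0 !mulr0 !addr0 => -[Hx|[Hx]]; [left; lia|lia].
Qed.

Lemma end_agree_pos N H (q n : int) : 0 < q -> q * H%:Z < n ->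
  cones_agree N H (end_cone 1) (wall_cone q n 1).
Proof.
move=> q0 nH x d xH dN; rewrite /end_cone /wall_cone !mul1r => -[d0|[-> x0]]; left.
  have : - H%:Z <= x by lia.
  by move=> xH'; nia.
by rewrite mulr0 addr0 mulr_gt0.
Qed.

Lemma end_agree_neg N H (q n : int) : 0 < q -> q * H%:Z < n ->
  cones_agree N H (end_cone (-1)) (wall_cone q (- n) (-1)).
Proof.
move=> q0 nH x d xH dN; rewrite /end_cone /wall_cone !mulN1r => -[d0|[-> x0]]; left.
  have : - H%:Z <= x by lia.
  by move=> xH'; nia.
by rewrite mulr0 addr0 mulr_gt0.
Qed.

Section Agree.
Variables (E kap : fieldType) (v : E -> int) (rho : E -> kap).
Hypothesis pl : place v rho.
Variables (F : fieldType) (iota : {rmorphism {poly E} -> F}).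
Hypothesis iota_inj : injective iota.
Hypothesis iota_frac : forall y, exists a b, iota b <> 0 /\ y = iota a / iota b.

Definition exponents_bounded (N H : nat) (p q : {poly E}) : Prop :=
  forall i j, p`_i != 0 -> q`_j != 0 ->
    `|v p`_i - v q`_j| <= H%:Z /\ `|i%:Z - j%:Z| <= N%:Z.

Lemma exponents_boundedW N H N' H' p q : (N <= N')%N -> (H <= H')%N ->
  exponents_bounded N H p q -> exponents_bounded N' H' p q.
Proof. by move=> NN' HH' bd i j pi qj; have [] := bd i j pi qj; lia. Qed.

Lemma exponents_bounded_exists p q : exists N H, exponents_bounded N H p q.
Proof.
exists (size p + size q)%N.
exists (\max_(i < size p) \max_(j < size q) `|v p`_i - v q`_j|)%N => i j pi qj.
have lti : (i < size p)%N.
  by rewrite ltnNge; apply: contraNN pi => sp; rewrite nth_default.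
have ltj : (j < size q)%N.
  by rewrite ltnNge; apply: contraNN qj => sq; rewrite nth_default.
split; last by lia.
rewrite -abszE lez_nat.
apply: leq_trans (leq_bigmax (F := fun i : 'I_(size p) => _) (Ordinal lti)).
exact: (leq_bigmax (F := fun j : 'I_(size q) => `|v p`_i - v q`_j|%N) (Ordinal ltj)).
Qed.

Lemma mono_value_agree N H C C' p q c : cone C -> cones_agree N H C C' -> q != 0 ->
  exponents_bounded N H p q -> exponents_bounded N H q q ->
  mono_value v rho C iota (iota p / iota q) c -> mono_value v rho C' iota (iota p / iota q) c.
Proof.
move=> coneC CC' q0 pq qq.
have weak x d : `|x| <= H%:Z -> `|d| <= N%:Z -> weak_cone C x d -> weak_cone C' x d.
  by move=> xH dN [/(CC' _ _ xH dN)|]; [left | right].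
case/(mono_value_rep pl coneC iota_inj) => // j [[qj jq] jp ->].
apply: mono_value_of => // [|i].
  split=> // i; have [->|qi] := eqVneq q`_i 0; first by left.
  have [b1 b2] := qq i j qi qj; right; apply: weak => //.
  by case: (jq i) => // /eqP; rewrite (negPf qi).
have [->|pi] := eqVneq p`_i 0; first by left.
have [b1 b2] := pq i j pi qj; right; apply: weak => //.
by case: (jp i) => // /eqP; rewrite (negPf pi).
Qed.

End Agree.

(** * Centres of valuations on a proper scheme *)

Lemma lift_hom (A S L : comPzRingType) (f : {rmorphism A -> L}) (i : {rmorphism S -> L}) :
  injective i -> (forall a, exists s, i s = f a) ->
  exists g : {rmorphism A -> S}, forall a, i (g a) = f a.
Proof.
move=> inj_i /choice[g gE].
have g_hom : ring_hom g.
  by split=> [a b|a b|]; apply: inj_i;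
    rewrite ?(rmorphD, rmorphM, rmorph1) !gE ?(rmorphD, rmorphM, rmorph1).
by have [h hE] := rmorphism_of g_hom; exists h => a; rewrite hE gE.
Qed.

Lemma lift_alg_hom (R : comPzRingType) (A S L : algebra R) (f : alg_hom A L)
    (i : alg_hom S L) : injective i -> (forall a, exists s, i s = f a) ->
  exists g : alg_hom A S, forall a, i (g a) = f a.
Proof.
move=> inj_i /(lift_hom inj_i)[g gE].
have g_comm r : g (alg_map A r) = alg_map S r.
  by apply: inj_i; rewrite gE !alg_hom_comm.
by exists (AlgHom g_comm).
Qed.

Lemma kernel_factor (A B C : comPzRingType) (f : {rmorphism A -> B})
    (g : {rmorphism A -> C}) : (forall b, exists a, b = f a) ->
  (forall a, f a = 0 -> g a = 0) -> exists h : {rmorphism B -> C}, forall a, h (f a) = g a.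
Proof.
move=> f_surj fg; have /choice[s sE] := f_surj.
have gs a : g (s (f a)) = g a.
  by apply/eqP; rewrite -subr_eq0 -rmorphB fg // rmorphB -sE subrr.
have h_hom : ring_hom (fun b => g (s b)).
  split=> [x y|x y|].
  - by rewrite {1}[x]sE {1}[y]sE -rmorphD gs rmorphD.
  - by rewrite {1}[x]sE {1}[y]sE -rmorphM gs rmorphM.
  - by rewrite -(rmorph1 f) gs rmorph1.
by have [h hE] := rmorphism_of h_hom; exists h => a; rewrite hE gs.
Qed.

Definition eq_hom (R L : comPzRingType) (f g : {rmorphism R -> L}) (fg : f =1 g) :
  alg_hom (Alg f) (Alg g) :=
  @AlgHom R (Alg f) (Alg g) (idfun : {rmorphism L -> L}) fg.

Section Centres.
Variables (R : comPzRingType) (k kap : fieldType) (pi : {rmorphism R -> k})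
  (kphi : {rmorphism k -> kap}) (X : functor R).
Hypothesis X_proper : proper_scheme X.

Let kpt := restrict pi (Alg kphi).

Section Field.
Variables (L : fieldType) (psi : {rmorphism R -> L}).

(** The valuation enters through its graph: [val z c] means that [z] is integral with residue [c].
    Valuations of one field are then compared without identifying their rings. *)
Definition has_centre (val : L -> kap -> Prop) (x : X (Alg psi)) (y : X kpt) : Prop :=
  exists (Ov : algebra R) (i : alg_hom Ov (Alg psi)) (res : alg_hom Ov kpt) (x' : X Ov),
  [/\ valuation_ring (i : {rmorphism Ov -> L}) (res : {rmorphism Ov -> kap}),
      forall o, val (i o) (res o), forall z c, val z c -> exists o, i o = z,
      fmap i x' = x & fmap res x' = y].

Lemma has_centre_exists (val : L -> kap -> Prop) (Ov : comPzRingType)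
    (i : {rmorphism Ov -> L}) (res : {rmorphism Ov -> kap}) (x : X (Alg psi)) :
  valuation_ring i res -> (forall o, val (i o) (res o)) ->
  (forall z c, val z c -> exists o, i o = z) ->
  (forall z c c', val z c -> val z c' -> c = c') ->
  (forall r, val (psi r) (kphi (pi r))) -> exists y, has_centre val x y.
Proof.
move=> val_i vi iv vfun vR; have [inj_i _ _] := val_i.
have [s sE] := lift_hom inj_i (fun r => iv _ _ (vR r)).
pose OA : algebra R := Alg s.
pose iA : alg_hom OA (Alg psi) := @AlgHom R OA (Alg psi) i sE.
have resE r : res (s r) = kphi (pi r).
  by apply: (vfun (psi r)) => //; rewrite -sE; apply: vi.
pose rA : alg_hom OA kpt := @AlgHom R OA kpt res resE.
have val_O : valuation_ring (Ov := OA) i res by [].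
have iE : psi =1 alg_map (push_alg (A := OA) i) by move=> r; rewrite /= sE.
have [x' x'E] := valuative_criterion X_proper val_O (fmap (eq_hom iE) x).
exists (fmap rA x'), OA, iA, rA, x'; split=> //.
apply: (separated_inj (f := eq_hom iE)).
- by case: X_proper.
- by [].
- by rewrite -x'E fmap_compE; apply: eq_fmap.
Qed.

(** When [x] is defined over a subring where both valuations are integral with equal residues,
    separatedness makes both integral extensions of [x] come from that subring. *)
Lemma centre_compare (val val' : L -> kap -> Prop) (x : X (Alg psi)) y y' :
  (forall z c c', val z c -> val z c' -> c = c') ->
  (forall z c c', val' z c -> val' z c' -> c = c') ->
  has_centre val x y -> has_centre val' x y' ->
  (exists (S : algebra R) (j : alg_hom S (Alg psi)) (xs : X S), fmap j xs = x /\
     forall s, exists c, val (j s) c /\ val' (j s) c) -> y = y'.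
Proof.
move=> vfun vfun' [Ov [i [res [x1 [[inj_i _ _] vi iv x1E <-]]]]]
  [Ov' [i' [res' [x1' [[inj_i' _ _] vi' iv' x1'E <-]]]]] [S [j [xs [xsE jP]]]].
have [g gE] : exists g : alg_hom S Ov, forall s, i (g s) = j s.
  by apply: lift_alg_hom => // s; have [c [/iv]] := jP s.
have [g' g'E] : exists g' : alg_hom S Ov', forall s, i' (g' s) = j s.
  by apply: lift_alg_hom => // s; have [c [_ /iv']] := jP s.
have sepX : separated X by case: X_proper.
have <- : fmap g xs = x1.
  by apply: (separated_inj (f := i)) => //; rewrite fmap_compE x1E -xsE; apply: eq_fmap.
have <- : fmap g' xs = x1'.
  by apply: (separated_inj (f := i')) => //; rewrite fmap_compE x1'E -xsE; apply: eq_fmap.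
rewrite !fmap_compE; apply: eq_fmap => s /=; have [c [vc vc']] := jP s.
transitivity c; last by apply: (vfun' (j s)) => //; rewrite -g'E.
by apply/esym/(vfun (j s)) => //; rewrite -gE.
Qed.

End Field.

Hypothesis pi_surj : forall y, exists r, y = pi r.
Variables (V W : subfunctor (base_change pi X)).
Hypotheses (V_closed : closed_sub V) (W_closed : closed_sub W) (VW : is_union V W).

(* A coarser valuation has a centre on [V] or on [W], and the centres of all its
   specializations lie on the same component. *)
Lemma centre_specialize (L : fieldType) (psi : {rmorphism R -> L})
    (P : L -> Prop) (x : X (Alg psi)) :
  P 1 -> (forall z z', P z -> P z' -> P (z - z')) ->
  (forall z z', P z -> P z' -> P (z * z')) ->
  (forall z, P z \/ exists z', P z' /\ z' * z = 1) ->
  (forall r, P (psi r)) -> (forall r, pi r = 0 -> ~ exists z, P z /\ psi r * z = 1) ->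
  (forall val y, has_centre val x y -> (forall z c, val z c -> P z) ->
    lies_in V (y : base_change pi X (Alg kphi))) \/
  (forall val y, has_centre val x y -> (forall z c, val z c -> P z) ->
    lies_in W (y : base_change pi X (Alg kphi))).
Proof.
move=> P1 PB PM Ptotal PR P_pi.
have [O2 [i2 [inj_i2 i2P]]] := subring_exists P1 PB PM.
pose m (o : O2) := ~ exists o', o * o' = 1.
have total2 (o o' : O2) : (exists c, o = o' * c) \/ (exists c, o' = o * c).
  have [->|o0] := EM (o' = 0); first by right; exists 0; rewrite mulr0.
  have io0 : i2 o' != 0 by apply/eqP; rewrite -(rmorph0 i2) => /inj_i2.
  case: (Ptotal (i2 o / i2 o')) => [/i2P[c cE]|[z [/i2P[c <-] cE]]].
    by left; exists c; apply: inj_i2; rewrite rmorphM cE mulrC divfK.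
  right; exists c; apply: inj_i2; rewrite rmorphM.
  by rewrite -[LHS]mul1r -cE -!mulrA mulVf // mulr1 mulrC.
have prime_m : is_prime m.
  have mMl a o : m o -> m (a * o).
    by move=> mo [o' E]; apply: mo; exists (a * o'); rewrite -E; ring.
  split; first split.
  - by move=> [o']; rewrite mul0r => /(congr1 i2) /eqP; rewrite rmorph0 rmorph1 eq_sym oner_eq0.
  - move=> o o' mo mo'; case: (total2 o o') => -[c E].
      by rewrite E -[X in m (_ + X)]mulr1 -mulrDr mulrC; apply: mMl.
    by rewrite E -[X in m (X + _)]mulr1 -mulrDr mulrC; apply: mMl.
  - by move=> a o; apply: mMl.
  - by apply; exists 1; rewrite mulr1.
  - move=> o o' moo'; apply: contrapT => /not_orP[/contrapT[a oa] /contrapT[b ob]].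
    by apply: moo'; exists (a * b); rewrite mulrACA oa ob mulr1.
have [kap2 [res2 [res20 _]]] := prime_residue_field prime_m.
have val2 : valuation_ring i2 res2.
  split=> // [y|o ro].
    case: (Ptotal y) => [/i2P Py|[z [/i2P[o <-] zy]]]; first by left.
    by right; exists o.
  by apply: contrapT => mo; apply: ro; apply/res20.
have [s sE] := lift_hom inj_i2 (fun r => proj1 (i2P _) (PR r)).
(* By [P_pi] nothing in the kernel of [pi] is inverted, so the residue field is a [k]-algebra and
   the centre of the coarser valuation lies on the special fibre. *)
have [kphi2 kphi2E] : exists h : {rmorphism k -> kap2}, forall r, h (pi r) = (res2 \o s) r.
  apply: kernel_factor => // r r0; apply/res20 => -[o E]; apply: (P_pi r r0).
  by exists (i2 o); split; [apply/i2P; exists o | rewrite -sE -rmorphM E rmorph1].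
pose OA : algebra R := Alg s.
have iE : psi =1 alg_map (push_alg (A := OA) i2) by move=> r; rewrite /= sE.
have [x2 x2E] := valuative_criterion X_proper (val2 : valuation_ring (Ov := OA) i2 res2)
  (fmap (eq_hom iE) x).
pose rA : alg_hom OA (restrict pi (Alg kphi2)) :=
  @AlgHom R OA (restrict pi (Alg kphi2)) res2 (fun r => esym (kphi2E r)).
suff spec (Z : subfunctor (base_change pi X)) : closed_sub Z ->
    lies_in Z (fmap rA x2 : base_change pi X (Alg kphi2)) ->
    forall val y, has_centre val x y -> (forall z c, val z c -> P z) ->
    lies_in Z (y : base_change pi X (Alg kphi)).
  by have [H|H] := union_field V_closed W_closed VW (fmap rA x2 : base_change pi X (Alg kphi2));
    [left | right] => val y; apply: spec.
move=> Z_closed Zx2 val y [O1 [i1 [res1 [x1 [[inj_i1 _ unit1] vi1 _ x1E <-]]]]] valP.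
have [g gE] := lift_hom (f := i1 : {rmorphism O1 -> L}) inj_i2
  (fun o => proj1 (i2P _) (valP _ _ (vi1 o))).
(* [Q] is the image of the finer ring in [kap2]. It embeds in [kap2] and maps to [kap], so a closed
   condition passes from the centre over [kap2] to the one over [kap]. *)
have [Q [q [q_surj q_ker q_univ]]] := ideal_quotient
  (ideal_preim (res2 \o g : {rmorphism O1 -> kap2}) (@zero_ideal kap2)).
have [a aE] := q_univ _ (res2 \o g : {rmorphism O1 -> kap2}) (fun _ H => H).
have inj_a : injective a.
  move=> b b' E; apply/eqP; rewrite -subr_eq0; apply/eqP.
  have [o oE] := q_surj (b - b'); rewrite oE; apply/q_ker.
  by rewrite -aE -oE rmorphB E subrr.
have [b bE] : exists b : {rmorphism Q -> kap}, forall o, b (q o) = res1 o.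
  apply: q_univ => o /= /res20 mo; apply: contrapT => ro; apply: mo.
  by have [o' oo'] := unit1 o ro; exists (g o'); rewrite -rmorphM oo' rmorph1.
have g_comm r : g (alg_map O1 r) = s r.
  by apply: inj_i2; rewrite gE sE alg_hom_comm.
have [kQ kQE] : exists h : {rmorphism k -> Q}, forall r, h (pi r) = (q \o alg_map O1) r.
  apply: kernel_factor => // r r0; apply: inj_a.
  by rewrite rmorph0 aE /= g_comm -[LHS]kphi2E r0 rmorph0.
pose QA : algebra k := Alg kQ.
have a_comm c : a (kQ c) = kphi2 c.
  by have [r ->] := pi_surj c; rewrite kQE aE kphi2E /= g_comm.
have b_comm c : b (kQ c) = kphi c.
  by have [r ->] := pi_surj c; rewrite kQE bE /= alg_hom_comm.
pose aA : alg_hom QA (Alg kphi2) := @AlgHom k QA (Alg kphi2) a a_comm.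
pose bA : alg_hom QA (Alg kphi) := @AlgHom k QA (Alg kphi) b b_comm.
pose qA : alg_hom O1 (restrict pi QA) :=
  @AlgHom R O1 (restrict pi QA) q (fun r => esym (kQE r)).
pose gA : alg_hom O1 OA := @AlgHom R O1 OA g g_comm.
pose yQ : base_change pi X QA := fmap qA x1.
have gx1 : fmap gA x1 = x2.
  apply: (separated_inj (f := @push_hom R OA L i2)) => //; first by case: X_proper.
  by rewrite x2E -x1E !fmap_compE; apply: eq_fmap => o /=; rewrite gE.
have -> : fmap res1 x1 = fmap bA yQ :> base_change pi X (Alg kphi).
  by rewrite /yQ /= fmap_compE; apply: eq_fmap => o /=; rewrite bE.
apply: lies_in_fmap; apply: (closed_inj (f := aA)) => //.
suff -> : fmap aA yQ = fmap rA x2 by [].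
by rewrite /yQ /= -gx1 !fmap_compE; apply: eq_fmap => o /=; rewrite aE.
Qed.

End Centres.

(** * Specializing a rational curve *)

(** With this place the cones [end_cone 1] and [end_cone (-1)] give the valuations of E(t) at
    [t = 0] and [t = oo], whose residue field is E. *)
Lemma trivial_place (E : fieldType) : place (fun _ : E => 0 : int) (id : E -> E).
Proof.
split=> // [a b n an bn|a Oa]; last by split=> [->|[//|]]; [left | rewrite ltxx].
case: an => [->|]; last by right.
by case: bn => [->|]; [left; rewrite addr0 | right].
Qed.

Section Tropical.
Variables (R : comPzRingType) (k kap : fieldType) (pi : {rmorphism R -> k})
  (kphi : {rmorphism k -> kap}) (X : functor R).
Hypothesis X_proper : proper_scheme X.
Hypothesis pi_surj : forall y, exists r, y = pi r.
Variables (V W : subfunctor (base_change pi X)).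
Hypotheses (V_closed : closed_sub V) (W_closed : closed_sub W) (VW : is_union V W).
Let kpt := restrict pi (Alg kphi).
Hypothesis T_empty : forall y : base_change pi X (Alg kphi),
  lies_in V y -> lies_in W y -> False.

Variables (E : fieldType) (v : E -> int) (rho : E -> kap) (phi : {rmorphism R -> E}).
Hypothesis pl : place v rho.
Hypothesis v_surj : forall n, exists2 a, a != 0 & v a = n.
Hypothesis phi_int : forall r, phi r = 0 \/ 0 <= v (phi r).
Hypothesis phi_res : forall r, rho (phi r) = kphi (pi r).

Variables (F : fieldType) (iota : {rmorphism {poly E} -> F}).
Hypothesis iota_inj : injective iota.
Hypothesis iota_frac : forall y, exists a b, iota b <> 0 /\ y = iota a / iota b.

Let mv C := mono_value v rho C iota.

Definition const_map : {rmorphism R -> F} :=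
  iota \o polyC \o phi : {rmorphism R -> F}.

Let mv_inj C : cone C -> forall z c c', mv C z c -> mv C z c' -> c = c'.
Proof. by move=> coneC z c c'; apply: mono_value_inj. Qed.

Let mv_const C : cone C -> forall r, mv C (const_map r) (kphi (pi r)).
Proof. by move=> coneC r; rewrite -phi_res; apply: mono_value_const. Qed.

Lemma mono_centre_exists C (x : X (Alg const_map)) : cone C ->
  exists y : X kpt, has_centre (mv C) x y.
Proof.
move=> coneC; have [Ov [i [res [val vi iv]]]] := mono_valuation pl coneC iota_inj iota_frac.
by apply: (has_centre_exists X_proper x val) => //; [apply: mv_inj | apply: mv_const].
Qed.

(* The centre only depends on the values of finitely many fractions, the images
   of the generators of the charts, hence on finitely many exponents. *)
Lemma centres_agree (x : X (Alg const_map)) : exists N H, forall C C', cone C -> cone C' ->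
  cones_agree N H C C' -> forall y y' : X kpt,
  has_centre (mv C) x y -> has_centre (mv C') x y' -> y = y'.
Proof.
case: (X_proper) => sepX [n [U [B [UB cover]]]] _.
suff bound j : exists N H, forall C C', cone C -> cone C' -> cones_agree N H C C' ->
    forall (Ov : algebra R) (i : alg_hom Ov (Alg const_map)) (res : alg_hom Ov kpt)
      (x' : X Ov) y', injective i -> (forall o, mv C (i o) (res o)) -> fmap i x' = x ->
    lies_in (U j) x' -> has_centre (mv C') x y' -> has_centre (mv C) x (fmap res x') ->
    fmap res x' = y'.
  have /choice[N /choice[H NH]] := bound.
  exists (\max_j N j)%N, (\max_j H j)%N => C C' coneC coneC' CC' y y' Cy Cy'.
  case: (Cy) => Ov [i [res [x' [[inj_i _ unit_res] vi _ x'E yE]]]].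
  have [j Uj] := cover kap (kphi \o pi : {rmorphism R -> kap}) (fmap res x').
  rewrite -yE; apply: (NH j C C') inj_i vi x'E _ Cy' _ => //; last by rewrite yE.
    move=> a d aH dN; apply: CC'; apply: le_trans; try eassumption.
      by rewrite lez_nat; apply: (leq_bigmax (F := fun j => H j)).
    by rewrite lez_nat; apply: (leq_bigmax (F := fun j => N j)).
  have U_open : open_sub (U j) by have [[]] := UB j.
  have [S xS] := opens_exists x' U_open; apply/(opens_lies xS).
  move/xS/field_unit_ideal: Uj => [_ [s [Ss ->]]] /unit_res[o' <-].
  by apply: idealMr; [apply: ideal_gen_ideal | apply: ideal_gen_sub].
have [/affine_openP [U_open [u [Uu u_univ]]] [n' [g gP]]] := UB j.
have u_inj (A : algebra R) (f f' : alg_hom (B j) A) : fmap f u = fmap f' u -> f =1 f'.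
  move=> ff' c; have [e [_ e_uniq]] := u_univ _ _ (lies_in_fmap f Uu).
  by rewrite (e_uniq f) // (e_uniq f').
have bounds1 l : exists N H, forall h : alg_hom (B j) (Alg const_map),
    fmap h u = x -> exists p q, [/\ q != 0, h (g l) = iota p / iota q,
      exponents_bounded v N H p q & exponents_bounded v N H q q].
  have [[g0 g0E]|no] := EM (exists g : alg_hom (B j) (Alg const_map), fmap g u = x);
    last by exists 0%N, 0%N => h hE; case: no; exists h.
  have [p [q [q0 fE]]] := iota_frac (g0 (g l)).
  have [N [H bd]] := exponents_bounded_exists v p q.
  have [N' [H' bd']] := exponents_bounded_exists v q q.
  exists (maxn N N'), (maxn H H') => h hE; exists p, q; split.
  - by apply/eqP => q0'; apply: q0; rewrite q0' rmorph0.
  - by rewrite -fE; apply: u_inj; rewrite hE g0E.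
  - by apply: exponents_boundedW bd; rewrite leq_maxl.
  - by apply: exponents_boundedW bd'; rewrite leq_maxr.
have /choice[N /choice[H NH]] := bounds1.
exists (\max_l N l)%N, (\max_l H l)%N => C C' coneC coneC' CC' Ov i res x' y' inj_i vi x'E Uj Cy' Cy.
apply: (centre_compare X_proper (mv_inj coneC) (mv_inj coneC') Cy Cy').
have [h [hu _]] := u_univ _ _ Uj.
pose hF := comp_hom i h.
have hFx : fmap hF u = x by rewrite -fmap_compE hu.
have [Ov' [i' [res' [val' vi' iv']]]] := mono_valuation pl coneC' iota_inj iota_frac.
have [inj_i' _ _] := val'.
(* The subring on which both valuations are integral with the same residue. It contains the image of
   [R] and, by the bounds, the generators of the chart, hence all coordinates of [x]. *)
pose P z := exists o o', [/\ i o = z, i' o' = z & res o = res' o'].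
have [|||S [jS [inj_j jP]]] := @subring_exists F P.
- by exists 1, 1; rewrite !rmorph1.
- move=> z z' [o [o' [<- E1 E2]]] [t [t' [<- E1' E2']]].
  by exists (o - t), (o' - t'); rewrite !rmorphB E1 E1' E2 E2'.
- move=> z z' [o [o' [<- E1 E2]]] [t [t' [<- E1' E2']]].
  by exists (o * t), (o' * t'); rewrite !rmorphM E1 E1' E2 E2'.
have PP z c : mv C z c -> mv C' z c -> (exists o, i o = z) -> P z.
  move=> Cz C'z [o oE]; have [o' o'E] := iv' _ _ C'z.
  have vo := vi o; rewrite oE in vo; have vo' := vi' o'; rewrite o'E in vo'.
  by exists o, o'; split=> //; rewrite (mv_inj coneC vo Cz) (mv_inj coneC' vo' C'z).
have PR r : P (const_map r).
  apply: (@PP _ (kphi (pi r))); [exact: mv_const | exact: mv_const |].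
  by exists (alg_map Ov r); rewrite -[RHS](alg_hom_comm i).
have Ph b : P (hF b).
  apply: (gP (fun b => P (hF b))) b => [r|l|a b|a b].
  - by rewrite alg_hom_comm; apply: PR.
  - have [p [q [q0 E0 b1 b2]]] := NH l hF hFx.
    have vC : mv C (hF (g l)) (res (h (g l))) by apply: vi.
    apply: (PP _ _ vC); last by exists (h (g l)).
    rewrite E0 in vC *.
    have leN : (N l <= \max_l N l)%N by apply: (leq_bigmax (F := fun l => N l)).
    have leH : (H l <= \max_l H l)%N by apply: (leq_bigmax (F := fun l => H l)).
    apply: (mono_value_agree pl iota_inj coneC CC' q0 _ _ vC).
      exact: exponents_boundedW b1.
    exact: exponents_boundedW b2.
  - move=> /jP[s sE] /jP[t tE]; apply/jP; exists (s + t).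
    by rewrite !rmorphD sE tE.
  - move=> /jP[s sE] /jP[t tE]; apply/jP; exists (s * t).
    by rewrite !rmorphM sE tE.
have [s sE] := lift_hom inj_j (fun r => proj1 (jP _) (PR r)).
pose SA : algebra R := Alg s.
pose jA : alg_hom SA (Alg const_map) := @AlgHom R SA (Alg const_map) jS sE.
have [hS hSE] := @lift_alg_hom R (B j) SA (Alg const_map) hF jA inj_j
  (fun b => proj1 (jP _) (Ph b)).
exists SA, jA, (fmap hS u); split.
  by rewrite fmap_compE -hFx; apply: eq_fmap.
move=> t; have [|o [o' [oE o'E rE]]] := proj2 (jP (jS t)); first by exists t.
exists (res o); split.
  by have := vi o; rewrite oE.
by have := vi' o'; rewrite o'E -rE.
Qed.

(* Both valuations specialize the coarser one obtained by inverting the monomial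
   [a t^q] on the wall. *)
Let wall_spec (q : nat) n (x : X (Alg const_map)) y y' : (0 < q)%N ->
  has_centre (mv (wall_cone q%:Z n 1)) x y -> has_centre (mv (wall_cone q%:Z n (-1))) x y' ->
  lies_in V (y : base_change pi X (Alg kphi)) <->
  lies_in V (y' : base_change pi X (Alg kphi)).
Proof.
move=> q0 Cy Cy'; have q0' : 0 < q%:Z by [].
have coneC := @wall_coneP q%:Z n 1 q0' isT; have coneC' := @wall_coneP q%:Z n (-1) q0' isT.
(* With this choice [a t^q] has weight [q (-n) + n q = 0]: it is positive only by the tie-break, so
   inverting it forgets the side of the wall. *)
have [a a0 va] := v_surj (- n).
pose s := iota (a *: 'X^q).
have [Ov [i [res [[inj_i total res_unit] vi iv]]]] := mono_valuation pl coneC iota_inj iota_frac.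
have sO : exists o, i o = s.
  apply: (iv _ 0); rewrite -[s]divr1 -(rmorph1 iota) -(expr0 'X).
  apply: (mono_value_monomial pl coneC) => //.
  by right; rewrite va subr0; split; lia.
case: sO => o_s sE.
have sX m : s ^+ m = iota (a ^+ m *: 'X^(q * m)).
  by rewrite -rmorphXn exprZn -exprM.
pose P z := exists m o, z * s ^+ m = i o.
have PO o : P (i o) by exists 0%N, o; rewrite expr0 mulr1.
have P1 : P 1 by rewrite -(rmorph1 i).
have PB z z' : P z -> P z' -> P (z - z').
  move=> [m [o oE]] [m' [o' o'E]]; exists (m + m')%N, (o * o_s ^+ m' - o' * o_s ^+ m).
  by rewrite rmorphB !rmorphM !rmorphXn sE -oE -o'E exprD; ring.
have PM z z' : P z -> P z' -> P (z * z').
  move=> [m [o oE]] [m' [o' o'E]]; exists (m + m')%N, (o * o').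
  by rewrite rmorphM -oE -o'E exprD; ring.
have Ptotal z : P z \/ exists z', P z' /\ z' * z = 1.
  have [[o <-]|[o oE]] := total z; first by left.
  by right; exists (i o).
have PR r : P (const_map r).
  by have [o <-] := iv _ _ (mv_const coneC r); apply: PO.
have vam m : v (a ^+ m) = - (n * m%:Z).
  elim: m => [|m' IH]; first by rewrite expr0 (place_v1 pl) mulr0 oppr0.
  by rewrite exprS (placeM pl) ?expf_neq0 // IH va; lia.
(* The weight of [phi r / s^m] is [q v(phi r) > 0] whatever [m] is, so its residue is 0 and [phi r]
   remains a non-unit of the coarser ring. *)
have P_pi r : pi r = 0 -> ~ exists z, P z /\ const_map r * z = 1.
  move=> r0 [z [[m [o oE]] E1]].
  have b0 : phi r != 0.
    by apply: contra_eq_neq E1 => b0; rewrite /= b0 !rmorph0 mul0r eq_sym oner_neq0.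
  have vb : 0 < v (phi r).
    have := phi_res r; rewrite r0 rmorph0 => /(place_res0 pl (phi_int r))[/eqP|//].
    by rewrite (negPf b0).
  have c0 : phi r / a ^+ m != 0 by rewrite mulf_neq0 // invr_eq0 expf_neq0.
  have vs : mv (wall_cone q%:Z n 1)
      (iota (phi r / a ^+ m *: 'X^0) / iota 'X^(q * m)) 0.
    apply: (mono_value_monomial pl coneC) => //.
    by left; rewrite (place_div pl) ?expf_neq0 // vam; nia.
  have [t tE] := iv _ _ vs.
  have : res (o * t) = 0.
    rewrite rmorphM; apply/eqP; rewrite mulf_eq0; apply/orP; right; apply/eqP.
    by have := vi t; rewrite tE => /(mv_inj coneC); apply.
  have -> : o * t = 1.
    apply: inj_i; rewrite rmorphM rmorph1 -oE tE sX -!mul_polyC expr0 mulr1 !rmorphM -E1.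
    have am0 : iota (a ^+ m)%:P != 0.
      rewrite -(rmorph0 iota) (inj_eq iota_inj) polyC_eq0 expf_neq0 //.
    have X0 : iota 'X^(q * m) != 0.
      by rewrite -(rmorph0 iota) (inj_eq iota_inj) monic_neq0 ?monicXn.
    have E2 : iota (phi r / a ^+ m)%:P * iota (a ^+ m)%:P = const_map r.
      by rewrite -rmorphM -polyCM divfK ?expf_neq0.
    by rewrite -E2; field; apply/andP.
  by rewrite rmorph1 => /eqP; rewrite oner_eq0.
have PC z c : mv (wall_cone q%:Z n 1) z c -> P z.
  by move=> /iv[o <-]; apply: PO.
have PC' z c : mv (wall_cone q%:Z n (-1)) z c -> P z.
  have [p [f [f0 ->]]] := iota_frac z.
  have f0' : f != 0 by apply/eqP => f0'; apply: f0; rewrite f0' rmorph0.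
  case/(mono_value_rep pl coneC' iota_inj) => // j [[fj jf] jp _].
  have [j' [fj' j'f]] := leading_exists v coneC f0'.
  have wall_ge e b d : weak_cone (wall_cone q%:Z n e) b d -> 0 <= q%:Z * b + n * d.
    by case=> [[/ltW//|[->]//]|[-> ->]]; rewrite !mulr0.
  (* Multiplication by [s^m] preserves the weight and raises all degrees by [q m > j'], so the
     tie-break of the other side is satisfied. *)
  pose m := j'.+1; exists m.
  have [|o oE] := iv (iota (p * (a ^+ m *: 'X^(q * m))) / iota f)
    (rho ((p * (a ^+ m *: 'X^(q * m)))`_j' / f`_j')).
  - apply: mono_value_of => // l; rewrite -scalerAr coefZ coefMXn.
    case: ltnP => lq; first by left; rewrite mulr0.
    have [->|pl0] := eqVneq p`_(l - q * m) 0; first by left; rewrite mulr0.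
    right; left; rewrite (placeM pl) ?expf_neq0 // vam.
    case: (jp (l - q * m)%N) => [/eqP|/wall_ge g1]; first by rewrite (negPf pl0).
    case: (jf j') => [/eqP|/wall_ge g2]; first by rewrite (negPf fj').
    case: (j'f j) => [/eqP|/wall_ge g3]; first by rewrite (negPf fj).
    have lE : (l - q * m)%N%:Z = l%:Z - q%:Z * m%:Z by lia.
    rewrite lE in g1.
    have g4 : 0 <= q%:Z * (- (n * m%:Z) + v p`_(l - q * m) - v f`_j') + n * (l%:Z - j'%:Z).
      by nia.
    case: (ltrgtP 0 (q%:Z * (- (n * m%:Z) + v p`_(l - q * m) - v f`_j') + n * (l%:Z - j'%:Z))) g4 => // [g5 _|/esym g5 _]; first by left.
    right; split=> //; rewrite mul1r subr_gt0 ltz_nat.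
    by apply: leq_trans lq; apply: leq_pmull.
  - by exists o; rewrite oE sX rmorphM; field; apply/eqP.
have := @centre_specialize R k kap pi kphi X X_proper pi_surj V W V_closed W_closed VW
  F const_map P x P1 PB PM Ptotal PR P_pi.
case=> H; have Hy := H _ _ Cy PC; have Hy' := H _ _ Cy' PC'; split=> // Vy.
  by case: (T_empty Vy Hy).
by case: (T_empty Vy Hy').
Qed.

(* The curve [x] over [E(t)] specializes to [P] at [t = 0] for [e = 1], and at
   [t = oo] for [e = -1]. *)
Definition has_value (e : int) (x : X (Alg const_map)) (P : X (Alg phi)) : Prop :=
  exists (A0 : algebra R) (i : alg_hom A0 (Alg const_map)) (ev : alg_hom A0 (Alg phi))
    (x0 : X A0),
  [/\ injective i,
      forall z c, mono_value (fun _ : E => 0) id (end_cone e) iota z c ->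
        exists o, i o = z /\ ev o = c,
      fmap i x0 = x & fmap ev x0 = P].

Definition place_value (z : E) (c : kap) : Prop := (z = 0 \/ 0 <= v z) /\ c = rho z.

(** The valuation of [end_cone e] is composed of the one at the end, with residue field E, and of
    [v]. Its ring lies in [A0] and its residue is [ev] followed by [rho], so [x] and its value [P]
    have the same centre. *)
Let end_centre (e : int) (x : X (Alg const_map)) (P : X (Alg phi)) (y y' : X kpt) : e != 0 -> has_value e x P ->
  has_centre (mv (end_cone e)) x y -> has_centre place_value P y' -> y = y'.
Proof.
move=> e0 [A0 [i0 [ev [x0 [inj_i0 iv0 x0E <-]]]]]
  [Ov [i [res [x1 [[inj_i _ _] vi iv x1E <-]]]]]
  [OE [iE [resE [x2 [[inj_iE _ _] viE ivE x2E <-]]]]].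
have coneE := end_coneP e0; have sepX : separated X by case: X_proper.
have val o : exists a, [/\ mono_value (fun _ : E => 0) id (end_cone e) iota (i o) a,
    (a = 0 \/ 0 <= v a) & res o = rho a].
  have := vi o; have [p [q [q0 ->]]] := iota_frac (i o).
  have {}q0 : q != 0 by apply/eqP => q0'; apply: q0; rewrite q0' rmorph0.
  case/(mono_value_rep pl coneE iota_inj) => // j [[qj jq] jp ->].
  have weak x' d : weak_cone (end_cone e) x' d -> weak_cone (end_cone e) 0 d.
    by case=> [[d0|[-> _]]|[_ ->]]; [left; left | right | right].
  exists (p`_j / q`_j); split=> //.
    apply: (mono_value_of (trivial_place E)) => // [|l].
      split=> // l; case: (jq l) => [->|/weak H]; [by left | by right; rewrite subrr].
    by case: (jp l) => [->|/weak H]; [left | right; rewrite subrr].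
  case: (jp j) => [->|]; first by left; rewrite mul0r.
  rewrite subrr => /(weak_cone_nneg coneE) H.
  have [->|pj] := eqVneq p`_j 0; first by left; rewrite mul0r.
  by right; rewrite (place_div pl).
have [f fE] : exists f : alg_hom Ov A0, forall o, i0 (f o) = i o.
  by apply: lift_alg_hom => // o; have [a [/iv0[o0 [H _]] _ _]] := val o; exists o0.
have evf o : (ev (f o) = 0 \/ 0 <= v (ev (f o))) /\ res o = rho (ev (f o)).
  have [a [/iv0[o0 [io0 evo0]] Oa ra]] := val o.
  by rewrite -fE in io0; rewrite -(inj_i0 _ _ io0) evo0.
have [h hE] : exists h : alg_hom Ov OE, forall o, iE (h o) = comp_hom ev f o.
  apply: lift_alg_hom => // o; have [H1 H2] := evf o.
  by apply: (ivE _ (rho (ev (f o)))).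
have fx : fmap f x1 = x0.
  by apply: (separated_inj (f := i0)) => //; rewrite fmap_compE x0E -x1E; apply: eq_fmap.
have <- : fmap h x1 = x2.
  apply: (separated_inj (f := iE)) => //; rewrite fmap_compE x2E -fx fmap_compE.
  exact: eq_fmap.
rewrite fmap_compE; apply: eq_fmap => o /=; have [_ ->] := evf o.
by have [_ ->] := viE (h o); rewrite hE.
Qed.

Lemma linked_centres x P Q (y z : X kpt) :
  has_value 1 x P -> has_value (-1) x Q ->
  has_centre place_value P y -> has_centre place_value Q z ->
  lies_in V (y : base_change pi X (Alg kphi)) <->
  lies_in V (z : base_change pi X (Alg kphi)).
Proof.
move=> xP xQ Py Qz; have [N [H agree]] := centres_agree x.
(* Exponents of degree at most [N] change sign only at slopes with denominator dividing [N!], so all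
   relevant walls are at integral [n]. *)
pose q := N`!; have q0 : (0 < q)%N by apply: fact_gt0.
have q0' : 0 < q%:Z by [].
have qN (d : nat) : (0 < d <= N)%N -> (d%:Z %| q%:Z)%Z.
  by move=> /dvdn_fact; rewrite dvdzE.
have plus n : exists y : X kpt, has_centre (mv (wall_cone q%:Z n 1)) x y.
  by apply: mono_centre_exists; apply: wall_coneP.
have minus n : exists y : X kpt, has_centre (mv (wall_cone q%:Z n (-1))) x y.
  by apply: mono_centre_exists; apply: wall_coneP.
have /choice[yp ypP] := plus; have /choice[ym ymP] := minus.
have [y0 y0P] := mono_centre_exists x (end_coneP (e := 1) isT).
have [y1 y1P] := mono_centre_exists x (end_coneP (e := -1) isT).
have e1 : (1 : int) != 0 by []; have e1' : (-1 : int) != 0 by [].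
have <- := end_centre e1 xP y0P Py; have <- := end_centre e1' xQ y1P Qz.
(* At slopes beyond [H] in absolute value the bounded exponents are ordered as at infinity. *)
pose n0 := (q * H).+1.
rewrite (agree _ _ _ _ (@end_agree_pos N H q%:Z n0 q0' _) _ _ y0P (ypP _)); first last.
- by rewrite /n0; lia.
- exact: wall_coneP.
- exact: end_coneP.
rewrite (agree _ _ _ _ (@end_agree_neg N H q%:Z n0 q0' _) _ _ y1P (ymP _)); first last.
- by rewrite /n0; lia.
- exact: wall_coneP.
- exact: end_coneP.
(* The centre does not change between the plus side of wall [n] and the minus side of wall [n + 1],
   and crossing a wall keeps the component; the chain runs from [- n0] to [n0]. *)
suff chain (m : nat) : lies_in V (yp (- n0%:Z + m%:Z) : base_change pi X (Alg kphi)) <->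
    lies_in V (ym (- n0%:Z) : base_change pi X (Alg kphi)).
  by rewrite -(chain (n0 + n0)%N) PoszD addKr.
elim: m => [|m IH]; first by rewrite addr0; apply: (wall_spec q0 (ypP _) (ymP _)).
rewrite -IH -addn1 PoszD addrA.
rewrite (agree _ _ _ _ (@wall_agree N H q%:Z _ qN) _ _ (ypP (- n0%:Z + m%:Z)) (ymP _)).
- exact: (wall_spec q0 (ypP _) (ymP _)).
- exact: wall_coneP.
- exact: wall_coneP.
Qed.

End Tropical.

(** * Lines in projective space *)

Definition spans (A : comPzRingType) n (M : 'rV[A]_n -> Prop) (w : 'rV[A]_n) : Prop :=
  forall v, M v <-> exists c, v = c *: w.

Lemma spans_line (A : comPzRingType) n (w : 'rV[A]_n) (c : 'cV[A]_n) :
  w *m c = 1%:M -> is_line (fun v => exists a, v = a *: w).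
Proof.
move=> wc; exists (c *m w); split.
- by rewrite mulmxA -(mulmxA c) wc mulmx1.
- move=> v; split=> [[a ->]|[u ->]].
    by exists (a *: w); rewrite -scalemxAl mulmxA wc mul1mx.
  by exists ((u *m c) 0 0); rewrite mulmxA {1}[u *m c]mx11_scalar mul_scalar_mx.
- move=> F phi; apply/eqP; rewrite eqn_leq; apply/andP; split.
    by rewrite map_mxM (leq_trans (mxrankM_maxl _ _)) // rank_leq_col.
  rewrite lt0n mxrank_eq0; apply/eqP => cw0.
  have : map_mx phi (w *m (c *m w) *m c) = 0 by rewrite 2!map_mxM cw0 mulmx0 mul0mx.
  rewrite mulmxA wc mul1mx wc map_scalar_mx rmorph1 => /matrixP /(_ 0 0) /eqP.
  by rewrite !mxE eqxx oner_eq0.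
Qed.

Lemma line_spanned (E : fieldType) n (M : 'rV[E]_n -> Prop) :
  is_line M -> exists2 w, w != 0 & spans M w.
Proof.
case=> e [_ Me re]; have := re E (idfun : {rmorphism E -> E}).
have -> : map_mx (idfun : {rmorphism E -> E}) e = e by apply/matrixP => i j; rewrite mxE.
move=> {}re; have [i ei] : exists i, row i e != 0.
  apply: contrapT => no; move/eqP: re; suff -> : e = 0 by rewrite mxrank0.
  apply/row_matrixP => i; rewrite row0; apply/eqP; apply: contrapT => /negP ei.
  by apply: no; exists i.
have sub_e : (row i e <= e)%MS by apply: row_sub.
have e_sub : (e <= row i e)%MS.
  by rewrite -(mxrank_leqif_sup sub_e) re rank_rV ei.
exists (row i e) => // v; rewrite Me; split=> [[u ->]|[c ->]].
  by apply/sub_rVP; apply: submx_trans e_sub; apply: submxMl.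
by apply/submxP; apply: submx_trans sub_e; apply: scalemx_sub.
Qed.

Lemma spans_push (A B : comPzRingType) (f : {rmorphism A -> B}) n
    (M : 'rV[A]_n -> Prop) (w : 'rV[A]_n) :
  spans M w -> spans (push_space f M) (map_mx f w).
Proof.
move=> Mw v; split=> [[m [c [u [Mu ->]]]]|[c ->]].
  have /choice[d dE] := fun i => proj1 (Mw (u i)) (Mu i).
  exists (\sum_i c i * f (d i)); rewrite scaler_suml; apply: eq_bigr => i _.
  by rewrite dE map_mxZ scalerA.
exists 1%N, (fun=> c), (fun=> w); split; last by rewrite big_ord1.
by move=> _; apply/Mw; exists 1; rewrite scale1r.
Qed.

(** As [(w + t w') c = 1] for every [t], such a [c] certifies through [spans_line] that the moving
    vector spans a line over the whole valuation ring. *)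
Lemma separating_functional (E : fieldType) n (w w' : 'rV[E]_n) : w' != 0 ->
  (forall c, w <> c *: w') -> exists c : 'cV[E]_n, w *m c = 1%:M /\ w' *m c = 0.
Proof.
move=> w'0 ww'; have [j w'j] : exists j, w' 0 j != 0 by apply/rV0Pn.
pose u := w - (w 0 j / w' 0 j) *: w'.
have [l ul] : exists l, u 0 l != 0.
  by apply/rV0Pn; apply/eqP => /subr0_eq /ww'.
have mulE (z : 'rV[E]_n) (a b : E) :
    z *m (a *: delta_mx l 0 - b *: delta_mx j 0) = (a * z 0 l - b * z 0 j)%:M.
  apply/matrixP => i i'; rewrite !ord1 mulmxBr -!scalemxAr -!colE !mxE eqxx mulr1n.
  by [].
exists ((u 0 l)^-1 *: delta_mx l 0 - ((u 0 l)^-1 * (w' 0 l / w' 0 j)) *: delta_mx j 0).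
rewrite !mulE; split; last first.
  rewrite (_ : _ - _ = 0) ?raddf0 //; last by field; rewrite w'j ul.
congr _%:M; rewrite -mulrA -mulrBr (_ : w 0 l - _ = u 0 l) ?mulVf //.
by rewrite /u !mxE; ring.
Qed.

Section Line.
Variables (R : comPzRingType) (X : functor R) (K0 E : fieldType) (n : nat).
Variables (tau : {rmorphism R -> K0}) (phi0 : {rmorphism K0 -> E}).
Variables (U : subfunctor (projective_space K0 n)) (h : morphism (sub U) (base_change tau X)).
Hypothesis U_open : open_sub U.
Variables (F : fieldType) (iota : {rmorphism {poly E} -> F}).
Hypothesis iota_inj : injective iota.
Hypothesis iota_frac : forall y, exists a b, iota b <> 0 /\ y = iota a / iota b.

Let EK : algebra K0 := Alg phi0.
Let FK : algebra K0 := Alg (iota \o polyC \o phi0 : {rmorphism K0 -> F}).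
Let phi : {rmorphism R -> E} := phi0 \o tau.

Let fromFK : alg_hom (restrict tau FK) (Alg (const_map phi iota)) :=
  @AlgHom R (restrict tau FK) (Alg (const_map phi iota))
    (idfun : {rmorphism F -> F}) (fun r => erefl).

(* The line joining two points, parametrized near the end of [P^1] where the
   parameter [u] vanishes: there [w + u w'] spans the point [a]. *)
Let line_end (e : int) (a : sub U EK) (w w' : 'rV[E]_n.+1) (u : F) :
  e != 0 -> mono_value (fun _ : E => 0) id (end_cone e) iota u 0 ->
  spans (sval (sval a)) w -> w' != 0 -> (forall c, w <> c *: w') ->
  exists p : sub U FK,
    spans (sval (sval p)) (map_mx (iota \o polyC) w + u *: map_mx (iota \o polyC) w') /\
    has_value e (fmap fromFK (h FK p)) (h EK a).
Proof.
move=> e0 u_val aw w'0 ww'; have [c [wc w'c]] := separating_functional w'0 ww'.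
have coneE := end_coneP e0; have plE := trivial_place E.
have [A0 [i [ev [[inj_i total ev_unit] vi iv]]]] := mono_valuation plE coneE iota_inj iota_frac.
have v_inj z d d' : mono_value (fun _ : E => 0) id (end_cone e) iota z d ->
    mono_value (fun _ : E => 0) id (end_cone e) iota z d' -> d = d'.
  exact: mono_value_inj.
have const_val d : mono_value (fun _ : E => 0) id (end_cone e) iota (iota d%:P) d.
  by apply: mono_value_const => //; right.
have [s sE] : exists s : {rmorphism E -> A0}, forall d, i (s d) = (iota \o polyC) d.
  by apply: lift_hom => // d; apply: (iv _ d); apply: const_val.
have evs d : ev (s d) = d.
  by apply: (v_inj (iota d%:P)) => //; have := vi (s d); rewrite sE.
have [t tE] := iv _ _ u_val; have evt : ev t = 0.
  by apply: (v_inj u) => //; rewrite -tE; apply: vi.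
pose AK : algebra K0 := Alg (s \o phi0 : {rmorphism K0 -> A0}).
pose iK : alg_hom AK FK := @AlgHom K0 AK FK i (fun r => sE _).
pose evK : alg_hom AK EK := @AlgHom K0 AK EK ev (fun r => evs _).
pose z : 'rV[A0]_n.+1 := map_mx s w + t *: map_mx s w'.
have zc : z *m map_mx s c = 1%:M.
  by rewrite mulmxDl -scalemxAl -!map_mxM wc w'c raddf0 scaler0 addr0 map_scalar_mx rmorph1.
pose p0 : projective_space K0 n AK := exist _ _ (spans_line zc).
have p0z : spans (sval p0) z by [].
have evz : map_mx ev z = w.
  by apply/matrixP => j l; rewrite !mxE rmorphD rmorphM !evs evt mul0r addr0.
have ev_p0 : fmap evK p0 = sval a.
  apply: line_eq => v; rewrite aw; have := spans_push ev p0z v.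
  by rewrite evz.
(* [A0] is local, so an open set that contains the reduction of [p0] contains [p0]. *)
have Up0 : lies_in U p0.
  have [S p0S] := opens_exists p0 U_open; apply/(opens_lies p0S).
  have : lies_in U (fmap evK p0) by rewrite ev_p0; apply: svalP.
  move/p0S/field_unit_ideal => [_ [b [Sb ->]]] /ev_unit[b' <-].
  by apply: idealMr; [apply: ideal_gen_ideal | apply: ideal_gen_sub].
pose p1 : sub U AK := exist _ p0 Up0.
exists (fmap iK p1); split.
  have -> : map_mx (iota \o polyC) w + u *: map_mx (iota \o polyC) w' = map_mx i z.
    by apply/matrixP => j l; rewrite !mxE rmorphD rmorphM !sE tE.
  exact: (spans_push i p0z).
pose iR : alg_hom (restrict tau AK) (Alg (const_map phi iota)) :=
  comp_hom fromFK (restrict_hom tau iK).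
exists (restrict tau AK), iR, (restrict_hom tau evK), (h AK p1); split=> //.
- move=> y d yd; have [o oE] := iv _ _ yd; exists o; split=> //.
  by apply: (v_inj y) => //; rewrite -oE; apply: vi.
- by rewrite app_nat /= fmap_compE.
- have -> : a = fmap evK p1.
    apply: eq_sig_hprop => /=; first by move=> *; apply: proof_irrelevance.
    by rewrite -ev_p0.
  by rewrite app_nat.
Qed.

(** The vectors [w + t w'] and [w' + t^-1 w] span the same line over E(t), so a single curve has
    both values at its ends. *)
Lemma line_values (a b : sub U EK) : a = b \/
  exists x : X (Alg (const_map phi iota)),
    has_value 1 x (h EK a) /\ has_value (-1) x (h EK b).
Proof.
have [w w0 aw] := line_spanned (svalP (sval a)).
have [w' w'0 bw'] := line_spanned (svalP (sval b)).
have [[c wc]|no] := EM (exists c, w = c *: w').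
  left; apply: eq_sig_hprop => /=; first by move=> *; apply: proof_irrelevance.
  have c0 : c != 0 by apply: contra_neq w0 => c0; rewrite wc c0 scale0r.
  apply: line_eq => v; rewrite aw bw' wc; split=> [[d ->]|[d ->]].
    by exists (d * c); rewrite scalerA.
  by exists (d / c); rewrite scalerA divfK.
right; have ww' c : w <> c *: w' by move=> wc; apply: no; exists c.
have w'w c : w' <> c *: w.
  move=> w'c; have c0 : c != 0 by apply: contra_neq w'0 => c0; rewrite w'c c0 scale0r.
  by apply: no; exists c^-1; rewrite w'c scalerA mulVf // scale1r.
have e1 : (1 : int) != 0 by []; have e1' : (-1 : int) != 0 by [].
have plE := trivial_place E.
have X0 : iota 'X != 0 by rewrite -(rmorph0 iota) (inj_eq iota_inj) polyX_eq0.
have val1 : mono_value (fun _ : E => 0) id (end_cone 1) iota (iota 'X) 0.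
  have -> : iota 'X = iota (1 *: 'X^1) / iota 'X^0.
    by rewrite scale1r expr1 expr0 rmorph1 divr1.
  by apply: (mono_value_monomial plE (end_coneP e1)); [apply: oner_neq0 | left].
have val2 : mono_value (fun _ : E => 0) id (end_cone (-1)) iota (iota 'X)^-1 0.
  have -> : (iota 'X)^-1 = iota (1 *: 'X^0) / iota 'X^1.
    by rewrite scale1r expr1 expr0 rmorph1 div1r.
  by apply: (mono_value_monomial plE (end_coneP e1')); [apply: oner_neq0 | left].
have [p [pE px]] := line_end e1 val1 aw w'0 ww'.
have [p' [p'E p'x]] := line_end e1' val2 bw' w0 w'w.
exists (fmap fromFK (h FK p)); split=> //.
suff -> : p = p' by [].
apply: eq_sig_hprop => /=; first by move=> *; apply: proof_irrelevance.
apply: line_eq => v; rewrite pE p'E.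
have E1 : map_mx (iota \o polyC) w + iota 'X *: map_mx (iota \o polyC) w' =
    iota 'X *: (map_mx (iota \o polyC) w' + (iota 'X)^-1 *: map_mx (iota \o polyC) w).
  by rewrite scalerDr scalerA mulfV // scale1r addrC.
rewrite E1; split=> [[d ->]|[d ->]].
  by exists (d * iota 'X); rewrite scalerA.
by exists (d / iota 'X); rewrite scalerA divfK.
Qed.

End Line.

(** * Irreducibility *)

Lemma pair_hom (R A B : comPzRingType) (f : {rmorphism R -> A}) (g : {rmorphism R -> B}) :
  {h : {rmorphism R -> (A * B)%type} | forall r, h r = (f r, g r)}.
Proof.
apply: (@rmorphism_of R (A * B)%type (fun r => (f r, g r))); split=> [x y|x y|].
- by rewrite !rmorphD.
- by rewrite !rmorphM.
- by rewrite !rmorph1.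
Qed.

Definition prod_alg (R : comPzRingType) (A B : algebra R) : algebra R :=
  Alg (sval (pair_hom (alg_map A) (alg_map B))).

Lemma pair_alg_hom (R : comPzRingType) (C A B : algebra R) (f : alg_hom C A) (g : alg_hom C B) :
  exists h : alg_hom C (prod_alg A B), forall c, h c = (f c, g c).
Proof.
have [h hE] := pair_hom f g.
suff hC r : h (alg_map C r) = alg_map (prod_alg A B) r.
  by exists (@AlgHom R C (prod_alg A B) h hC).
by rewrite hE /prod_alg /=; case: pair_hom => ? /= ->; rewrite !alg_hom_comm.
Qed.

Lemma prod_projections (R : comPzRingType) (A B : algebra R) :
  exists (p : alg_hom (prod_alg A B) A) (q : alg_hom (prod_alg A B) B),
    forall c, c = (p c, q c).
Proof.
have pC r : (fst : {rmorphism (A * B)%type -> A}) (alg_map (prod_alg A B) r) = alg_map A r.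
  by rewrite /prod_alg /=; case: pair_hom => ? /= ->.
have qC r : (snd : {rmorphism (A * B)%type -> B}) (alg_map (prod_alg A B) r) = alg_map B r.
  by rewrite /prod_alg /=; case: pair_hom => ? /= ->.
exists (@AlgHom R (prod_alg A B) A (fst : {rmorphism (A * B)%type -> A}) pC).
by exists (@AlgHom R (prod_alg A B) B (snd : {rmorphism (A * B)%type -> B}) qC); case.
Qed.

Record idempotent_split (R : comPzRingType) (A A1 A2 : algebra R) (e : A)
    (q1 : alg_hom A A1) (q2 : alg_hom A A2) : Prop := IdempotentSplit {
  split_idem : e * e = e;
  split_surj1 : forall b, exists a, b = q1 a;
  split_surj2 : forall b, exists a, b = q2 a;
  split_ker1 : forall a, q1 a = 0 <-> e * a = 0;
  split_ker2 : forall a, q2 a = 0 <-> (1 - e) * a = 0 }.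

Lemma idempotent_split_exists (R : comPzRingType) (A : algebra R) (e : A) : e * e = e ->
  exists (A1 A2 : algebra R) (q1 : alg_hom A A1) (q2 : alg_hom A A2),
    idempotent_split e q1 q2.
Proof.
move=> ee; have [A1 [q1 [s1 k1 _]]] := @alg_quotient R A _ (@annihilator_ideal A e).
have [A2 [q2 [s2 k2 _]]] := @alg_quotient R A _ (@annihilator_ideal A (1 - e)).
by exists A1, A2, q1, q2; split=> // a; rewrite mulrC.
Qed.

Section Split.
Variables (R : comPzRingType) (A A1 A2 : algebra R) (e : A).
Variables (q1 : alg_hom A A1) (q2 : alg_hom A A2).
Hypothesis sp : idempotent_split e q1 q2.

Let ee : e * (1 - e) = 0.
Proof. by rewrite mulrBr mulr1 (split_idem sp) subrr. Qed.

Lemma split_q1 : q1 e = 1.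
Proof.
apply/eqP; rewrite eq_sym -subr_eq0 -(rmorph1 q1) -rmorphB; apply/eqP.
by apply/(split_ker1 sp).
Qed.

Lemma split_q2 : q2 e = 0.
Proof. by apply/(split_ker2 sp); rewrite mulrC. Qed.

Lemma split_inj a a' : q1 a = q1 a' -> q2 a = q2 a' -> a = a'.
Proof.
move=> /eqP; rewrite -subr_eq0 -rmorphB => /eqP /(split_ker1 sp) E1.
move=> /eqP; rewrite -subr_eq0 -rmorphB => /eqP /(split_ker2 sp) E2.
by apply/eqP; rewrite -subr_eq0 -[a - a']mul1r -(subrK e 1) mulrDl E1 E2 addr0.
Qed.

Lemma split_pair b1 b2 : exists a, q1 a = b1 /\ q2 a = b2.
Proof.
have [a1 ->] := split_surj1 sp b1; have [a2 ->] := split_surj2 sp b2.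
exists (e * a1 + (1 - e) * a2); rewrite !rmorphD !rmorphM !rmorphB !rmorph1 split_q1 split_q2.
by rewrite subrr subr0 !mul0r !mul1r addr0 add0r.
Qed.

Lemma split_sheaf (X : functor R) : zariski_sheaf X ->
  forall p1 p2, exists! p : X A, fmap q1 p = p1 /\ fmap q2 p = p2.
Proof.
move=> sheafX p1 p2.
pose L (b : bool) := if b then A1 else A2.
pose l b : alg_hom A (L b) := if b return alg_hom A (L b) then q1 else q2.
pose s (b : bool) := if b then e else 1 - e.
pose p b : X (L b) := if b return X (L b) then p1 else p2.
pose bit (i : 'I_2) := i == ord0.
have [|||q [qE q_uniq]] := sheafX A 2%N (fun i => s (bit i)) _
    (fun i => L (bit i)) (fun i => l (bit i)) _ (fun i => p (bit i)) _.
- exists 2%N, (fun i => s (bit i)), (fun=> 1); split; first by move=> i; exists i.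
  by rewrite big_ord_recr big_ord1 /= !mul1r addrC subrK.
- have idem b : s b * s b = s b.
    by case: b; rewrite /= ?(split_idem sp) // mulrBr mulr1 (mulrC _ e) ee subr0.
  move=> i; case: (bit i) => /=; split.
  + by exists 1; rewrite mulr1 split_q1.
  + by move=> b; have [a ->] := split_surj1 sp b; exists a, 0%N; rewrite mulr1.
  + by move=> a /(split_ker1 sp) ea; exists 1%N; rewrite expr1.
  + by exists 1; rewrite mulr1 rmorphB rmorph1 split_q2 subr0.
  + by move=> b; have [a ->] := split_surj2 sp b; exists a, 0%N; rewrite mulr1.
  + by move=> a /(split_ker2 sp) ea; exists 1%N; rewrite expr1.
(* Over the zero ring the empty family is a covering, so a sheaf has at most one section there; this
   handles the empty overlap of D(e) and D(1 - e). *)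
- have zero (C : algebra R) (x y : X C) : (1 : C) = 0 -> x = y.
    move=> C10; have [|||q [_ q_uniq]] := sheafX C 0%N (fun=> 0) _
      (fun=> C) (fun=> id_hom C) _ (fun=> x) _; try by case.
      by exists 0%N, (fun=> 0), (fun=> 0); split; [case | rewrite big_ord0 C10].
    by rewrite -(q_uniq x) ?(q_uniq y) //; case.
  move=> i j C; case: (bit i); case: (bit j) => /= g g' gg'.
  + by apply: eq_fmap => b; have [a ->] := split_surj1 sp b.
  + by apply: zero; have := gg' e; rewrite split_q1 split_q2 rmorph1 rmorph0.
  + by apply: zero; have := gg' e; rewrite split_q1 split_q2 rmorph1 rmorph0.
  + by apply: eq_fmap => b; have [a ->] := split_surj2 sp b.
exists q; split.
  by split; [have := qE ord0 | have := qE ord_max].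
by move=> q' [q1E q2E]; apply: q_uniq => i; rewrite /p /l; case: (bit i).
Qed.

End Split.

Section Disjoint.
Variables (R : comPzRingType) (X : functor R).
Hypothesis X_sheaf : zariski_sheaf X.
Variables (U U' : subfunctor X) (B B' : algebra R).
Hypotheses (UB : affine_open U B) (UB' : affine_open U' B').
Hypothesis disjoint : forall (F : fieldType) (phi : {rmorphism R -> F}) (p : X (Alg phi)),
  lies_in U p -> lies_in U' p -> False.

(* [e] is the idempotent that cuts out the part of Spec A lying over [U]. *)
Definition disjoint_union : subfunctor X.
Proof.
refine (@Subfunctor R X (fun A p => exists e : A, [/\ e * e = e,
  forall (C : algebra R) (f : alg_hom A C), f e = 1 -> lies_in U (fmap f p)
  & forall (C : algebra R) (f : alg_hom A C), f e = 0 -> lies_in U' (fmap f p)]) _).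
move=> A C f p [e [ee eU eU']]; exists (f e); split.
- by rewrite -rmorphM ee.
- by move=> D g ge; rewrite fmap_compE; apply: eU.
- by move=> D g ge; rewrite fmap_compE; apply: eU'.
Defined.

Let disjoint_zero (A : algebra R) (p : X A) : lies_in U p -> lies_in U' p -> (1 : A) = 0.
Proof.
move=> Up Up'; apply: contrapT => A1.
have [F [f _]] := maximal_residue_field (zero_ideal A) A1.
exact: (disjoint (lies_in_fmap (push_hom f) Up) (lies_in_fmap (push_hom f) Up')).
Qed.

(** The preimages of [U] and [U'] in an affine scheme have ideals with nilpotent products. Where
    these ideals are coprime an idempotent separates them, and a point of the union is a pair of
    points of the charts, glued by the sheaf property. *)
Lemma disjoint_union_affine : affine_open disjoint_union (prod_alg B B').
Proof.
have [U_open [u [Uu u_univ]]] := proj1 (affine_openP U B) UB.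
have [U'_open [u' [Uu' u'_univ]]] := proj1 (affine_openP U' B') UB'.
apply/affine_openP; split.
  move=> A p; have [S pS] := opens_exists p U_open; have [S' pS'] := opens_exists p U'_open.
  exists (fun a => S a \/ S' a) => C f; rewrite unit_idealP; split.
    move=> [e [ee eU eU']]; apply: contrapT => no.
    have [F [g gE]] := maximal_residue_field (ideal_gen_ideal _) no.
    have g0 a : S a \/ S' a -> g (f a) = 0.
      by move=> Sa; apply: gE; apply: ideal_gen_sub; exists a.
    have : g e = 1 \/ g e = 0.
      have : g e * (1 - g e) = 0 by rewrite mulrBr mulr1 -rmorphM ee subrr.
      by move/eqP; rewrite mulf_eq0 subr_eq0 => /orP[/eqP->|/eqP<-]; [right | left].
    case=> ge; [have := eU _ (push_hom g) ge | have := eU' _ (push_hom g) ge];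
      rewrite fmap_compE; [move/pS | move/pS'] => /field_unit_ideal[_ [a [Sa ->]]] /=.
    + by rewrite g0 //; left.
    + by rewrite g0 //; right.
  move=> unitS.
  pose I := ideal_gen (image_set f S); pose I' := ideal_gen (image_set f S').
  have idI : is_ideal I by apply: ideal_gen_ideal.
  have idI' : is_ideal I' by apply: ideal_gen_ideal.
  have [x [Ix Ix']] : exists x, I x /\ I' (1 - x).
    apply: (ideal_gen_min (I := fun y => exists x, I x /\ I' (y - x)) unitS).
      split; first by exists 0; rewrite subr0; split; apply: ideal0.
        move=> y z [a [Ia Ia']] [b [Ib Ib']]; exists (a + b); split; first exact: idealD.
        by rewrite opprD addrACA; apply: idealD.
      move=> c y [a [Ia Ia']]; exists (c * a); split; first exact: idealMl.
      by rewrite -mulrBr; apply: idealMl.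
    move=> t [a [[Sa|Sa] ->]].
      by exists (f a); split; [apply: ideal_gen_sub; exists a | rewrite subrr; apply: ideal0].
    by exists 0; split; [apply: ideal0 | rewrite subr0; apply: ideal_gen_sub; exists a].
  have prod_nil y y' : I y -> I' y' -> exists n, (y * y') ^+ n = 0.
    move=> Iy Iy'; have [L [l [[w lw] _ l0 _]]] := alg_localization (y * y').
    have lI z : I z -> ideal_gen (image_set (comp_hom l f) S) (l z).
      move=> Iz; apply: (ideal_gen_min (I := fun z => ideal_gen _ (l z)) Iz).
        by apply: ideal_preim; apply: ideal_gen_ideal.
      by move=> _ [a [Sa ->]]; apply: ideal_gen_sub; exists a.
    have lI' z : I' z -> ideal_gen (image_set (comp_hom l f) S') (l z).
      move=> Iz; apply: (ideal_gen_min (I := fun z => ideal_gen _ (l z)) Iz).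
        by apply: ideal_preim; apply: ideal_gen_ideal.
      by move=> _ [a [Sa ->]]; apply: ideal_gen_sub; exists a.
    have E1 : l y * (l y' * w) = 1 by rewrite mulrA -rmorphM.
    have E2 : l y' * (l y * w) = 1 by rewrite mulrA -rmorphM (mulrC y').
    have UL : lies_in U (fmap (comp_hom l f) p).
      by apply/pS; rewrite -E1; apply: idealMr; [apply: ideal_gen_ideal | apply: lI].
    have UL' : lies_in U' (fmap (comp_hom l f) p).
      by apply/pS'; rewrite -E2; apply: idealMr; [apply: ideal_gen_ideal | apply: lI'].
    have L10 := disjoint_zero UL UL'.
    have [n n0] := l0 1 (etrans (rmorph1 l) L10); exists n.
    by rewrite mulr1 in n0.
  have [n xn] := prod_nil _ _ Ix Ix'.
  (* Since [x (1 - x)] is nilpotent, suitable multiples of high powers of [x] and [1 - x] are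
     complementary orthogonal idempotents. *)
  have [e [d [Ie Id ed1 ed0]]] : exists e d, [/\ I e, I' d, e + d = 1 & e * d = 0].
    have [y [y' yE]] : exists y y', y * x ^+ n.+1 + y' * (1 - x) ^+ n.+1 = 1.
      have comax (a b : C) m : (exists y y', y * a + y' * b = 1) ->
          exists y y', y * a ^+ m + y' * b = 1.
        move=> [y [y' E0]]; elim: m => [|m [z [z' zE]]].
          by exists 1, 0; rewrite expr0 mulr1 mul0r addr0.
        exists (z * y), (z' + z * a ^+ m * y').
        by rewrite -[RHS]zE -[X in _ = z * X + _]mulr1 -E0 exprS; ring.
      have [|y [y' yE]] := comax x (1 - x) n.+1.
        by exists 1, 1; rewrite !mul1r addrC subrK.
      have [|z [z' zE]] := comax (1 - x) (x ^+ n.+1) n.+1.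
        by exists y', y; rewrite addrC.
      by exists z', z; rewrite addrC.
    exists (y * x ^+ n.+1), (y' * (1 - x) ^+ n.+1); split=> //.
    - by rewrite exprS mulrCA; apply: idealMr.
    - by rewrite exprS mulrCA; apply: idealMr.
    - rewrite mulrACA -exprMn exprS.
      by rewrite xn mulr0 mulr0.
  have dE : d = 1 - e by rewrite -ed1 addrC addKr.
  have ee : e * e = e.
    by apply/eqP; rewrite -subr_eq0 -{3}[e]mulr1 -mulrBr -opprB mulrN -dE ed0 oppr0.
  exists e; split=> // D g ge.
  - rewrite fmap_compE; apply/pS; rewrite -ge; apply: (ideal_gen_min (I := fun z => ideal_gen _ (g z)) Ie).
      by apply: ideal_preim; apply: ideal_gen_ideal.
    by move=> _ [a [Sa ->]]; apply: ideal_gen_sub; exists a.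
  - have gd : g d = 1 by rewrite dE rmorphB rmorph1 ge subr0.
    rewrite fmap_compE; apply/pS'; rewrite -gd; apply: (ideal_gen_min (I := fun z => ideal_gen _ (g z)) Id).
      by apply: ideal_preim; apply: ideal_gen_ideal.
    by move=> _ [a [Sa ->]]; apply: ideal_gen_sub; exists a.
have [r [r' rE]] := prod_projections B B'.
pose eB : prod_alg B B' := (1, 0).
have rr' c : r c = c.1 /\ r' c = c.2 by case: c => a b; have [<- <-] := rE (a, b).
have spB : idempotent_split eB r r'.
  split.
  - by apply/eqP; rewrite /eB xpair_eqE /= mulr1 mulr0 !eqxx.
  - by move=> b; exists (b, 0); have [-> _] := rr' (b, 0).
  - by move=> b; exists (0, b); have [_ ->] := rr' (0, b).
  - move=> [a b]; have [-> _] := rr' (a, b); split=> /= [->|].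
      by apply/eqP; rewrite xpair_eqE /= mulr0 mul0r !eqxx.
    by move=> /(congr1 fst) /=; rewrite mul1r.
  - move=> [a b]; have [_ ->] := rr' (a, b); split=> /= [->|].
      by apply/eqP; rewrite xpair_eqE /= mulr0 subrr mul0r !eqxx.
    by move=> /(congr1 snd) /=; rewrite subr0 mul1r.
have [z [[zu zu'] _]] := split_sheaf spB X_sheaf u u'.
have through (A : algebra R) (f : alg_hom (prod_alg B B') A) :
    (f eB = 1 -> exists g : alg_hom B A, forall c, f c = g (r c)) /\
    (f eB = 0 -> exists g : alg_hom B' A, forall c, f c = g (r' c)).
  split=> fe.
    have [|g gE] := kernel_factor (f := r) (g := f) (split_surj1 spB).
      by move=> a /(split_ker1 spB) ea; rewrite -[f a]mul1r -fe -rmorphM ea rmorph0.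
    suff gC t : g (alg_map B t) = alg_map A t by exists (AlgHom gC) => c; rewrite -gE.
    by rewrite -(alg_hom_comm r) gE alg_hom_comm.
  have [|g gE] := kernel_factor (f := r') (g := f) (split_surj2 spB).
    move=> a /(split_ker2 spB) ea; rewrite -[f a]mul1r -(subr0 1) -fe -(rmorph1 f).
    by rewrite -rmorphB -rmorphM ea rmorph0.
  suff gC t : g (alg_map B' t) = alg_map A t by exists (AlgHom gC) => c; rewrite -gE.
  by rewrite -(alg_hom_comm r') gE alg_hom_comm.
exists z; split.
  exists eB; split; first exact: split_idem spB.
  - move=> A f /(proj1 (through A f))[g gE].
    suff -> : fmap f z = fmap g u by apply: lies_in_fmap.
    by rewrite -zu fmap_compE; apply: eq_fmap.
  - move=> A f /(proj2 (through A f))[g gE].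
    suff -> : fmap f z = fmap g u' by apply: lies_in_fmap.
    by rewrite -zu' fmap_compE; apply: eq_fmap.
move=> A p [e [ee eU eU']].
have [A1 [A2 [q1 [q2 sp]]]] := idempotent_split_exists ee.
have [h1 [h1E h1_uniq]] := u_univ _ _ (eU _ q1 (split_q1 sp)).
have [h2 [h2E h2_uniq]] := u'_univ _ _ (eU' _ q2 (split_q2 sp)).
have [q qE] := pair_alg_hom q1 q2.
have [f fE] := pair_alg_hom (comp_hom h1 r) (comp_hom h2 r').
have q_inj : injective q.
  by move=> a b; rewrite !qE => -[]; apply: (split_inj sp).
have [h hE] : exists h : alg_hom (prod_alg B B') A, forall a, q (h a) = f a.
  apply: lift_alg_hom => // c; rewrite fE.
  have [a [a1 a2]] := split_pair sp (comp_hom h1 r c) (comp_hom h2 r' c).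
  by exists a; rewrite qE a1 a2.
have h_1 a : q1 (h a) = h1 (r a) by have := hE a; rewrite qE fE => -[].
have h_2 a : q2 (h a) = h2 (r' a) by have := hE a; rewrite qE fE => -[].
have he : h eB = e.
  apply: (split_inj sp); rewrite ?h_1 ?h_2.
    by have [-> _] := rr' eB; rewrite rmorph1 (split_q1 sp).
  by have [_ ->] := rr' eB; rewrite rmorph0 (split_q2 sp).
exists h; split.
  have [p0 [_ p0_uniq]] := split_sheaf sp X_sheaf (fmap q1 p) (fmap q2 p).
  rewrite -(p0_uniq p) //; symmetry; apply: p0_uniq; split.
    rewrite -h1E -zu !fmap_compE; apply: eq_fmap => a; exact: h_1.
  by rewrite -h2E -zu' !fmap_compE; apply: eq_fmap => a; apply: h_2.
move=> h' h'E.
have zU (C : algebra R) (g : alg_hom (prod_alg B B') C) : g eB = 1 -> lies_in U (fmap g z).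
  move=> /(proj1 (through C g))[g' g'E].
  suff -> : fmap g z = fmap g' u by apply: lies_in_fmap.
  by rewrite -zu fmap_compE; apply: eq_fmap.
have zU' (C : algebra R) (g : alg_hom (prod_alg B B') C) : g eB = 0 -> lies_in U' (fmap g z).
  move=> /(proj2 (through C g))[g' g'E].
  suff -> : fmap g z = fmap g' u' by apply: lies_in_fmap.
  by rewrite -zu' fmap_compE; apply: eq_fmap.
have hh'E : fmap h' z = p by [].
(* Both idempotents separate the part over [U] from the part over [U']. Where they differ the point
   lies in both opens, so the ring there is zero. *)
have he' : h' eB = e.
  have idem' : h' eB * h' eB = h' eB by rewrite -rmorphM (split_idem spB).
  have [C1 [C2 [c1 [c2 spC]]]] := idempotent_split_exists idem'.
  apply: (split_inj spC).
    rewrite (split_q1 spC).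
    have [|D1 [D2 [d1 [d2 spD]]]] := @idempotent_split_exists R _ (c1 e).
      by rewrite -rmorphM ee.
    apply: (split_inj spD); first by rewrite rmorph1 (split_q1 spD).
    rewrite (split_q2 spD) rmorph1; apply: (@disjoint_zero D2 (fmap (comp_hom d2 c1) p)).
      rewrite -h'E fmap_compE; apply: zU => /=.
      by rewrite (split_q1 spC) rmorph1.
    by apply: eU'; rewrite /= (split_q2 spD).
  rewrite (split_q2 spC).
  have [|D1 [D2 [d1 [d2 spD]]]] := @idempotent_split_exists R _ (c2 e).
    by rewrite -rmorphM ee.
  apply: (split_inj spD); last by rewrite rmorph0 (split_q2 spD).
  rewrite (split_q1 spD) rmorph0; symmetry.
  apply: (@disjoint_zero D1 (fmap (comp_hom d1 c2) p)).
    by apply: eU; rewrite /= (split_q1 spD).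
  rewrite -h'E fmap_compE; apply: zU' => /=.
  by rewrite (split_q2 spC) rmorph0.
move=> c; apply: (split_inj sp); rewrite ?h_1 ?h_2.
  have [|g gE] := proj1 (through _ (comp_hom q1 h')); first by rewrite /= he' (split_q1 sp).
  have -> : h1 (r c) = g (r c).
    symmetry; apply: h1_uniq; rewrite -h'E -zu !fmap_compE; apply: eq_fmap => a /=.
    by rewrite -gE.
  by rewrite -gE.
have [|g gE] := proj2 (through _ (comp_hom q2 h')); first by rewrite /= he' (split_q2 sp).
have -> : h2 (r' c) = g (r' c).
  symmetry; apply: h2_uniq; rewrite -h'E -zu' !fmap_compE; apply: eq_fmap => a /=.
  by rewrite -gE.
by rewrite -gE.
Qed.

End Disjoint.

(* Otherwise the disjoint union is an affine open whose chart [B * B'] is not a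
   domain. *)
Lemma affine_opens_meet (R : comPzRingType) (X : functor R) (U U' : subfunctor X)
    (B B' : algebra R) :
  zariski_sheaf X -> integral X -> affine_open U B -> affine_open U' B' ->
  nonempty (sub U) -> nonempty (sub U') ->
  exists (F : fieldType) (phi : {rmorphism R -> F}) (p : X (Alg phi)),
    lies_in U p /\ lies_in U' p.
Proof.
move=> X_sheaf [_ X_dom] UB UB' neU neU'; apply: contrapT => no.
have aff := disjoint_union_affine X_sheaf UB UB' (fun F phi p Up Up' =>
  no (ex_intro _ F (ex_intro _ phi (ex_intro _ p (conj Up Up'))))).
have [U'_open _] := UB'.
have [|_ dom] := X_dom _ _ aff.
  have [F [phi [[p Up]]]] := neU; exists F, phi; split; exists p, 1; split.
  - by rewrite mulr1.
  - by move=> C f _; apply: lies_in_fmap.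
  - move=> C f f0; have [S pS] := opens_exists p U'_open; apply/pS.
    by rewrite -(rmorph1 f) f0; apply: ideal0 (ideal_gen_ideal _).
have no_point (V : subfunctor X) G : affine_open V G -> nonempty (sub V) -> (1 : G) <> 0.
  move=> /affine_openP[_ [u [_ u_univ]]] [F [phi [[p Vp]]]] G10.
  have [h _] := u_univ _ _ Vp.
  by have /eqP := rmorph1 h; rewrite G10 rmorph0 eq_sym oner_eq0.
have [|E1|E1] := dom (1, 0) (0, 1).
- by apply/eqP; rewrite xpair_eqE /= mulr0 mul0r !eqxx.
- by apply: (no_point U B) => //; have /(congr1 fst) := E1.
- by apply: (no_point U' B') => //; have /(congr1 snd) := E1.
Qed.

Lemma domain_generic_point (B : comPzRingType) : is_domain B ->
  exists (F : fieldType) (f : {rmorphism B -> F}), injective f /\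
    forall c, exists a s, f s <> 0 /\ c = f a / f s.
Proof.
move=> [B1 B_int]; have [|F [f [f0 fF]]] := @prime_residue_field B (fun a => a = 0).
  by split=> //; apply: zero_ideal.
by exists F, f; split=> // x y /eqP; rewrite -subr_eq0 -rmorphB => /eqP /f0 /subr0_eq.
Qed.

(** A chart around a point of [U'] meets [U]. Its ring is a domain, so its generic point lies in
    D(s) and D(s') for nonzero functions [s], [s'] defining parts of [U] and [U']. *)
Lemma open_meets_chart (R : comPzRingType) (X : functor R) (U U' : subfunctor X)
    (B : algebra R) :
  is_scheme X -> integral X -> affine_open U B -> nonempty (sub U) ->
  open_sub U' -> nonempty (sub U') ->
  exists (F : fieldType) (phi : {rmorphism R -> F}) (p : X (Alg phi)),
    lies_in U p /\ lies_in U' p.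
Proof.
move=> [X_sheaf X_cover] X_int UB neU U'_open [L [psi [[q U'q]]]].
have [U3 [G [U3G U3q]]] := X_cover L psi q.
have neU3 : nonempty (sub U3) by exists L, psi; split; exists q.
have [M [xi [p' [Up' U3p']]]] := affine_opens_meet X_sheaf X_int UB U3G neU neU3.
have [U_open _] := UB.
have domG : is_domain G by apply: (proj2 X_int) U3G neU3.
have [_ [g [U3g g_univ]]] := proj1 (affine_openP _ _) U3G.
have [S gS] := opens_exists g U_open; have [S' gS'] := opens_exists g U'_open.
have [h [hE _]] := g_univ _ _ U3p'; have [h' [h'E _]] := g_univ _ _ U3q.
have [s Ss s0] : exists2 s, S s & s <> 0.
  have : lies_in U (fmap h g) by rewrite hE.
  move/gS/field_unit_ideal => [_ [s [Ss ->]]] hs; exists s => // s0.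
  by apply: hs; rewrite s0 rmorph0.
have [s' Ss' s'0] : exists2 s, S' s & s <> 0.
  have : lies_in U' (fmap h' g) by rewrite h'E.
  move/gS'/field_unit_ideal => [_ [s' [Ss' ->]]] hs; exists s' => // s'0.
  by apply: hs; rewrite s'0 rmorph0.
have [F [f [f_inj _]]] := domain_generic_point domG.
have f_neq0 c : c <> 0 -> f c <> 0 by move=> c0; rewrite -(rmorph0 f) => /f_inj.
exists F, (f \o alg_map G : {rmorphism R -> F}), (fmap (push_hom f) g); split.
  by apply/gS; apply/field_unit_ideal; exists (f s); [exists s | apply: f_neq0].
by apply/gS'; apply/field_unit_ideal; exists (f s'); [exists s' | apply: f_neq0].
Qed.

(** * Base change *)

Definition base_sub (R S : comPzRingType) (phi : {rmorphism R -> S}) (X : functor R)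
    (U : subfunctor X) : subfunctor (base_change phi X) :=
  @Subfunctor S (base_change phi X) (fun A p => @lies_in R X U (restrict phi A) p)
    (fun A B f p Up => lies_in_fmap (restrict_hom phi f) Up).

Lemma base_sub_open (R S : comPzRingType) (phi : {rmorphism R -> S}) (X : functor R)
    (U : subfunctor X) : open_sub U -> open_sub (base_sub phi U).
Proof.
move=> U_open A p; have [T pT] := U_open (restrict phi A) p; exists T => B f.
exact: (pT (restrict phi B) (restrict_hom phi f)).
Qed.

Record is_tensor (R : comPzRingType) (A B : algebra R) (T : comPzRingType)
    (i : {rmorphism A -> T}) (j : {rmorphism B -> T}) : Prop := IsTensor {
  tensor_agree : forall r, i (alg_map A r) = j (alg_map B r);
  tensor_univ : forall (C : comPzRingType) (f : {rmorphism A -> C}) (g : {rmorphism B -> C}),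
    (forall r, f (alg_map A r) = g (alg_map B r)) ->
    exists h : {rmorphism T -> C}, (forall a, h (i a) = f a) /\ forall b, h (j b) = g b;
  tensor_span : forall t, exists s : seq (A * B), t = \sum_(x <- s) i x.1 * j x.2;
  tensor_zero : forall n (a : 'I_n -> A) (b : 'I_n -> B),
    \sum_x i (a x) * j (b x) = 0 <-> tensor_eq0 (a : 'I_n -> lmod_of A) b }.

Lemma tensor_exists (R : comPzRingType) (A B : algebra R) :
  exists (T : comPzRingType) (i : {rmorphism A -> T}) (j : {rmorphism B -> T}), is_tensor i j.
Proof.
have [T [i [j [agree univ span zero]]]] := tensor_product A B.
by exists T, i, j.
Qed.

Lemma tensor_base_injective (R : comPzRingType) (A A' B : algebra R) (phi : alg_hom A A')
    (T T' : comPzRingType) (i : {rmorphism A -> T}) (j : {rmorphism B -> T})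
    (i' : {rmorphism A' -> T'}) (j' : {rmorphism B -> T'}) :
  flat_algebra B -> injective phi -> is_tensor i j -> is_tensor i' j' ->
  exists h : {rmorphism T -> T'}, [/\ injective h, forall a, h (i a) = i' (phi a)
    & forall b, h (j b) = j' b].
Proof.
move=> flatB phi_inj ten ten'.
have [r|h [hi hj]] := tensor_univ ten (f := i' \o phi) (g := j').
  by rewrite /= alg_hom_comm (tensor_agree ten').
exists h; split=> //.
apply: (flat_tensor_injective flatB phi_inj (tensor_span ten) _ _ hi hj).
  by move=> n a b; apply: (proj2 (tensor_zero ten a b)).
by move=> n a b; apply: (proj1 (tensor_zero ten' a b)).
Qed.

Lemma tensor_right_injective (R : comPzRingType) (A B : algebra R) (T : comPzRingType)
    (i : {rmorphism A -> T}) (j : {rmorphism B -> T}) :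
  flat_algebra B -> injective (alg_map A) -> is_tensor i j -> injective j.
Proof.
move=> flatB A_inj ten.
apply: (flat_tensor_injective (phi := struct_hom A) (i := alg_map B : {rmorphism alg_self R -> B})
  (j := idfun : {rmorphism B -> B}) flatB A_inj _ _
  (fun n a b => proj1 (tensor_zero ten a b))) => //.
- by move=> b; exists [:: (1, b)]; rewrite big_seq1 rmorph1 mul1r.
- move=> n a b /(_ (lmod_of B) (fun m c => alg_map B m * c : lmod_of B)); apply; split.
  + by move=> m m' c; rewrite rmorphD mulrDl.
  + by move=> m c c'; rewrite mulrDr.
  + by move=> r m c; rewrite !alg_scaleE rmorphM mulrA.
  + by move=> r m c; rewrite !alg_scaleE mulrCA.
- by move=> r /=; rewrite (tensor_agree ten).
Qed.

Section TwoBaseChanges.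
Variables (R K0 F : comPzRingType) (tau : {rmorphism R -> K0}) (phi : {rmorphism K0 -> F}).
Variables (X : functor R) (U : subfunctor X) (B : algebra R) (u : X B).
Hypotheses (U_open : open_sub U) (Uu : lies_in U u).
Hypothesis u_univ : forall (A : algebra R) (p : X A), lies_in U p ->
  exists h : alg_hom B A, fmap h u = p /\ forall h' : alg_hom B A, fmap h' u = p -> h' =1 h.
Variables (T : comPzRingType) (i : {rmorphism F -> T}) (j : {rmorphism B -> T}).
Hypothesis ten : @is_tensor R (Alg (phi \o tau : {rmorphism R -> F})) B T i j.

Let jR : alg_hom B (restrict tau (restrict phi (Alg i))) :=
  @AlgHom R B (restrict tau (restrict phi (Alg i))) j (fun r => esym (tensor_agree ten r)).

(** The chart is [F (x) B]. There are two successive base changes because geometric integrality is a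
    property of the generic fibre, itself a base change. *)
Lemma base_change_chart : affine_open (base_sub phi (base_sub tau U)) (Alg i).
Proof.
apply/affine_openP; split; first exact/base_sub_open/base_sub_open.
exists (fmap jR u : base_change phi (base_change tau X) (Alg i)); split.
  by apply: (@lies_in_fmap R X U).
move=> A p Up; have [h [hE h_uniq]] := u_univ (Up : @lies_in R X U _ p).
have [r|g [gi gj]] := tensor_univ ten (f := alg_map A) (g := h).
  by rewrite alg_hom_comm.
exists (@AlgHom F (Alg i) A g gi); split.
  rewrite /= (@fmap_compE R X) -[RHS]hE; apply: (@eq_fmap R X) => b /=; exact: gj.
move=> g'; rewrite /= (@fmap_compE R X) => /h_uniq g'E t.
have [s ->] := tensor_span ten t; rewrite !raddf_sum; apply: eq_bigr => x _.
rewrite [LHS](rmorphM g') [RHS](rmorphM g) gi gj [g' (i _)](alg_hom_comm g' x.1).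
congr (_ * _).
by have := g'E x.2.
Qed.

End TwoBaseChanges.

Lemma base_change_sheaf (R S : comPzRingType) (phi : {rmorphism R -> S}) (X : functor R) :
  zariski_sheaf X -> zariski_sheaf (base_change phi X).
Proof.
move=> X_sheaf A n s s_unit L l l_loc p p_agree.
apply: (X_sheaf (restrict phi A) n s s_unit (fun i => restrict phi (L i))
  (fun i => restrict_hom phi (l i)) l_loc p) => i j C g g' gg'.
(* Agreement is required on [R]-algebras but known on [S]-algebras: [C] becomes an [S]-algebra
   through [L i], and [gg'] shows that [L j] induces the same structure. *)
pose CS : algebra S := Alg (g \o alg_map (L i) : {rmorphism S -> alg_ring C}).
have [gS gSE] : exists gS : alg_hom (L i) CS, forall a, gS a = g a.
  by exists (@AlgHom S (L i) CS (alg_hom_fun g) (fun r => erefl)).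
have [gS' gSE'] : exists gS : alg_hom (L j) CS, forall a, gS a = g' a.
  suff gC r : g' (alg_map (L j) r) = alg_map CS r.
    by exists (@AlgHom S (L j) CS (alg_hom_fun g') gC).
  by rewrite /= -(alg_hom_comm (l j)) -(alg_hom_comm (l i)) -gg'.
have back r : (idfun : {rmorphism CS -> C}) (alg_map (restrict phi CS) r) = alg_map C r.
  exact: (alg_hom_comm g r).
pose b : alg_hom (restrict phi CS) C := @AlgHom R (restrict phi CS) C idfun back.
have -> : fmap g (p i) = fmap b (fmap (restrict_hom phi gS) (p i)).
  by rewrite fmap_compE; apply: eq_fmap => a /=; rewrite gSE.
have -> : fmap g' (p j) = fmap b (fmap (restrict_hom phi gS') (p j)).
  by rewrite fmap_compE; apply: eq_fmap => a /=; rewrite gSE'.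
congr fmap; apply: (p_agree i j CS gS gS') => a.
by rewrite gSE gSE'.
Qed.

Lemma base_change_scheme (R K0 F : comPzRingType) (tau : {rmorphism R -> K0})
    (phi : {rmorphism K0 -> F}) (X : functor R) :
  is_scheme X -> is_scheme (base_change phi (base_change tau X)).
Proof.
move=> [X_sheaf X_cover]; split; first exact/base_change_sheaf/base_change_sheaf.
move=> L psi p; have [U [B [UB Up]]] := X_cover L _ p.
have [T [i [j ten]]] := tensor_exists (Alg (phi \o tau : {rmorphism R -> F})) B.
have [U_open [u [Uu u_univ]]] := proj1 (affine_openP _ _) UB.
exists (base_sub phi (base_sub tau U)), (Alg i); split=> //.
exact: (base_change_chart U_open Uu u_univ ten).
Qed.

Lemma fraction_extend (A : comPzRingType) (K F : fieldType) (i : {rmorphism A -> K})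
    (f : {rmorphism A -> F}) : injective i -> injective f ->
  (forall c, exists a s, i s <> 0 /\ c = i a / i s) ->
  exists g : {rmorphism K -> F}, forall a, g (i a) = f a.
Proof.
move=> i_inj f_inj i_frac; have /choice[num /choice[den fracE]] := i_frac.
have i0 s : i s != 0 -> f s != 0.
  by apply: contra_neq => /eqP; rewrite -(rmorph0 f) (inj_eq f_inj) => /eqP ->; rewrite rmorph0.
pose g c := f (num c) / f (den c).
have gE a s : i s != 0 -> g (i a / i s) = f a / f s.
  move=> s0; rewrite /g; set c := i a / i s; have [/eqP d0 cE] := fracE c.
  apply/eqP; rewrite eqr_div ?i0 //; apply/eqP; rewrite -!rmorphM; apply: (congr1 f).
  apply: i_inj; rewrite !rmorphM; apply/eqP; rewrite -eqr_div //; apply/eqP.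
  by rewrite -cE.
have frac c : exists a s, i s != 0 /\ c = i a / i s.
  by have [a [s [/eqP]]] := i_frac c; exists a, s.
have [|h hE] := @rmorphism_of K F g.
  split.
  - move=> x y; have [a [s [s0 ->]]] := frac x; have [b [t [t0 ->]]] := frac y.
    have -> : i a / i s + i b / i t = i (a * t + b * s) / i (s * t).
      by rewrite addf_div // rmorphD !rmorphM.
    by rewrite !gE // ?rmorphM ?mulf_neq0 // addf_div ?i0 // rmorphD !rmorphM.
  - move=> x y; have [a [s [s0 ->]]] := frac x; have [b [t [t0 ->]]] := frac y.
    have -> : i a / i s * (i b / i t) = i (a * b) / i (s * t).
      by rewrite mulf_div !rmorphM.
    by rewrite !gE // ?rmorphM ?mulf_neq0 // mulf_div.
  - have -> : 1 = i 1 / i 1 :> K by rewrite rmorph1 divr1.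
    by rewrite gE ?rmorph1 ?oner_eq0 // divr1.
exists h => a; rewrite hE; have -> : i a = i a / i 1 by rewrite rmorph1 divr1.
by rewrite gE ?rmorph1 ?oner_eq0 // divr1.
Qed.

Lemma is_domain_inj (A B : comPzRingType) (f : {rmorphism A -> B}) :
  injective f -> is_domain B -> is_domain A.
Proof.
move=> f_inj [B1 B_int]; split.
  by move=> A1; apply: B1; rewrite -(rmorph1 f) A1 rmorph0.
move=> x y /(congr1 f); rewrite rmorphM rmorph0 => /B_int.
by case; rewrite -(rmorph0 f) => /f_inj; [left | right].
Qed.

Lemma field_inj (F : fieldType) (A : comPzRingType) (f : {rmorphism F -> A}) :
  (1 : A) <> 0 -> injective f.
Proof.
move=> A1 x y /eqP; rewrite -subr_eq0 -rmorphB => /eqP xy.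
apply/eqP; rewrite -subr_eq0; apply: contrapT => /negP xy0; apply: A1.
by rewrite -(rmorph1 f) -(mulfV xy0) rmorphM xy mul0r.
Qed.

Section Generic.
Variables (R : comPzRingType) (K0 : fieldType) (tau : {rmorphism R -> K0}).
Hypothesis tau_inj : injective tau.
Hypothesis tau_frac : forall c, exists a s, tau s <> 0 /\ c = tau a / tau s.
Variable X : functor R.
Hypothesis X_scheme : is_scheme X.
Hypothesis X_flat : flat X.
Hypothesis X_integral : geometrically_integral (base_change tau X).

Let fibre_domain (F : fieldType) (phi : {rmorphism K0 -> F}) (U : subfunctor X) (B : algebra R)
    (T : comPzRingType) (i : {rmorphism F -> T}) (j : {rmorphism B -> T}) :
  affine_open U B -> @is_tensor R (Alg (phi \o tau : {rmorphism R -> F})) B T i j ->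
  (1 : T) <> 0 -> is_domain T.
Proof.
move=> UB ten T1; have [U_open [u [Uu u_univ]]] := proj1 (affine_openP _ _) UB.
have chart := base_change_chart U_open Uu u_univ ten.
apply: (proj2 (X_integral phi) _ _ chart).
have [L [f _]] := maximal_residue_field (zero_ideal T) T1.
have [_ [w [Uw _]]] := proj1 (affine_openP _ _) chart.
exists L, (f \o i : {rmorphism F -> L}); split.
by exists (fmap (@push_hom F (Alg i) L f) w); apply: (lies_in_fmap (@push_hom F (Alg i) L f) Uw).
Qed.

(** By flatness [B] embeds into [K0 (x) B], the ring of a chart of the generic fibre. *)
Let chart_domain (U : subfunctor X) (B : algebra R) :
  affine_open U B -> (1 : B) <> 0 -> is_domain B /\ injective (alg_map B).
Proof.
move=> UB B1; have flatB := X_flat UB.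
pose KR : algebra R := Alg ((idfun : {rmorphism K0 -> K0}) \o tau : {rmorphism R -> K0}).
have [T [i [j ten]]] := tensor_exists KR B.
have j_inj : injective j by apply: tensor_right_injective ten.
have T1 : (1 : T) <> 0 by rewrite -(rmorph1 j) -(rmorph0 j) => /j_inj.
split; first by apply: is_domain_inj j_inj _; apply: fibre_domain UB ten T1.
move=> r s /(congr1 j); rewrite -!(tensor_agree ten) => /(field_inj T1); exact: tau_inj.
Qed.

(* By flatness [B (x) C] embeds into [Frac B (x) C], a chart of the base change of
   the generic fibre to [Frac B]. *)
Lemma product_domain (U U' : subfunctor X) (B C : algebra R) (k : fieldType)
    (f : {rmorphism B -> k}) (g : {rmorphism C -> k})
    (D : comPzRingType) (i : {rmorphism B -> D}) (j : {rmorphism C -> D}) :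
  affine_open U B -> affine_open U' C -> (forall r, f (alg_map B r) = g (alg_map C r)) ->
  is_tensor i j ->
  [/\ is_domain D, injective i, injective j & injective (alg_map B)].
Proof.
move=> UB UC fg ten; have flatC := X_flat UC.
have [|domB R_inj] := chart_domain UB.
  by move=> B1; have /eqP := rmorph1 f; rewrite B1 rmorph0 eq_sym oner_eq0.
have [F [b [b_inj b_frac]]] := domain_generic_point domB.
have [|phi phiE] := fraction_extend (f := b \o alg_map B) tau_inj _ tau_frac.
  by move=> r s /= /b_inj /R_inj.
pose FR : algebra R := Alg (phi \o tau : {rmorphism R -> F}).
pose bR : alg_hom B FR := @AlgHom R B FR b (fun r => esym (phiE r)).
have [T [i' [j' ten']]] := tensor_exists FR C.
have [h [h_inj hi hj]] := tensor_base_injective (phi := bR) flatC b_inj ten ten'.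
have [e _] := tensor_univ ten fg.
have D1 : (1 : D) <> 0.
  by move=> D1; have /eqP := rmorph1 e; rewrite D1 rmorph0 eq_sym oner_eq0.
have T1 : (1 : T) <> 0 by rewrite -(rmorph1 h) -(rmorph0 h) => /h_inj.
split=> //.
- by apply: is_domain_inj h_inj _; apply: fibre_domain UC ten' T1.
- move=> x y /(congr1 h); rewrite !hi => /(field_inj T1); exact: b_inj.
- move=> x y /(congr1 h); rewrite !hj; apply: (tensor_right_injective flatC _ ten').
  by apply: inj_comp; [apply: field_inj; apply/eqP; apply: oner_neq0 | apply: tau_inj].
Qed.

(** Injectivity of [f] makes the point generic. By irreducibility some function defining [U'] on the
    chart is nonzero, and it remains so at the point because [K0 (x) B] embeds into [E]. *)
Lemma generic_point_lies (U : subfunctor X) (B : algebra R) (u : X B)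
    (E : fieldType) (phi : {rmorphism K0 -> E})
    (f : alg_hom B (Alg (phi \o tau : {rmorphism R -> E})))
    (U' : subfunctor (base_change tau X)) :
  affine_open U B -> lies_in U u ->
  (forall (A : algebra R) (p : X A), lies_in U p ->
    exists h : alg_hom B A, fmap h u = p /\ forall h' : alg_hom B A, fmap h' u = p -> h' =1 h) ->
  injective f -> open_sub U' -> nonempty (sub U') ->
  lies_in U' (fmap f u : base_change tau X (Alg phi)).
Proof.
move=> UB Uu u_univ f_inj U'_open [L0 [psi0 [[q U'q]]]].
pose I : {rmorphism K0 -> K0} := idfun.
have [U_open _] := UB.
have [T [i [j ten]]] := tensor_exists (Alg (I \o tau : {rmorphism R -> K0})) B.
have jC r : j (alg_map B r) = alg_map (restrict tau (Alg i)) r by rewrite -(tensor_agree ten).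
pose jR : alg_hom B (restrict tau (Alg i)) := @AlgHom R B (restrict tau (Alg i)) j jC.
pose w : base_change tau X (Alg i) := fmap jR u.
have [S wS] := opens_exists w U'_open.
have chart := base_change_chart U_open Uu u_univ ten.
have [r|g [gi gj]] := tensor_univ ten (f := phi : {rmorphism K0 -> E}) (g := f).
  by rewrite alg_hom_comm.
pose gK : alg_hom (Alg i) (Alg phi) := @AlgHom K0 (Alg i) (Alg phi) g gi.
have gw : fmap gK w = fmap f u.
  by rewrite /= (@fmap_compE R X); apply: (@eq_fmap R X) => b /=; apply: gj.
have g_inj : injective g.
  move=> x y /eqP; rewrite -subr_eq0 -rmorphB => /eqP xy; apply/eqP; rewrite -subr_eq0.
  move: (x - y) xy => {x y} t gt.
  have tE r : i (tau r) = j (alg_map B r) by rewrite -(tensor_agree ten).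
  (* Clearing denominators moves an element of [K0 (x) B] into [B], where injectivity of [f]
     applies. *)
  have [e [b [e0 eb]]] : exists e b, tau e != 0 /\ i (tau e) * t = j b.
    have [s ->] := tensor_span ten t.
    elim: s => [|x s [e [b [e0 eb]]]].
      by exists 1, 0; rewrite rmorph1 oner_neq0 big_nil mulr0 rmorph0.
    have [a [d [/eqP d0 xE]]] := tau_frac x.1.
    exists (e * d), (alg_map B (e * a) * x.2 + alg_map B d * b); split.
      by rewrite rmorphM mulf_neq0.
    rewrite big_cons mulrDr [RHS]rmorphD; congr (_ + _).
      rewrite [RHS]rmorphM -tE mulrA -rmorphM; congr (i _ * _).
      by rewrite xE !rmorphM; field.
    by rewrite [tau _]rmorphM mulrC [i _]rmorphM mulrA (mulrC _ (i (tau e))) eb mulrC [RHS]rmorphM -tE.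
  have b0 : b = 0.
    apply: f_inj; rewrite rmorph0 -gj -eb rmorphM.
    by rewrite gt mulr0.
  by rewrite -[t]mul1r -(rmorph1 i) -(mulVf e0) rmorphM -mulrA eb b0 rmorph0 mulr0.
have [L [psi [p [Up U'p]]]] : exists (L : fieldType) (psi : {rmorphism K0 -> L})
    (p : base_change I (base_change tau X) (Alg psi)),
    lies_in (base_sub I (base_sub tau U)) p /\ lies_in (base_sub I U') p.
  apply: (open_meets_chart (base_change_scheme _ _ X_scheme) (X_integral I) chart).
  - exists E, phi; split.
    have fC r : f (alg_map B r) = alg_map (restrict tau (restrict I (Alg phi))) r.
      by rewrite alg_hom_comm.
    exists (fmap (@AlgHom R B (restrict tau (restrict I (Alg phi))) f fC) u).
    exact: (@lies_in_fmap R X U).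
  - exact: base_sub_open.
  - exists L0, psi0; split.
    have back r : (idfun : {rmorphism L0 -> L0}) (alg_map (Alg psi0) r) =
      alg_map (restrict I (Alg psi0)) r by [].
    exists (fmap (@AlgHom K0 (Alg psi0) (restrict I (Alg psi0)) idfun back) q).
    exact: (@lies_in_fmap K0 (base_change tau X) U').
have [h [hE _]] := u_univ _ _ (Up : @lies_in R X U _ p).
have [r|h' [hi hj]] := tensor_univ ten (f := psi : {rmorphism K0 -> L}) (g := h).
  by rewrite alg_hom_comm.
pose hK : alg_hom (Alg i) (restrict I (Alg psi)) :=
  @AlgHom K0 (Alg i) (restrict I (Alg psi)) h' hi.
have : lies_in U' (fmap hK w).
  suff -> : fmap hK w = p by [].
  by rewrite -hE /= (@fmap_compE R X); apply: (@eq_fmap R X) => b /=; apply: hj.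
move/wS/field_unit_ideal => [_ [s [Ss ->]]] hs.
rewrite -gw; apply/wS/field_unit_ideal; exists (g s); first by exists s.
by rewrite -(rmorph0 g) => /g_inj s0; apply: hs; rewrite s0 /= rmorph0.
Qed.

End Generic.

(** * Hasse-Schmidt derivations *)

(* [w g a] reads "the order of [a] is at least [g]", and [r g a] is then the
   coefficient of [a] in order [g]. *)
Record grading (k : fieldType) (A : algebra k) (Z : A -> Prop) (G : Type)
    (mulG : G -> G -> G) (w : G -> A -> Prop) (r : G -> A -> k) : Prop := Grading {
  grading0 : forall g a, Z a -> w g a /\ r g a = 0;
  gradingB : forall g a b, w g a -> w g b -> w g (a - b) /\ r g (a - b) = r g a - r g b;
  gradingM : forall g h a b, w g a -> w h b ->
    w (mulG g h) (a * b) /\ r (mulG g h) (a * b) = r g a * r h b;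
  gradingZ : forall g c a, w g a ->
    w g (alg_map A c * a) /\ r g (alg_map A c * a) = c * r g a;
  grading_lead : forall a, ~ Z a -> exists g, w g a /\ r g a <> 0;
  grading_total : forall g h a b, w g a -> r g a <> 0 -> w h b -> r h b <> 0 ->
    w g b \/ w h a }.

Section HasseSchmidt.
Variables (k : fieldType) (A M : algebra k) (c : nat -> A -> M).

(** These are the rules for the coefficients of a morphism [A -> M[[z]]], with [c n] the coefficient
    of [z^n]; the power series ring itself is never formed. *)
Record hasse_schmidt : Prop := HasseSchmidtMaps {
  hsB : forall n a b, c n (a - b) = c n a - c n b;
  hsM : forall n a b, c n (a * b) = \sum_(i < n.+1) c i a * c (n - i)%N b;
  hsZ : forall n s a, c n (alg_map A s * a) = alg_map M s * c n a }.

Hypothesis hs : hasse_schmidt.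

Lemma hs0 n : c n 0 = 0.
Proof. by rewrite -(subrr 0) (hsB hs) subrr. Qed.

Lemma hsD n a b : c n (a + b) = c n a + c n b.
Proof. by have := hsB hs n a (0 - b); rewrite (hsB hs n 0) hs0 !sub0r !opprK. Qed.

Lemma hs_lowM n m a b : (forall i, (i < n)%N -> c i a = 0) ->
  (forall i, (i < m)%N -> c i b = 0) ->
  (forall i, (i < n + m)%N -> c i (a * b) = 0) /\ c (n + m)%N (a * b) = c n a * c m b.
Proof.
move=> an bm; split=> [l lnm|].
  rewrite (hsM hs) big1 // => i _; have [/an ->|ni] := ltnP i n; first by rewrite mul0r.
  by rewrite (bm (l - i)%N) ?mulr0 //; have := ltn_ord i; lia.
have nlt : (n < (n + m).+1)%N by lia.
rewrite (hsM hs) (bigD1 (Ordinal nlt)) //= addKn big1 ?addr0 // => i; rewrite -val_eqE /= => ni.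
have [/an ->|n_le] := ltnP i n; first by rewrite mul0r.
by rewrite (bm (n + m - i)%N) ?mulr0 //; have := ltn_ord i; lia.
Qed.

Variables (G : Type) (mulG : G -> G -> G) (w : G -> M -> Prop) (r : G -> M -> k).
Hypothesis gr : grading (fun x : M => x = 0) mulG w r.

Lemma hs_grading : grading (fun a => forall n, c n a = 0)
  (fun g h : nat * G => ((g.1 + h.1)%N, mulG g.2 h.2))
  (fun g a => (forall i, (i < g.1)%N -> c i a = 0) /\ w g.2 (c g.1 a))
  (fun g a => r g.2 (c g.1 a)).
Proof.
split.
- by move=> [n g] a a0 /=; have [wg rg] := grading0 gr g (a0 n).
- move=> [n g] a b [/= an wa] [bn wb]; have [wg rg] := gradingB gr wa wb.
  by rewrite (hsB hs); split=> //; split=> // i i_n; rewrite (hsB hs) an // bn // subrr.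
- move=> [n g] [m h] a b [/= an wa] [bm wb]; have [low lead] := hs_lowM an bm.
  by rewrite lead; have [wg rg] := gradingM gr wa wb.
- move=> [n g] s a [/= an wa]; have [wg rg] := gradingZ gr s wa.
  by rewrite (hsZ hs); split=> //; split=> // i i_n; rewrite (hsZ hs) an // mulr0.
- move=> a a0; have ex : exists n, `[< c n a <> 0 >].
    by apply: contrapT => no; apply: a0 => n; apply: contrapT => an; apply: no; exists n; apply/asboolP.
  case: (ex_minnP ex) => n /asboolP /(grading_lead gr)[g [wg rg]] n_min.
  exists (n, g); split=> //; split=> // i /= i_n; apply: contrapT => /asboolP /n_min.
  by rewrite leqNgt i_n.
- move=> [n g] [m h] a b [/= an wa] ra [bm wb] rb.
  case: (ltngtP n m) => [nm|mn|nm].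
  + left; split; first by move=> i i_n; apply: bm; apply: ltn_trans nm.
    by have [] := grading0 gr g (bm _ nm).
  + right; split; first by move=> i i_n; apply: an; apply: ltn_trans mn.
    by have [] := grading0 gr h (an _ mn).
  + rewrite nm in an wa ra *.
    by case: (grading_total gr wa ra wb rb) => ?; [left | right].
Qed.

End HasseSchmidt.

(** This is the polynomial ring in [e] variables, graded one variable at a time: the coefficients of
    a polynomial satisfy the Hasse-Schmidt rules, so [hs_grading] applies. All leading coefficients
    end up in [k], which is where the [k]-valued place comes from. *)
Lemma free_algebra (k : fieldType) (e : nat) :
  exists (M : comNzRingType) (f : {rmorphism k -> M}) (t : nat -> M)
    (G : Type) (mulG : G -> G -> G) (w : G -> M -> Prop) (r : G -> M -> k),
    @grading k (Alg (f : {rmorphism k -> (M : comPzRingType)})) (fun x => x = 0) G mulG w r /\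
    forall (A : algebra k) (x : nat -> A), (1 : A) <> 0 ->
      exists ev : {rmorphism M -> A}, (forall c, ev (f c) = alg_map A c) /\
        forall i, (i < e)%N -> ev (t i) = x i.
Proof.
elim: e => [|e [M [f [t [G [mulG [w [r [gr ev_ex]]]]]]]]].
  exists k, (idfun : {rmorphism k -> k}), (fun=> 0), unit, (fun _ _ => tt), (fun _ _ => True),
    (fun _ a => a); split; last by move=> A x _; exists (alg_map A).
  by split=> [||||a a0|]; [| | | |exists tt|left].
pose fP : {rmorphism k -> {poly M}} := polyC \o f.
exists {poly M}, fP, (fun i => if i == e then 'X else (t i)%:P).
have hs : @hasse_schmidt k (Alg (fP : {rmorphism k -> ({poly M} : comPzRingType)}))
    (Alg (f : {rmorphism k -> (M : comPzRingType)})) (fun n (p : {poly M}) => p`_n).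
  split=> [n p q|n p q|n s p]; first exact: coefB.
    exact: coefM.
  exact: coefCM.
pose gr' := hs_grading hs gr.
exists (nat * G)%type; do 3 eexists; split.
  have ZE : (fun p : Alg fP => p = 0) = (fun p => forall n, p`_n = 0).
    apply/funext => p; apply/propext; split=> [-> n|pn]; first exact: coef0.
    by apply/polyP => n; rewrite coef0; apply: pn.
  by rewrite ZE; apply: gr'.
move=> A x A1; have [ev [evC evt]] := ev_ex A x A1.
have [g [gC gX]] := poly_evaluation ev (x e) A1; exists g; split=> [s|i].
  by rewrite /= gC evC.
by rewrite ltnS leq_eqVlt; case: eqP => [-> _|_ /= ie]; rewrite ?gC ?evt.
Qed.

(** * Smooth rational points: cotangent space and formal lifting *)

Lemma dependent_choice_fun (T : Type) (P : T -> Type) (Q : forall t, P t -> Prop) :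
  (forall t, exists y : P t, Q t y) -> exists f : forall t, P t, forall t, Q t (f t).
Proof. by move=> ex; exists (fun t => sval (cid (ex t))) => t; apply: svalP. Qed.

Lemma ideal_powerM (A : comPzRingType) (I : A -> Prop) m n a b :
  ideal_power I m a -> ideal_power I n b -> ideal_power I (m + n) (a * b).
Proof.
elim: m a => [|m IH] a; first by move=> _; apply: idealMl (ideal_power_ideal _ _).
move=> am bn; apply: (ideal_gen_min (I := fun y => ideal_power I (m.+1 + n) (y * b)) am).
  split=> [|y z Iy Iz|c y Iy]; first by rewrite mul0r; apply: ideal0 (ideal_power_ideal _ _).
    by rewrite mulrDl; apply: idealD => //; apply: ideal_power_ideal.
  by rewrite -mulrA; apply: idealMl => //; apply: ideal_power_ideal.
move=> _ [c [d [Ic dm ->]]]; rewrite -mulrA; apply: ideal_gen_sub.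
by exists c, (d * b); split=> //; apply: IH.
Qed.

Lemma ideal_power1 (A : comPzRingType) (I : A -> Prop) a : I a -> ideal_power I 1 a.
Proof. by move=> Ia; apply: ideal_gen_sub; exists a, 1; rewrite mulr1. Qed.

Section RationalPoint.
Variables (k : fieldType) (A : algebra k) (h : {rmorphism A -> k}).
Hypothesis h_k : forall c, h (alg_map A c) = c.
Hypothesis noethA : noetherian A.
Let m a := h a = 0.
Let pow n := ideal_power m n.
Let id_pow n : is_ideal (pow n) := ideal_power_ideal m n.

Let split_point a : m (a - alg_map A (h a)).
Proof. by rewrite /m rmorphB h_k subrr. Qed.

Let cotangent_span n (x : nat -> A) := (forall i, (i < n)%N -> m (x i)) /\
  forall a, m a -> exists l : nat -> k, pow 2 (a - \sum_(i < n) alg_map A (l i) * x i).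

Let pow2 a b : m a -> m b -> pow 2 (a * b).
Proof. by move=> ma mb; apply: (@ideal_powerM _ _ 1 1); apply: ideal_power1. Qed.

Let cotangent_span_exists : exists n x, cotangent_span n x.
Proof.
have [s [sm ms]] := noethA (ideal_preim h (zero_ideal k)).
exists (size s), (nth 0 s); split=> [i i_s|a ma]; first by apply/sm/mem_nth.
pose P a := m a /\ exists l : nat -> k,
  pow 2 (a - \sum_(i < size s) alg_map A (l i) * nth 0 s i).
suff : P a by case.
apply: (ideal_gen_min (ms a ma)).
  split.
  - split; first by rewrite /m rmorph0.
    exists (fun=> 0); rewrite big1 ?subrr; first exact: ideal0 (id_pow 2).
    by move=> i _; rewrite rmorph0 mul0r.
  - move=> y z [my [l yl]] [mz [l' zl]]; split; first by rewrite /m rmorphD my mz addr0.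
    exists (fun i => l i + l' i).
    rewrite (eq_bigr (fun i : 'I_(size s) => alg_map A (l i) * nth 0 s i +
      alg_map A (l' i) * nth 0 s i)); last by move=> i _; rewrite rmorphD mulrDl.
    by rewrite big_split opprD addrACA; apply: idealD.
  - move=> c y [my [l yl]]; split; first by rewrite /m rmorphM my mulr0.
    exists (fun i => h c * l i).
    rewrite (eq_bigr (fun i : 'I_(size s) => alg_map A (h c) * (alg_map A (l i) * nth 0 s i)));
      last by move=> i _; rewrite rmorphM mulrA.
    rewrite -mulr_sumr; set S := \sum_(_ < _) _.
    have -> : c * y - alg_map A (h c) * S =
      alg_map A (h c) * (y - S) + (c - alg_map A (h c)) * y by ring.
    by apply: idealD => //; [apply: idealMl | apply: pow2].
move=> t ts; split; first exact: sm.
have t_s : (index t s < size s)%N by rewrite index_mem.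
exists (fun i => (i == index t s)%:R).
rewrite (bigD1 (Ordinal t_s)) //= eqxx rmorph1 mul1r nth_index // big1 ?addr0 ?subrr.
  exact: ideal0 (id_pow 2).
by move=> i; rewrite -val_eqE /= => /negPf ->; rewrite rmorph0 mul0r.
Qed.

(** A spanning family of least size is free: a relation with a nonzero coefficient would allow the
    corresponding member to be dropped. *)
Let cotangent_basis : exists n x, cotangent_span n x /\
  forall l : nat -> k, pow 2 (\sum_(i < n) alg_map A (l i) * x i) ->
    forall i, (i < n)%N -> l i = 0.
Proof.
have ex : exists n, `[< exists x, cotangent_span n x >].
  by have [n nP] := cotangent_span_exists; exists n; apply/asboolP.
case: (ex_minnP ex) => n /asboolP[x [xm x_span]] n_min; exists n, x; split=> // l l0 j jn.
apply: contrapT => /eqP lj.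
case: n => [//|n] in xm x_span n_min l0 jn *.
suff: (n.+1 <= n)%N by rewrite ltnn.
pose jo := Ordinal jn; apply: n_min; apply/asboolP; exists (fun i => x (bump j i)); split.
  move=> i i_n; apply: xm; exact: (ltn_ord (lift jo (Ordinal i_n))).
move=> a /x_span[u au]; exists (fun i => u (bump j i) - u j / l j * l (bump j i)).
pose u' i := u i - u j / l j * l i.
have -> : \sum_(i < n) alg_map A (u (bump j i) - u j / l j * l (bump j i)) * x (bump j i) =
    \sum_(i < n.+1) alg_map A (u' i) * x i.
  rewrite (bigD1_ord jo) //= [u' j]/u' divfK // subrr rmorph0 mul0r add0r.
  by apply: eq_bigr.
rewrite (eq_bigr (fun i : 'I_n.+1 => alg_map A (u i) * x i -
    alg_map A (u j / l j) * (alg_map A (l i) * x i))); last first.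
  by move=> i _; rewrite /u' rmorphB mulrBl rmorphM mulrA.
rewrite sumrB -mulr_sumr opprB addrCA addrC; apply: idealD => //.
exact: idealMl.
Qed.

Definition lifts_at : Prop := forall (B B' N : algebra k) (q : alg_hom B B') (e : alg_hom B' N),
  (forall b, exists a, b = q a) ->
  (forall a a', q a = 0 -> q a' = 0 -> a * a' = 0) ->
  (forall b, exists a, e a = b) -> (forall a, e a = 0 -> exists n, a ^+ n = 0) ->
  forall g : alg_hom A B', (forall a, e (g a) = alg_map N (h a)) ->
  exists g' : alg_hom A B, forall a, q (g' a) = g a.
Hypothesis A_lifts : lifts_at.

(** The coordinates of [a - h a] in m/m^2 with respect to the basis [x] are derivations, because
    [(a - h a)(b - h b)] lies in m^2. *)
Let tangent_coordinates n x : cotangent_span n x ->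
  (forall l : nat -> k, pow 2 (\sum_(i < n) alg_map A (l i) * x i) ->
    forall i, (i < n)%N -> l i = 0) ->
  exists d : nat -> A -> k, forall i, (i < n)%N ->
    [/\ forall a b, d i (a + b) = d i a + d i b,
        forall a b, d i (a * b) = h a * d i b + d i a * h b,
        forall c, d i (alg_map A c) = 0 & forall j, (j < n)%N -> d i (x j) = (i == j)%:R].
Proof.
move=> [xm x_span] x_free.
have /choice[l lP] : forall a, exists l : nat -> k,
    pow 2 (a - alg_map A (h a) - \sum_(i < n) alg_map A (l i) * x i).
  by move=> a; apply: x_span.
have l_uniq a (l' : nat -> k) :
    pow 2 (a - alg_map A (h a) - \sum_(i < n) alg_map A (l' i) * x i) ->
    forall i, (i < n)%N -> l a i = l' i.
  move=> l'P i i_n; apply/eqP; rewrite -subr_eq0; apply/eqP.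
  apply: (x_free (fun i => l a i - l' i)) => //.
  rewrite (eq_bigr (fun i : 'I_n => alg_map A (l a i) * x i - alg_map A (l' i) * x i));
    last by move=> j _; rewrite rmorphB mulrBl.
  rewrite sumrB; set S := \sum_(_ < _) _; set S' := \sum_(_ < _) _.
  apply: (ideal_comb (id_pow 2) l'P (lP a) (a := 1) (b := -1)).
  by rewrite -/S -/S'; ring.
exists (fun i a => l a i) => i i_n; split.
- move=> a b; apply: (l_uniq _ (fun i => l a i + l b i)) => //.
  rewrite (eq_bigr (fun i : 'I_n => alg_map A (l a i) * x i + alg_map A (l b i) * x i));
    last by move=> j _; rewrite rmorphD mulrDl.
  rewrite big_split /=; apply: (ideal_comb (id_pow 2) (lP a) (lP b) (a := 1) (b := 1)).
  by rewrite !rmorphD; ring.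
- move=> a b; apply: (l_uniq _ (fun i => h a * l b i + l a i * h b)) => //.
  rewrite (eq_bigr (fun i : 'I_n => alg_map A (h a) * (alg_map A (l b i) * x i) +
      alg_map A (h b) * (alg_map A (l a i) * x i))); last first.
    by move=> j _; rewrite rmorphD !rmorphM; ring.
  rewrite big_split /= -!mulr_sumr.
  have := pow2 (split_point a) (split_point b) => ab.
  have := idealD (id_pow 2) (idealMl (alg_map A (h a)) (id_pow 2) (lP b))
    (idealMl (alg_map A (h b)) (id_pow 2) (lP a)) => ab'.
  apply: (ideal_comb (id_pow 2) ab ab' (a := 1) (b := 1)).
  by rewrite !rmorphM; ring.
- move=> c; apply: (l_uniq _ (fun=> 0)) => //.
  rewrite h_k subrr sub0r big1 ?oppr0; first exact: ideal0 (id_pow 2).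
  by move=> j _; rewrite rmorph0 mul0r.
- move=> j jn; apply: (l_uniq _ (fun i => (i == j)%:R)) => //.
  rewrite (bigD1 (Ordinal jn)) //= eqxx (rmorph1 (alg_map A)) mul1r big1 ?addr0.
    by rewrite (xm j jn) rmorph0 subr0 subrr; apply: ideal0 (id_pow 2).
  by move=> i'; rewrite -val_eqE /= => /negPf ->; rewrite rmorph0 mul0r.
Qed.

Section Lifting.
Variables (M : comNzRingType) (f : {rmorphism k -> M}) (t : nat -> M) (e : nat) (x : nat -> A).
Variable d : nat -> A -> k.
Hypothesis dD : forall i, (i < e)%N -> forall a b, d i (a + b) = d i a + d i b.
Hypothesis dM : forall i, (i < e)%N -> forall a b, d i (a * b) = h a * d i b + d i a * h b.
Hypothesis dk : forall i, (i < e)%N -> forall c, d i (alg_map A c) = 0.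
Hypothesis dx : forall i j, (i < e)%N -> (j < e)%N -> d i (x j) = (i == j)%:R.

Let MA : algebra k := Alg (f : {rmorphism k -> (M : comPzRingType)}).

Let truncation n : exists (T : algebra k) (p : {rmorphism {poly M} -> T}),
  [/\ forall b, exists P, b = p P, forall P, p P = 0 <-> forall i, (i <= n)%N -> P`_i = 0
    & forall c, alg_map T c = p (f c)%:P].
Proof.
have [|T [p [p_surj p_ker _]]] := @ideal_quotient {poly M} (fun P => forall i, (i <= n)%N -> P`_i = 0).
  split=> [i _|P Q Pn Qn i i_n|Q P Pn i i_n]; first exact: coef0.
    by rewrite coefD Pn // Qn // addr0.
  rewrite coefM big1 // => j _; rewrite Pn ?mulr0 //.
  by apply: leq_trans i_n; apply: leq_subr.
by exists (Alg (p \o polyC \o f : {rmorphism k -> T})), p.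
Qed.

(** The derivations [d i] give a first-order morphism [a -> h a + sum_i d_i(a) t_i z] into
    [M[z]/z^2]. Each further truncation is a square-zero thickening whose reduction is constant
    equal to [h], so the morphism lifts indefinitely. *)
Lemma hasse_schmidt_exists : exists c : nat -> A -> MA,
  [/\ hasse_schmidt c, forall a, c 0%N a = f (h a) & forall i, (i < e)%N -> c 1%N (x i) = t i].
Proof.
have /dependent_choice_fun[T /dependent_choice_fun[p pP]] := truncation.
have p_surj n b : exists P, b = p n P by have [] := pP n.
have p_ker n P : p n P = 0 <-> forall i, (i <= n)%N -> P`_i = 0 by have [] := pP n.
have p_alg n c : alg_map (T n) c = p n (f c)%:P by have [] := pP n.
have p_eq n P Q : p n P = p n Q -> forall i, (i <= n)%N -> P`_i = Q`_i.
  move=> /eqP; rewrite -subr_eq0 -rmorphB => /eqP /p_ker PQ i /PQ /eqP.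
  by rewrite coefB subr_eq0 => /eqP.
have /dependent_choice_fun[q qE] : forall n, exists q : alg_hom (T n.+1) (T n), forall P, q (p n.+1 P) = p n P.
  move=> n; have [|q qE] := kernel_factor (f := p n.+1) (g := p n) (p_surj n.+1).
    by move=> P /p_ker P0; apply/p_ker => i i_n; apply: P0; apply: leqW.
  suff qC r : q (alg_map (T n.+1) r) = alg_map (T n) r by exists (AlgHom qC).
  by rewrite !p_alg qE.
have /dependent_choice_fun[ev evE] : forall n, exists ev : alg_hom (T n) MA, forall P, ev (p n P) = P`_0.
  move=> n; have [|c0 c0E] := @rmorphism_of {poly M} M (fun P => P`_0).
    split=> [P Q|P Q|]; [exact: coefD | | by rewrite coef1].
    by rewrite coefM big_ord1.
  have [|ev evE] := kernel_factor (f := p n) (g := c0) (p_surj n).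
    by move=> P /p_ker P0; rewrite c0E P0.
  suff evC r : ev (alg_map (T n) r) = alg_map MA r.
    by exists (@AlgHom k (T n) MA ev evC) => P; rewrite /= evE c0E.
  by rewrite p_alg evE c0E coefC.
have step n (g : alg_hom A (T n.+1)) : (forall a, ev n.+1 (g a) = f (h a)) ->
    exists g' : alg_hom A (T n.+2), (forall a, ev n.+2 (g' a) = f (h a)) /\
      forall a, q n.+1 (g' a) = g a.
  move=> gh; have [||||g' g'E] := A_lifts (q := q n.+1) (e := ev n.+1) _ _ _ _ (g := g) gh.
  - by move=> b; have [P ->] := p_surj _ b; exists (p n.+2 P); rewrite qE.
  - move=> b b'; have [P ->] := p_surj _ b; have [P' ->] := p_surj _ b'.
    rewrite !qE => /p_ker P0 /p_ker P0'; rewrite -rmorphM; apply/p_ker => i i_n.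
    rewrite coefM big1 // => j _; have [/P0 ->|nj] := leqP j n.+1; first by rewrite mul0r.
    by rewrite P0' ?mulr0 //; lia.
  - by move=> b; exists (p n.+1 b%:P); rewrite evE coefC.
  - move=> b; have [P ->] := p_surj _ b; rewrite evE => P0; exists n.+2.
    rewrite -rmorphXn; apply/p_ker.
    have powP l : forall i, (i < l)%N -> (P ^+ l)`_i = 0.
      elim: l => // l IH i i_l; rewrite exprS coefM big1 // => -[[|j] jl] _ /=; first by rewrite P0 mul0r.
      by rewrite IH ?mulr0 //; lia.
    by move=> i i_n; apply: powP.
  exists g'; split=> // a; rewrite -gh -g'E.
  by have [P ->] := p_surj _ (g' a); rewrite qE !evE.
pose L a := \sum_(i < e) f (d i a) * t i.
have [g0 g0E] : exists g0 : alg_hom A (T 1%N), forall a, g0 a = p 1%N ((f (h a))%:P + (L a)%:P * 'X).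
  have X2 : p 1%N ('X * 'X) = 0.
    by apply/p_ker => i; rewrite coefMX; case: i => [|[|]] // _; rewrite coefX.
  have [|g0 g0E] := @rmorphism_of A (T 1%N) (fun a => p 1%N ((f (h a))%:P + (L a)%:P * 'X)).
    split=> [a b|a b|].
    - rewrite -rmorphD; congr (p 1%N _); have -> : L (a + b) = L a + L b.
        rewrite -big_split; apply: eq_bigr => i _ /=.
        by rewrite dD ?ltn_ord // rmorphD mulrDl.
      by rewrite !rmorphD; ring.
    - have -> : L (a * b) = f (h a) * L b + L a * f (h b).
        rewrite mulr_sumr mulr_suml -big_split; apply: eq_bigr => i _ /=.
        by rewrite dM ?ltn_ord // rmorphD !rmorphM; ring.
      rewrite -rmorphM.
      have -> : ((f (h a))%:P + (L a)%:P * 'X) * ((f (h b))%:P + (L b)%:P * 'X) =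
          ((f (h (a * b)))%:P + (f (h a) * L b + L a * f (h b))%:P * 'X) +
          (L a * L b)%:P * ('X * 'X).
        by rewrite !rmorphM !rmorphD !rmorphM; ring.
      by rewrite [RHS]rmorphD [X in _ = _ + X]rmorphM X2 mulr0 addr0.
    - rewrite rmorph1 rmorph1 /L big1 ?mul0r ?addr0 ?rmorph1 // => i _.
      by rewrite -(rmorph1 (alg_map A)) dk ?ltn_ord // rmorph0 mul0r.
  suff g0C r : g0 (alg_map A r) = alg_map (T 1%N) r by exists (AlgHom g0C).
  rewrite g0E p_alg h_k /L big1 ?mul0r ?addr0 // => i _.
  by rewrite dk ?ltn_ord // rmorph0 mul0r.
have g0h a : ev 1%N (g0 a) = f (h a) by rewrite g0E evE coefD coefC coefMX addr0.
(* The index is shifted: [T n] is [M[z]/z^(n+1)], and the lifting starts from the first-order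
   morphism into [T 1]. *)
pose St n := {g : alg_hom A (T n.+1) | forall a, ev n.+1 (g a) = f (h a)}.
pose next n (s : St n) : St n.+1 :=
  exist _ (sval (cid (step n _ (svalP s)))) (proj1 (svalP (cid (step n _ (svalP s))))).
pose st : forall n, St n := nat_rect St (exist _ g0 g0h) next.
pose g n := sval (st n).
have g_next n a : q n.+1 (g n.+1 a) = g n a.
  exact: (proj2 (svalP (cid (step n _ (svalP (st n)))))).
have /choice[rep repE] : forall n, exists r : A -> {poly M}, forall a, p n.+1 (r a) = g n a.
  move=> n; have /choice[r rE] := fun a => p_surj n.+1 (g n a).
  by exists r => a; rewrite -rE.
have down n P a : p n.+2 P = g n.+1 a -> p n.+1 P = g n a.
  by move=> PE; rewrite -qE PE g_next.
have coef_rep n l P a i : p n.+1 P = g n a -> (l <= n)%N -> (i <= l.+1)%N -> P`_i = (rep l a)`_i.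
  elim: n => [|n IH] PE ln il.
    by move: ln; rewrite leqn0 => /eqP l0; subst l; apply: (p_eq 1%N) => //; rewrite repE.
  move: ln; rewrite leq_eqVlt => /predU1P[lE|ln]; last by apply: IH => //; apply: down.
  by subst l; apply: (p_eq n.+2) => //; rewrite repE.
exists (fun n a => (rep n a)`_n); split.
- split=> [n a b|n a b|n s a].
  + rewrite -coefB; symmetry; apply: (coef_rep n n) => //.
    by rewrite !rmorphB !repE.
  + have <- : (rep n a * rep n b)`_n = (rep n (a * b))`_n.
      by apply: (coef_rep n n) => //; rewrite !rmorphM !repE.
    rewrite coefM; apply: eq_bigr => i _; congr (_ * _).
      by apply: (coef_rep n) => //; rewrite ?repE // -ltnS.
    by apply: (coef_rep n) => //; rewrite ?repE // leq_subr.
  + have <- : ((f s)%:P * rep n a)`_n = (rep n (alg_map A s * a))`_n.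
      by apply: (coef_rep n n) => //; rewrite [p _ _]rmorphM [g n _]rmorphM repE -p_alg alg_hom_comm.
    by rewrite coefCM.
- by move=> a; rewrite -(g0h a) -[g0 a](repE 0%N a) evE.
- move=> i ie.
  rewrite (coef_rep 1%N 0%N (rep 1%N (x i)) (x i) 1%N) ?repE //.
  have -> : (rep 0%N (x i))`_1 = ((f (h (x i)))%:P + (L (x i))%:P * 'X)`_1.
    by apply: (p_eq 1%N) => //; rewrite repE -g0E.
  rewrite coefD coefC coefMX coefC /= add0r /L (bigD1 (Ordinal ie)) //= dx // eqxx rmorph1 mul1r.
  rewrite big1 ?addr0 // => j; rewrite -val_eqE /= => /negPf ji.
  by rewrite dx ?ltn_ord // ji rmorph0 mul0r.
Qed.

End Lifting.

Section Kernel.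
Variables (M : comNzRingType) (f : {rmorphism k -> M}) (t : nat -> M) (e : nat) (x : nat -> A).
Let MA : algebra k := Alg (f : {rmorphism k -> (M : comPzRingType)}).
Variables (ev : {rmorphism M -> A}) (c : nat -> A -> MA).
Hypothesis ev_k : forall s, ev (f s) = alg_map A s.
Hypothesis ev_t : forall i, (i < e)%N -> ev (t i) = x i.
Hypothesis hs : hasse_schmidt c.
Hypothesis c0E : forall a, c 0%N a = f (h a).
Hypothesis c1E : forall i, (i < e)%N -> c 1%N (x i) = t i.
Hypothesis x_span : cotangent_span e x.

(* Modulo the next power of the maximal ideal, [a] is the value at the [x i] of a
   form [G] of degree [n], and [c n a] recovers [G]. *)
Let leading_form n a : pow n a -> (forall i, (i < n)%N -> c i a = 0) /\
  exists G : M, [/\ pow n.+1 (a - ev G), c n (ev G) = G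
    & forall i, (i < n)%N -> c i (ev G) = 0].
Proof.
elim: n a => [|n IH] a.
  move=> _; split=> //; exists (f (h a)); rewrite ev_k c0E h_k; split=> //.
  by apply: ideal_power1; apply: split_point.
pose P a := [/\ pow n.+1 a, forall i, (i < n.+1)%N -> c i a = 0
  & exists G : M, [/\ pow n.+2 (a - ev G), c n.+1 (ev G) = G
    & forall i, (i < n.+1)%N -> c i (ev G) = 0]].
move=> an; suff: P a by case.
apply: (ideal_gen_min an); first split.
- split; first exact: ideal0 (id_pow _).
    by move=> i _; apply: hs0.
  exists 0; rewrite rmorph0 subrr (hs0 hs); split=> //; first exact: ideal0 (id_pow _).
  by move=> i _; apply: hs0.
- move=> y z [yn y0 [G [yG GE G0]]] [zn z0 [G' [zG G'E G'0]]]; split.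
  + by apply: idealD => //; apply: id_pow.
  + by move=> i i_n; rewrite (hsD hs) y0 // z0 // addr0.
  + exists (G + G'); rewrite rmorphD (hsD hs) GE G'E opprD addrACA; split=> //.
      by apply: idealD => //; apply: id_pow.
    by move=> i i_n; rewrite (hsD hs) G0 // G'0 // addr0.
- move=> s y [yn y0 [G [yG GE G0]]]; split.
  + by apply: idealMl => //; apply: id_pow.
  + have low0 i : (i < 0)%N -> c i s = 0 by [].
    by have [] := hs_lowM hs low0 y0.
  + exists (f (h s) * G); rewrite rmorphM ev_k; split.
    * have -> : s * y - alg_map A (h s) * ev G =
        alg_map A (h s) * (y - ev G) + (s - alg_map A (h s)) * y by ring.
      apply: idealD; first exact: id_pow; first by apply: idealMl => //; apply: id_pow.
      by apply: (@ideal_powerM _ _ 1 n.+1) => //; apply: ideal_power1; apply: split_point.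
    * by rewrite (hsZ hs) GE.
    * by move=> i i_n; rewrite (hsZ hs) G0 // mulr0.
- move=> _ [a1 [b [ma1 bn ->]]]; have [b0 [G [bG GE G0]]] := IH b bn.
  have low1 y : m y -> forall i, (i < 1)%N -> c i y = 0.
    by move=> my [|//] _; rewrite c0E my rmorph0.
  split.
  + by apply: (@ideal_powerM _ _ 1 n) => //; apply: ideal_power1.
  + by have [] := hs_lowM hs (low1 _ ma1) b0.
  have [l a1l] := proj2 x_span a1 ma1.
  pose X := \sum_(i < e) alg_map A (l i) * x i.
  pose X' := \sum_(i < e) f (l i) * t i.
  have evX : ev X' = X.
    by rewrite rmorph_sum; apply: eq_bigr => i _; rewrite rmorphM ev_k ev_t.
  have mX : m X.
    rewrite /m rmorph_sum big1 // => i _; rewrite rmorphM (proj1 x_span) ?mulr0 //.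
  have cX : c 1%N X = X'.
    rewrite /X /X'; elim/big_rec2: _ => [|i y z _ <-]; first exact: (hs0 hs).
    by rewrite (hsD hs) (hsZ hs) c1E.
  have [low lead] := hs_lowM hs (low1 _ mX) G0.
  exists (X' * G); rewrite rmorphM evX; split=> //.
    have -> : a1 * b - X * ev G = (a1 - X) * b + X * (b - ev G) by ring.
    apply: idealD; first exact: id_pow.
      by apply: (@ideal_powerM _ _ 2 n).
    by apply: (@ideal_powerM _ _ 1 n.+1) => //; apply: ideal_power1.
  by have := lead; rewrite add1n cX GE.
Qed.

(** If [a] lies in m^n, its form of degree [n] is [c n a = 0], so [a] lies in m^(n+1). Krull's
    theorem concludes. *)
Lemma hasse_schmidt_kernel a : (forall n, c n a = 0) -> exists s, h s = 1 /\ s * a = 0.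
Proof.
move=> a0; apply: (krull_intersection noethA) => n.
suff : pow n a by [].
elim: n => [//|n IH]; have [_ [G [aG GE _]]] := leading_form IH.
have [/(_ n (ltnSn n)) aG0 _] := leading_form aG.
have G0 : G = 0.
  by have := hsB hs n a (a - ev G); rewrite aG0 a0 subr0 subKr GE.
by move: aG; rewrite G0 rmorph0 subr0.
Qed.

End Kernel.

(* The zero set [Q] of a Hasse-Schmidt derivation at a smooth point is the
   kernel of the map to the completed local ring, a domain. *)
Lemma smooth_point_grading : exists (Q : A -> Prop) G mulG (w : G -> A -> Prop) r,
  [/\ grading Q mulG w r, is_prime Q, forall a, Q a -> h a = 0
    & forall a, Q a -> exists s, h s = 1 /\ s * a = 0].
Proof.
have [e [x [span free]]] := cotangent_basis.
have [d dP] := tangent_coordinates span free.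
have [M [f [t [G [mulG [w [r [gr ev_ex]]]]]]]] := free_algebra k e.
have A1 : (1 : A) <> 0.
  by move=> A1; have /eqP := rmorph1 h; rewrite A1 rmorph0 eq_sym oner_eq0.
have [ev [ev_k ev_t]] := ev_ex A x A1.
have [||||c [hs c0E c1E]] := @hasse_schmidt_exists M f t e x d.
- by move=> i /dP[].
- by move=> i /dP[].
- by move=> i /dP[].
- by move=> i j /dP[_ _ _]; apply.
have gr' := hs_grading hs gr.
exists (fun a => forall n, c n a = 0); do 4 eexists; split; first exact: gr'.
- split.
  + split=> [n|a b a0 b0 n|a b b0 n].
    * exact: hs0.
    * by rewrite (hsD hs) a0 b0 addr0.
    * by rewrite (hsM hs) big1 // => i _; rewrite b0 mulr0.
  + by move=> /(_ 0%N); rewrite c0E !rmorph1 => /eqP; rewrite oner_eq0.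
  + move=> a b ab; apply: contrapT => /not_orP[/(grading_lead gr')[g [wg rg]] /(grading_lead gr')[g' [wg' rg']]].
    have [_] := gradingM gr' wg wg'.
    have [_ ->] := grading0 gr' ((g.1 + g'.1)%N, mulG g.2 g'.2) ab.
    by move/esym/eqP; rewrite mulf_eq0 => /orP[/eqP|/eqP].
- move=> a /(_ 0%N); rewrite c0E => fa; apply: (@field_inj k M f).
    by apply/eqP; apply: oner_neq0.
  by rewrite fa rmorph0.
- by move=> a; apply: (hasse_schmidt_kernel ev_k ev_t hs c0E c1E span).
Qed.

End RationalPoint.

(** Applied to the grading of [smooth_point_grading], this is the [k]-valued place of the function
    field of the component. *)
Lemma grading_valuation (k : fieldType) (A : algebra k) (Q : A -> Prop) (G : Type) mulG
    (w : G -> A -> Prop) r (kap : fieldType) (f : {rmorphism A -> kap}) :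
  grading Q mulG w r -> (forall a, f a = 0 <-> Q a) ->
  (forall c, exists a s, f s <> 0 /\ c = f a / f s) ->
  exists (Ov : algebra k) (i : {rmorphism Ov -> kap}) (res : {rmorphism Ov -> k}),
    [/\ valuation_ring i res, forall c, i (alg_map Ov c) = f (alg_map A c)
      & forall c, res (alg_map Ov c) = c].
Proof.
move=> gr fQ f_frac.
have [|||||Ov [i [res [val vi iv]]]] := graded_valuation (w := w) (r := r) (mulG := mulG) f_frac.
- by move=> g a /fQ; apply: (grading0 gr).
- exact: (gradingB gr).
- exact: (gradingM gr).
- by move=> a a0; apply: (grading_lead gr) => /fQ.
- exact: (grading_total gr).
have const c : graded_value f w r (f (alg_map A c)) c.
  have [|g [wg rg]] := grading_lead gr (a := 1).
    by move/fQ => /eqP; rewrite rmorph1 oner_eq0.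
  have [wc rc] := gradingZ gr c wg; exists g, (alg_map A c * 1), 1; split=> //.
    by rewrite mulr1 rmorph1 divr1.
  by rewrite rc mulfK //; apply/eqP.
have [i_inj _ _] := val.
have [|s sE] := lift_hom (f := f \o alg_map A) i_inj.
  by move=> c; apply: iv (const c).
exists (Alg s), i, res; split=> // c /=.
apply: (graded_value_inj (iota := f) (w := w) (r := r) (mulG := mulG)) (const c).
- by move=> g a /fQ; apply: (grading0 gr).
- exact: (gradingB gr).
- exact: (gradingM gr).
- by have := vi (s c); rewrite sE.
Qed.

(** * The place of a principal localization *)

Section PrincipalLocalization.
Variables (D : comPzRingType) (P : D -> Prop) (p0 : D).
Hypothesis domD : is_domain D.
Hypothesis noethD : noetherian D.
Hypothesis primeP : is_prime P.
Hypotheses (Pp0 : P p0) (p0_neq0 : p0 <> 0).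
Hypothesis P_principal : forall a, P a -> exists s b, ~ P s /\ s * a = p0 * b.

Let idP : is_ideal P. Proof. by case: primeP. Qed.
Let PM s s' : ~ P s -> ~ P s' -> ~ P (s * s').
Proof. by case: primeP => _ _ H s0 s0' /H[]. Qed.
Let neq0 s : ~ P s -> s <> 0.
Proof. by move=> Ps s0; apply: Ps; rewrite s0; apply: ideal0. Qed.
Let cancel (a x y : D) : a <> 0 -> a * x = a * y -> x = y.
Proof.
move=> a0 /eqP; rewrite -subr_eq0 -mulrBr => /eqP /(proj2 domD)[//|/eqP].
by rewrite subr_eq0 => /eqP.
Qed.
(** The local ring at [P] is a noetherian domain with maximal ideal generated by [p0], so
    divisibility by powers of [p0] must stop. *)
Let order_exists d : d <> 0 -> exists n s u, [/\ ~ P s, ~ P u & s * d = p0 ^+ n * u].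
Proof.
move=> d0; apply: contrapT => no.
have div n : exists s u, ~ P s /\ s * d = p0 ^+ n * u.
  elim: n => [|n [s [u [Ps sd]]]].
    by exists 1, d; rewrite expr0; split=> //; case: primeP.
  have [|s' [b [Ps' s'u]]] := P_principal (a := u).
    by apply: contrapT => Pu; apply: no; exists n, s, u.
  exists (s' * s), b; split; first exact: PM.
  by rewrite -mulrA sd mulrCA s'u exprS; ring.
(* [J n] is the colon ideal [d : p0^n] in the local ring. Once the chain is stable, [d = p0^(n+1) u]
   puts [u p0^n] in the ideal of [d], and cancelling [d] makes [p0] a unit. *)
pose J n y := exists s z, ~ P s /\ s * (y * p0 ^+ n) = d * z.
have [||n nJ] := @noetherian_acc D J noethD.
- move=> n; split.
  + by exists 1, 0; rewrite mul0r !mulr0; split=> //; case: primeP.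
  + move=> y y' [s [z [Ps sy]]] [s' [z' [Ps' sy']]]; exists (s * s'), (s' * z + s * z').
    split; first exact: PM.
    by rewrite mulrDl mulrDr mulrDr (mulrCA d s') -sy (mulrCA d s) -sy'; ring.
  + move=> a y [s [z [Ps sy]]]; exists s, (a * z); split=> //.
    by rewrite (mulrCA d a) -sy; ring.
- move=> n y [s [z [Ps sy]]]; exists s, (p0 * z); split=> //.
  by rewrite exprS (mulrCA d p0) -sy; ring.
have [s [u [Ps sd]]] := div n.+1.
have [|s' [z [Ps' s'u]]] := nJ n.+1 u.
  by exists 1, s; rewrite mul1r mulrC -sd mulrC; split=> //; case: primeP.
apply: (PM Ps Ps'); suff -> : s * s' = p0 * z by apply: idealMr.
apply: (cancel d0); rewrite (mulrCA d p0) -s'u.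
have -> : d * (s * s') = s' * (s * d) by ring.
by rewrite sd exprS; ring.
Qed.

Variables (E kap : fieldType) (f : {rmorphism D -> E}) (g : {rmorphism D -> kap}).
Hypothesis f_inj : injective f.
Hypothesis f_frac : forall c, exists a s, f s <> 0 /\ c = f a / f s.
Hypothesis gP : forall a, g a = 0 <-> P a.

Let f0 a : a <> 0 -> f a != 0.
Proof. by move=> a0; apply/eqP; rewrite -(rmorph0 f) => /f_inj. Qed.
Let g0 a : ~ P a -> g a != 0.
Proof. by move=> Pa; apply/eqP => /gP. Qed.
Let pE := f p0.
Let pE0 : pE != 0. Proof. exact: f0. Qed.

Let order (x : E) (n : int) := exists a b, [/\ ~ P a, ~ P b & x = pE ^ n * (f a / f b)].

Let order_ex (x : E) : x != 0 -> exists n, order x n.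
Proof.
have [d [d' [/eqP fd' ->]]] := f_frac x => x0.
have d0 : d <> 0 by move=> d0; move: x0; rewrite d0 rmorph0 mul0r eqxx.
have d'0 : d' <> 0 by move=> d'0; move: fd'; rewrite d'0 rmorph0 eqxx.
have [n [s [u [Ps Pu sd]]]] := order_exists d0.
have [n' [s' [u' [Ps' Pu' s'd']]]] := order_exists d'0.
exists (n%:Z - n'%:Z), (u * s'), (u' * s); split; try exact: PM.
have fs := f0 (neq0 Ps); have fs' := f0 (neq0 Ps'); have fu' := f0 (neq0 Pu').
have pn' : pE ^+ n' != 0 by rewrite expf_neq0.
have E1 : f d = pE ^+ n * f u / f s.
  by apply: (mulIf fs); rewrite divfK // mulrC -rmorphM sd rmorphM rmorphXn.
have E2 : f d' = pE ^+ n' * f u' / f s'.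
  by apply: (mulIf fs'); rewrite divfK // mulrC -rmorphM s'd' rmorphM rmorphXn.
rewrite E1 E2 expfzDr // -exprnN -exprnP !rmorphM.
by field; rewrite fs fs' fu' pn'.
Qed.

Let order_neq0 x n : order x n -> x != 0.
Proof.
move=> [a [b [Pa Pb ->]]].
by rewrite !mulf_neq0 ?invr_eq0 ?expfz_neq0 ?f0 //; apply: neq0.
Qed.

Let orderM x y n m : order x n -> order y m -> order (x * y) (n + m).
Proof.
move=> [a [b [Pa Pb ->]]] [c [d [Pc Pd ->]]]; exists (a * c), (b * d).
split; try exact: PM.
by rewrite expfzDr // !rmorphM -mulf_div; ring.
Qed.

Let integral x := exists a b, ~ P b /\ x = f a / f b.

Let order_integral x n : order x n -> (0 <= n <-> integral x).
Proof.
move=> [a [b [Pa Pb xE]]]; split.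
  case: n xE => // n xE _; exists (p0 ^+ n * a), b; split=> //.
  by rewrite xE rmorphM rmorphXn mulrA.
move=> [c [d [Pd xE']]]; case: n xE => // n xE; exfalso.
apply: (PM Pa Pd); suff -> : a * d = p0 * (p0 ^+ n * (c * b)) by apply: idealMr.
have fb := f0 (neq0 Pb); have fd := f0 (neq0 Pd).
apply: f_inj; rewrite mulrA -exprS rmorphM [RHS]rmorphM rmorphXn.
have pn : pE ^+ n.+1 != 0 by rewrite expf_neq0.
have : f c / f d = (pE ^+ n.+1)^-1 * (f a / f b) by rewrite -xE' xE NegzE -exprnN.
move=> /(congr1 (fun z => z * (f d * f b * pE ^+ n.+1))).
have -> : f c / f d * (f d * f b * pE ^+ n.+1) = pE ^+ n.+1 * (f c * f b) by field.
have -> : (pE ^+ n.+1)^-1 * (f a / f b) * (f d * f b * pE ^+ n.+1) = f a * f d.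
  by field; rewrite fb pn.
by rewrite [f (c * b)]rmorphM.
Qed.

Let order_uniq x n m : order x n -> order x m -> n = m.
Proof.
have orderV y l : order y l -> order y^-1 (- l).
  move=> [a [b [Pa Pb ->]]]; exists b, a; split=> //.
  by rewrite !invfM invrK -invr_expz [_^-1 * f b]mulrC.
have le u l : order x u -> order x l -> u <= l.
  move=> xu xl; have := orderM xl (orderV _ _ xu).
  rewrite mulfV ?(order_neq0 xu) // => H; rewrite -subr_ge0; apply/(order_integral H).
  exists 1, 1; rewrite rmorph1 divr1; split=> //; by case: primeP.
by move=> xn xm; apply/eqP; rewrite eq_le !le.
Qed.

Lemma discrete_place : exists (v : E -> int) (rho : E -> kap),
  [/\ place v rho, v (f p0) = 1, forall d, f d = 0 \/ 0 <= v (f d)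
    & forall d, rho (f d) = g d].
Proof.
have /choice[v vP] : forall x : E, exists n, x != 0 -> order x n.
  by move=> x; have [->|/order_ex[n xn]] := eqVneq x 0; [exists 0 | exists n].
have vE x n : order x n -> v x = n.
  by move=> xn; apply: (order_uniq _ xn); apply/vP/(order_neq0 xn).
have int_v x : x = 0 \/ 0 <= v x <-> integral x.
  have [->|x0] := eqVneq x 0.
    split; last by left.
    by move=> _; exists 0, 1; rewrite rmorph0 mul0r; split=> //; case: primeP.
  split=> [[/eqP|]|]; first by rewrite (negPf x0).
    by move/(order_integral (vP x x0)).
  by move=> /(order_integral (vP x x0)); right.
have rho_wd a b c d : ~ P b -> ~ P d -> f a / f b = f c / f d -> g a / g b = g c / g d.
  move=> Pb Pd /eqP; rewrite eqr_div ?f0 //; try exact: neq0.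
  rewrite -!rmorphM => /eqP /f_inj ad; apply/eqP.
  by rewrite eqr_div ?g0 // -!rmorphM ad.
have /choice[rho rhoP] : forall x, exists c, forall a b, ~ P b -> x = f a / f b -> c = g a / g b.
  move=> x; have [[a [b [Pb ->]]]|no] := EM (integral x).
    by exists (g a / g b) => c d Pd; apply: rho_wd.
  by exists 0 => a b Pb xE; case: no; exists a, b.
have P1 : ~ P 1 by case: primeP.
exists v, rho; split; first split.
- by move=> a b a0 b0; apply: vE; apply: orderM; apply: vP.
- move=> a b n.
  have scale y : y = 0 \/ n <= v y <-> integral (y / pE ^ n).
    rewrite -int_v; have [->|y0] := eqVneq y 0; first by rewrite mul0r; split; left.
    have -> : v (y / pE ^ n) = v y - n.
      apply: vE; apply: orderM; first exact: vP.
      by exists 1, 1; rewrite rmorph1 divr1 mulr1 -invr_expz.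
    have yn0 : y / pE ^ n != 0 by rewrite mulf_neq0 // invr_eq0 expfz_neq0.
    by rewrite subr_ge0; split=> -[/eqP|]; rewrite ?(negPf y0) ?(negPf yn0) //; right.
  rewrite !scale mulrDl => -[c [s [Ps ->]]] [d [t [Pt ->]]].
  exists (c * t + d * s), (s * t); split; first exact: PM.
  by rewrite addf_div ?f0 //; [rewrite rmorphD !rmorphM | exact: neq0 | exact: neq0].
- by rewrite (rhoP 1 1 1) ?rmorph1 ?divr1.
- move=> x y /int_v[a [b [Pb xE]]] /int_v[c [d [Pd yE]]].
  rewrite (rhoP x a b) // (rhoP y c d) // (rhoP (x + y) (a * d + c * b) (b * d)).
  + by rewrite rmorphD !rmorphM addf_div ?g0.
  + exact: PM.
  + by rewrite xE yE addf_div ?f0 ?rmorphD ?rmorphM //; apply: neq0.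
- move=> x y /int_v[a [b [Pb xE]]] /int_v[c [d [Pd yE]]].
  rewrite (rhoP x a b) // (rhoP y c d) // (rhoP (x * y) (a * c) (b * d)).
  + by rewrite !rmorphM mulf_div.
  + exact: PM.
  + by rewrite xE yE mulf_div !rmorphM.
- move=> x /int_v[a [b [Pb xE]]]; rewrite (rhoP x a b) //.
  have fb := f0 (neq0 Pb); split.
    move/eqP; rewrite mulf_eq0 invr_eq0 (negPf (g0 Pb)) orbF => /eqP /gP Pa.
    have [x0|x0] := eqVneq x 0; [by left | right].
    have [s [c [Ps sa]]] := P_principal Pa; have fs := f0 (neq0 Ps).
    have xE' : x = pE * (f c / f (b * s)).
      have fa : f a = pE * f c / f s.
        by apply: (mulIf fs); rewrite divfK // mulrC -rmorphM sa rmorphM.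
      by rewrite xE fa rmorphM; field; rewrite fb fs.
    have c0 : f c / f (b * s) != 0 by apply: contra_neq x0 => c0; rewrite xE' c0 mulr0.
    have : 0 <= v (f c / f (b * s)).
      have [|/eqP|//] := proj2 (int_v (f c / f (b * s))); last by rewrite (negPf c0).
      by exists c, (b * s); split=> //; apply: PM.
    have -> : v x = 1 + v (f c / f (b * s)).
      apply: vE; rewrite xE'; apply: orderM (vP _ c0); exists 1, 1.
      by rewrite rmorph1 divr1 mulr1 expr1z.
    by lia.
  have [x0 _|x0 [/eqP|]] := eqVneq x 0; last 1 first.
  + move=> vx; have [c [d [Pc Pd xE']]] := vP x x0.
    case vn: (v x) vx xE' => [[|n]|] // _ xE'.
    rewrite (rho_wd a b (p0 ^+ n.+1 * c) d) //.
      by rewrite rmorphM rmorphXn (proj2 (gP p0)) // expr0n !mul0r.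
    by rewrite -xE xE' rmorphM rmorphXn mulrA.
  + suff -> : a = 0 by rewrite rmorph0 mul0r.
    by apply: f_inj; apply: (mulIf (invr_neq0 fb)); rewrite -xE x0 rmorph0 mul0r.
  + by rewrite (negPf x0).
- apply: vE; exists 1, 1; by rewrite rmorph1 divr1 mulr1 expr1z.
- by move=> d; apply/int_v; exists d, 1; rewrite rmorph1 divr1.
- by move=> d; rewrite (rhoP _ d 1) ?rmorph1 ?divr1.
Qed.

End PrincipalLocalization.

Lemma place_ring (E kap : fieldType) (v : E -> int) (rho : E -> kap) : place v rho ->
  exists (Ov : comPzRingType) (i : {rmorphism Ov -> E}) (res : {rmorphism Ov -> kap}),
  [/\ valuation_ring i res, forall o, place_value v rho (i o) (res o)
    & forall z, z = 0 \/ 0 <= v z -> exists o, i o = z].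
Proof.
move=> pl; pose O z := z = 0 \/ 0 <= v z.
have O1 : O 1 by right; rewrite (place_v1 pl).
have ON z : O z -> O (- z).
  by case=> [->|]; [left; rewrite oppr0 | right; rewrite (placeN pl)].
have OB x y : O x -> O y -> O (x - y).
  by move=> Ox /ON Oy; apply: (placeD pl).
have OM x y : O x -> O y -> O (x * y).
  case: (eqVneq x 0) => [->|x0]; first by left; rewrite mul0r.
  case: (eqVneq y 0) => [->|y0]; first by left; rewrite mulr0.
  case=> [/eqP|vx]; first by rewrite (negPf x0).
  case=> [/eqP|vy]; first by rewrite (negPf y0).
  by right; rewrite (placeM pl) // addr_ge0.
have [S [i [i_inj iO]]] := subring_exists O1 OB OM.
have Oi o : O (i o) by apply/iO; exists o.
have [|res resE] := @rmorphism_of S kap (fun o => rho (i o)).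
  split=> [x y|x y|]; last by rewrite rmorph1 (place1 pl).
    by rewrite rmorphD; apply: (place_resD pl); apply: Oi.
  by rewrite rmorphM; apply: (place_resM pl); apply: Oi.
exists S, i, res; split; [split=> // [y|o]| |].
- have [->|y0] := eqVneq y 0; first by left; exists 0; rewrite rmorph0.
  have [vy|vy] := leP 0 (v y); first by left; apply/iO; right.
  right; have [|o oE] := proj1 (iO y^-1); first by right; rewrite (placeV pl) // oppr_ge0 ltW.
  by exists o; rewrite oE mulVf.
- move=> /eqP; rewrite resE => ro.
  have io0 : i o != 0 by apply: contra_neq ro => ->; rewrite (place_rho0 pl).
  have vo : v (i o) = 0.
    case: (Oi o) => [/eqP|]; first by rewrite (negPf io0).
    rewrite le_eqVlt => /predU1P[//|vo].
    by move: ro; rewrite (proj2 (place_res0 pl (Oi o))) ?eqxx //; right.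
  have [|o' o'E] := proj1 (iO (i o)^-1); first by right; rewrite (placeV pl) // vo oppr0.
  by exists o'; apply: i_inj; rewrite rmorphM o'E mulfV // rmorph1.
- by move=> o; split; [apply: Oi | rewrite resE].
- by move=> z Oz; apply/iO.
Qed.

Lemma place_surjective (E kap : fieldType) (v : E -> int) (rho : E -> kap) p : place v rho ->
  p != 0 -> v p = 1 -> forall n, exists2 a, a != 0 & v a = n.
Proof.
move=> pl p0 vp; have vX n : v (p ^+ n) = n.
  elim: n => [|n IH]; first by rewrite expr0 (place_v1 pl).
  by rewrite exprS (placeM pl) ?expf_neq0 // IH vp; lia.
case=> n; first by exists (p ^+ n); rewrite ?expf_neq0 ?vX.
exists (p ^+ n.+1)^-1; first by rewrite invr_eq0 expf_neq0.
by rewrite (placeV pl) ?expf_neq0 // vX NegzE.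
Qed.

Section SmoothPlace.
Variables (R : comPzRingType) (k : fieldType) (pi : {rmorphism R -> k}) (varpi : R).
Hypothesis pi_surj : forall y, exists r, y = pi r.
Hypothesis pi_ker : forall r, pi r = 0 <-> exists s, r = varpi * s.
Variables (X : functor R) (V W : subfunctor (base_change pi X)).
Hypothesis X_proper : proper_scheme X.
Hypotheses (V_closed : closed_sub V) (W_closed : closed_sub W).
Hypothesis T_empty : forall p : rational_point (base_change pi X),
  lies_in V p -> lies_in W p -> False.
Variables (D : algebra R) (h : alg_hom D (restrict pi (alg_self k))).
Hypothesis domD : is_domain D.
Hypothesis noethD : noetherian D.
Hypothesis varpi_neq0 : alg_map D varpi <> 0.
Hypothesis D_lifts : smooth_lifting pi h.
Variables (E : fieldType) (f : {rmorphism D -> E}).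
Hypothesis f_inj : injective f.
Hypothesis f_frac : forall c, exists a s, f s <> 0 /\ c = f a / f s.

Let piD : D := alg_map D varpi.

Let hpi r : h (alg_map D r) = pi r.
Proof. exact: (alg_hom_comm h). Qed.

Let reduction : exists (A : algebra k) (q : alg_hom D (restrict pi A)) (hA : {rmorphism A -> k}),
  [/\ forall b, exists a, b = q a, forall a, q a = 0 <-> exists b, a = piD * b,
      forall a, hA (q a) = h a, forall c, hA (alg_map A c) = c & lifts_at hA].
Proof.
have [|A0 [q [q_surj q_ker _]]] := @ideal_quotient D (fun a => exists b, a = piD * b).
  split=> [|_ _ [a ->] [b ->]|c _ [a ->]]; first by exists 0; rewrite mulr0.
    by exists (a + b); rewrite mulrDr.
  by exists (c * a); rewrite mulrCA.
have [|s sE] := kernel_factor (f := pi) (g := q \o alg_map D) pi_surj.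
  by move=> r /pi_ker[t ->]; apply/q_ker; exists (alg_map D t); rewrite rmorphM.
have pi0 : pi varpi = 0 by apply/pi_ker; exists 1; rewrite mulr1.
have [|hA hAE] := kernel_factor (f := q) (g := h) q_surj.
  by move=> a /q_ker[b ->]; rewrite rmorphM hpi pi0; apply: mul0r.
pose A : algebra k := Alg s.
pose qR : alg_hom D (restrict pi A) := @AlgHom R D (restrict pi A) q (fun r => esym (sE r)).
have hAk c : hA (alg_map A c) = c.
  by have [r ->] := pi_surj c; rewrite /= sE hAE hpi.
exists A, qR, hA; split=> // B B' N q' e q'_surj q'_sq e_surj e_nil g gh.
have [||||b|g' g'E] := D_lifts (q := q') (e := e) _ _ _ _ (g := comp_hom (restrict_hom pi g) qR) => //.
  by rewrite [LHS]gh hAE.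
have [|g2 g2E] := kernel_factor (f := q) (g := g') q_surj.
  move=> a /q_ker[b ->]; rewrite rmorphM [g' piD](alg_hom_comm g' varpi) /=.
  by rewrite pi0 rmorph0 mul0r.
have g2C c : g2 (alg_map A c) = alg_map B c.
  have [r ->] := pi_surj c; rewrite /= sE g2E; exact: (alg_hom_comm g' r).
exists (@AlgHom k A B g2 g2C) => a; have [b ->] := q_surj a.
by rewrite [g2 _]g2E [LHS]g'E.
Qed.

(* The kernel of [D -> kap] is the generic point of the component of the special
   fibre through [h]; as [kap] has a [k]-valued place, T has no point over it. *)
Lemma smooth_place : exists (kap : fieldType) (kphi : {rmorphism k -> kap})
    (v : E -> int) (rho : E -> kap) (g : alg_hom D (restrict pi (Alg kphi))),
  [/\ place v rho, forall n, exists2 a, a != 0 & v a = n,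
      forall d, place_value v rho (f d) (g d),
      forall y : base_change pi X (Alg kphi), lies_in V y -> lies_in W y -> False
    & forall (Z : subfunctor (base_change pi X)) (x : X D), closed_sub Z ->
        lies_in Z (fmap g x : base_change pi X (Alg kphi)) ->
        lies_in Z (fmap h x : base_change pi X (alg_self k))].
Proof.
have [A [q [hA [q_surj q_ker hAq hAk A_lifts]]]] := reduction.
have noethA : noetherian A by apply: noetherian_image noethD.
have [Q [G [mulG [w [r [gr primeQ Qh Qkill]]]]]] := smooth_point_grading hAk noethA A_lifts.
have [kap [gA [gA0 gA_frac]]] := prime_residue_field primeQ.
pose kphi : {rmorphism k -> kap} := gA \o alg_map A.
pose g : alg_hom D (restrict pi (Alg kphi)) :=
  comp_hom (restrict_hom pi (@AlgHom k A (Alg kphi) gA (fun c => erefl))) q.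
pose P a := Q (q a).
have idQ : is_ideal Q by case: primeQ.
have primeP : is_prime P.
  case: primeQ => _ Q1 QM; split; first exact: ideal_preim.
    by rewrite /P rmorph1.
  by move=> x y; rewrite /P rmorphM; apply: QM.
have Ppi : P piD.
  by rewrite /P (proj2 (q_ker piD)); [apply: ideal0 | exists 1; rewrite mulr1].
(* An element of [Q] is killed by some [s] outside [Q], so [s a] is divisible by [piD] upstairs:
   [piD] generates the maximal ideal of the local ring at [P]. *)
have P_principal a : P a -> exists s b, ~ P s /\ s * a = piD * b.
  move=> /Qkill[s' [hs s'a]]; have [s sE] := q_surj s'.
  have [|b bE] := proj1 (q_ker (s * a)); first by rewrite rmorphM -sE.
  exists s, b; split=> // /Qh; rewrite -sE hs => /eqP; apply/negP; exact: oner_neq0.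
have gP a : g a = 0 <-> P a by apply: gA0.
have [v [rho [pl vpi f_int rho_f]]] := discrete_place domD noethD primeP Ppi varpi_neq0
  P_principal f_inj f_frac gP.
exists kap, kphi, v, rho, g; split=> //.
- apply: place_surjective pl _ vpi; apply/eqP => fpi; apply: varpi_neq0.
  by apply: f_inj; rewrite rmorph0.
- move=> y Vy Wy.
  (* By properness a [kap]-point of T extends over the [k]-valued place and reduces to a [k]-point
     of T. *)
  have [Ov [i [res [val iE resE]]]] := grading_valuation gr gA0 gA_frac.
  pose OR := restrict pi Ov.
  have fwd r' : (kphi \o pi) r' = (i \o alg_map OR) r' by rewrite /= iE.
  have [x' x'E] := valuative_criterion (Ov := OR) X_proper val (fmap (eq_hom fwd) y).
  pose iK : alg_hom Ov (Alg kphi) := @AlgHom k Ov (Alg kphi) i iE.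
  pose resK : alg_hom Ov (alg_self k) := @AlgHom k Ov (alg_self k) res resE.
  have yE : fmap (restrict_hom pi iK) x' = y.
    have bwd r' : (i \o alg_map OR) r' = (kphi \o pi) r' by rewrite -fwd.
    have := congr1 (fmap (eq_hom bwd)) x'E; rewrite !fmap_compE => E1.
    rewrite -[RHS](fmap_id (f := comp_hom (eq_hom bwd) (eq_hom fwd))) //.
    by rewrite -E1; apply: eq_fmap.
  have i_inj : injective i by case: val.
  have down (Z : subfunctor (base_change pi X)) : closed_sub Z -> lies_in Z y ->
      lies_in Z (fmap resK (x' : base_change pi X Ov)).
    move=> Z_closed Zy; apply: lies_in_fmap; apply: (closed_inj (f := iK)) => //.
    by rewrite /= yE.
  by apply: (T_empty (p := fmap resK (x' : base_change pi X Ov))); apply: down.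
- move=> Z x Z_closed Zx.
  (* [A/Q] embeds in [kap] and maps to [k]: it carries the specialization from the generic point of
     the component to [h]. *)
  have [S0 [j [j_surj j_ker _]]] := @ideal_quotient A Q idQ.
  have [|jk jkE] := kernel_factor (f := j) (g := gA) j_surj.
    by move=> a /j_ker /gA0.
  have [|jh jhE] := kernel_factor (f := j) (g := hA) j_surj.
    by move=> a /j_ker /Qh.
  pose S : algebra k := Alg (j \o alg_map A : {rmorphism k -> S0}).
  pose iS : alg_hom S (Alg kphi) := @AlgHom k S (Alg kphi) jk (fun c => jkE _).
  have hC c : jh (alg_map S c) = c by rewrite /= jhE hAk.
  pose hS : alg_hom S (alg_self k) := @AlgHom k S (alg_self k) jh hC.
  pose jD : alg_hom D (restrict pi S) := comp_hom
    (restrict_hom pi (@AlgHom k A S j (fun c => erefl))) q.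
  have Zj : lies_in Z (fmap jD x : base_change pi X S).
    apply: (closed_inj (f := iS)) => //.
      move=> a b; have [a' ->] := j_surj a; have [b' ->] := j_surj b.
      rewrite /= !jkE => /eqP; rewrite -subr_eq0 -rmorphB => /eqP /gA0 /j_ker.
      by rewrite rmorphB => /eqP; rewrite subr_eq0 => /eqP.
    suff -> : fmap iS (fmap jD x : base_change pi X S) = fmap g x by [].
    by rewrite /= (@fmap_compE R X); apply: (@eq_fmap R X) => a; apply: jkE.
  suff -> : (fmap h x : base_change pi X (alg_self k)) =
      fmap hS (fmap jD x : base_change pi X S) by apply: lies_in_fmap.
  rewrite /= (@fmap_compE R X); apply: (@eq_fmap R X) => a /=.
  by rewrite jhE hAq.
Qed.

End SmoothPlace.

(** * Points with different labels *)

Lemma dvr_structure (R : idomainType) (k : fieldType) (pi : {rmorphism R -> k}) :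
  is_dvr R -> is_residue_map pi ->
  [/\ exists2 varpi, varpi <> 0 & forall r, pi r = 0 <-> exists s, r = varpi * s,
      noetherian R
    & forall c : {fraction R}, exists a s : R, tofrac s <> 0 /\ c = tofrac a / tofrac s].
Proof.
move=> [v [[vM vD v_surj] vR]] [pi_surj pi_unit].
have t0 (r : R) : (tofrac r == 0) = (r == 0) by rewrite tofrac_eq0.
have tI (r s : R) : tofrac r = tofrac s -> r = s by move/eqP; rewrite tofrac_eq => /eqP.
have v1 : v 1 = 0.
  by have := vM 1 1 (oner_neq0 _) (oner_neq0 _); rewrite mulr1; move: (v 1) => z; lia.
have vV x : x != 0 -> v x^-1 = - v x.
  move=> x0; have := vM x x^-1 x0; rewrite invr_eq0 mulfV // v1 => /(_ x0).
  by move: (v x) (v x^-1) => a b; lia.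
have v_ge0 (r : R) : r != 0 -> 0 <= v (tofrac r).
  move=> r0; have [|/eqP|//] := proj1 (vR (tofrac r)); first by exists r.
  by rewrite t0 (negPf r0).
have dvdR (a b : R) : a != 0 -> b != 0 -> v (tofrac a) <= v (tofrac b) -> exists s, b = a * s.
  move=> a0 b0 ab; have [|s sE] := proj2 (vR (tofrac b / tofrac a)).
    by right; rewrite vM ?invr_eq0 ?t0 // vV ?t0 // subr_ge0.
  by exists s; apply: tI; rewrite tofracM -sE mulrC divfK // t0.
split.
- have [x [x0 vx]] := v_surj 1.
  have [varpi xE] : exists r : R, x = tofrac r by apply/vR; right; rewrite vx.
  rewrite {}xE in x0 vx; rewrite t0 in x0; exists varpi; first exact/eqP.
  move=> r; split=> [/pi_unit r_unit|[s ->]].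
    have [->|r0] := eqVneq r 0; first by exists 0; rewrite mulr0.
    apply: (dvdR varpi r) => //; rewrite vx; have := v_ge0 r r0.
    rewrite le_eqVlt => /predU1P[vr|]; last by rewrite -gtz0_ge1.
    case: r_unit; apply/unitrP.
    have [|s rs] := dvdR r 1 r0 (oner_neq0 _); first by rewrite tofrac1 v1 -vr.
    by exists s; rewrite mulrC -rs.
  apply/pi_unit; rewrite unitrM => /andP[/unitrP[s' [s'p _]] _].
  have s'0 : s' != 0 by apply: contra_eq_neq s'p => ->; rewrite mul0r eq_sym oner_neq0.
  have := vM (tofrac s') (tofrac varpi); rewrite !t0 -tofracM s'p tofrac1 v1 vx => /(_ s'0 x0).
  by have := v_ge0 _ s'0; lia.
- move=> I idI; have [[a Ia a0]|no] := EM (exists2 a, I a & a <> 0); last first.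
    exists [::]; split=> // b Ib; have [->|/eqP b0] := eqVneq b 0.
      exact: ideal0 (ideal_gen_ideal _).
    by case: no; exists b.
  have ex : exists n : nat, `[< exists b, [/\ I b, b != 0 & v (tofrac b) = n] >].
    exists `|v (tofrac a)|%N; apply/asboolP; exists a; split=> //; first exact/eqP.
    by rewrite gez0_abs //; apply: v_ge0; apply/eqP.
  case: (ex_minnP ex) => n /asboolP[b [Ib b0 vb]] n_min; exists [:: b]; split.
    by move=> x; rewrite inE => /eqP ->.
  move=> c Ic; have [->|c0] := eqVneq c 0; first exact: ideal0 (ideal_gen_ideal _).
  have [|s ->] := dvdR b c b0 c0.
    rewrite vb -(gez0_abs (v_ge0 _ c0)) lez_nat; apply: n_min; apply/asboolP.
    by exists c; split=> //; rewrite gez0_abs // v_ge0.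
  by apply: idealMr; [apply: ideal_gen_ideal | apply: ideal_gen_sub; rewrite inE].
- move=> c; have [->|c0] := eqVneq c 0.
    by exists 0, 1; rewrite tofrac0 tofrac1 mul0r; split=> //; apply/eqP; apply: oner_neq0.
  have [vc|vc] := leP 0 (v c).
    have [r ->] : exists r : R, c = tofrac r by apply/vR; right.
    by exists r, 1; rewrite tofrac1 divr1; split=> //; apply/eqP; apply: oner_neq0.
  have [r rE] : exists r : R, c^-1 = tofrac r by apply/vR; right; rewrite vV // oppr_ge0 ltW.
  exists 1, r; rewrite -rE tofrac1 div1r invrK; split=> //.
  by apply/eqP; rewrite invr_eq0.
Qed.

Lemma has_value_restrict (R K : comPzRingType) (tau : {rmorphism R -> K}) (X : functor R)
    (E : fieldType) (phi : {rmorphism K -> E}) (psi : {rmorphism R -> E})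
    (phi_psi : forall r, phi (tau r) = psi r)
    (F : fieldType) (iota : {rmorphism {poly E} -> F})
    (const_psi : forall r, const_map phi iota (tau r) = const_map psi iota r)
    (e : int) (x : base_change tau X (Alg (const_map phi iota)))
    (P : base_change tau X (Alg phi)) :
  has_value e x P ->
  has_value e
    (fmap (@AlgHom R (restrict tau (Alg (const_map phi iota))) (Alg (const_map psi iota))
       (idfun : {rmorphism F -> F}) const_psi) x)
    (fmap (@AlgHom R (restrict tau (Alg phi)) (Alg psi) (idfun : {rmorphism E -> E}) phi_psi) P).
Proof.
case=> A0 [i [ev [x0 [i_inj iv <- <-]]]].
exists (restrict tau A0).
exists (comp_hom (@AlgHom R (restrict tau (Alg (const_map phi iota))) (Alg (const_map psi iota))
  (idfun : {rmorphism F -> F}) const_psi) (restrict_hom tau i)).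
exists (comp_hom (@AlgHom R (restrict tau (Alg phi)) (Alg psi) (idfun : {rmorphism E -> E})
  phi_psi) (restrict_hom tau ev)), x0.
by split=> //; rewrite -fmap_compE.
Qed.

Lemma centre_unique (R : comPzRingType) (k kap : fieldType) (pi : {rmorphism R -> k})
    (kphi : {rmorphism k -> kap}) (X : functor R) (L : fieldType) (psi : {rmorphism R -> L})
    (val : L -> kap -> Prop) (x : X (Alg psi)) y y' :
  proper_scheme X -> (forall z c c', val z c -> val z c' -> c = c') ->
  @has_centre R k kap pi kphi X L psi val x y -> has_centre val x y' -> y = y'.
Proof.
move=> X_proper val_inj xy xy'; apply: (centre_compare X_proper val_inj val_inj xy xy').
have [Ov [i [res [x' [_ vi _ x'E _]]]]] := xy.
by exists Ov, i, x'; split=> // s; exists (res s).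
Qed.

Lemma tensor_finitely_generated (R : comPzRingType) (B C D : algebra R)
    (i : alg_hom B D) (j : alg_hom C D) : is_tensor i j ->
  finitely_generated B -> finitely_generated C -> finitely_generated D.
Proof.
move=> ten [n [x x_gen]] [m [y y_gen]].
exists (n + m)%N, (fun l => match split l with inl a => i (x a) | inr b => j (y b) end).
move=> S SR Sx SD SM.
have Si b : S (i b).
  apply: (x_gen (fun b => S (i b))) b => [r|a|a b Sa Sb|a b Sa Sb].
  - by rewrite alg_hom_comm.
  - by have := Sx (unsplit (inl a)); rewrite unsplitK.
  - by rewrite rmorphD; apply: SD.
  - by rewrite rmorphM; apply: SM.
have Sj b : S (j b).
  apply: (y_gen (fun b => S (j b))) b => [r|a|a b Sa Sb|a b Sa Sb].
  - by rewrite alg_hom_comm.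
  - by have := Sx (unsplit (inr a)); rewrite unsplitK.
  - by rewrite rmorphD; apply: SD.
  - by rewrite rmorphM; apply: SM.
move=> d; have [s ->] := tensor_span ten d.
elim: s => [|z s IH]; first by rewrite big_nil -(rmorph0 (alg_map D)).
by rewrite big_cons; apply: SD => //; apply: SM.
Qed.

Lemma tensor_lifting (R k : comPzRingType) (pi : {rmorphism R -> k}) (B C D : algebra R)
    (i : alg_hom B D) (j : alg_hom C D) (hB : B -> k) (hC : C -> k) (hD : D -> k) :
  is_tensor i j -> (forall b, hD (i b) = hB b) -> (forall c, hD (j c) = hC c) ->
  smooth_lifting pi hB -> smooth_lifting pi hC -> smooth_lifting pi hD.
Proof.
move=> ten hi hj liftB liftC A A' M q e q_surj q_sq e_surj e_nil g gh.
have [b|gB gBE] := liftB A A' M q e q_surj q_sq e_surj e_nil (comp_hom g i).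
  by rewrite -hi; apply: gh.
have [c|gC gCE] := liftC A A' M q e q_surj q_sq e_surj e_nil (comp_hom g j).
  by rewrite -hj; apply: gh.
have [r|g' [gi gj]] := tensor_univ ten (f := gB) (g := gC).
  by rewrite !alg_hom_comm.
have g'C r : g' (alg_map D r) = alg_map (restrict pi A) r.
  by rewrite -(alg_hom_comm i) gi alg_hom_comm.
exists (@AlgHom R D (restrict pi A) g' g'C) => d; have [s ->] := tensor_span ten d.
rewrite [g' _]rmorph_sum [LHS]rmorph_sum [RHS]rmorph_sum; apply: eq_bigr => z _.
rewrite [g' _]rmorphM [LHS]rmorphM [RHS]rmorphM gi gj; congr (_ * _).
  exact: gBE.
exact: gCE.
Qed.

(** The label [L] says that a point specializes into [V]. Both halves of the theorem need only these
    clauses; the ends of a curve are compared directly, over any presentation of E(t) as a fraction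
    field of E[t]. *)
Lemma separated_points (R : idomainType) (R_dvr : is_dvr R)
    (k : fieldType) (pi : {rmorphism R -> k}) (pi_residue : is_residue_map pi)
    (X : functor R) (X_scheme : is_scheme X) (X_proper : proper_scheme X) (X_flat : flat X)
    (X_integral : geometrically_integral (generic_fibre X))
    (V W : subfunctor (special_fibre pi X))
    (V_closed : closed_sub V) (W_closed : closed_sub W) (VW_union : is_union V W)
    (T_empty : ~ exists p : rational_point (special_fibre pi X), lies_in (inter V W) p)
    (V_smooth_point : exists p : rational_point (sub V), in_smooth_locus p)
    (W_smooth_point : exists p : rational_point (sub W), in_smooth_locus p) :
  exists (E : fieldType) (phi : {rmorphism {fraction R} -> E})
    (A B : generic_fibre X (Alg phi)) (L : generic_fibre X (Alg phi) -> Prop),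
  [/\ L A, ~ L B,
      forall (F : fieldType) (iota : {rmorphism {poly E} -> F})
        (x : X (Alg (const_map (phi \o @tofrac R : {rmorphism R -> E}) iota)))
        (P Q : X (Alg (phi \o @tofrac R : {rmorphism R -> E}))),
      injective iota -> (forall y, exists a b, iota b <> 0 /\ y = iota a / iota b) ->
      has_value 1 x P -> has_value (-1) x Q -> L P -> L Q
    & forall U : subfunctor (generic_fibre X), open_sub U -> nonempty (sub U) ->
      lies_in U A /\ lies_in U B].
Proof.
pose tau : {rmorphism R -> {fraction R}} := @tofrac R.
have [[varpi varpi0 pi_ker] noethR tau_frac] := dvr_structure R_dvr pi_residue.
have tau_inj : injective tau by move=> r s /eqP; rewrite tofrac_eq => /eqP.
have [pi_surj _] := pi_residue.
have T_empty' (p : rational_point (base_change pi X)) : lies_in V p -> lies_in W p -> False.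
  by move=> Vp Wp; apply: T_empty; exists p.
case: V_smooth_point => pv pv_smooth; case: W_smooth_point => pw pw_smooth.
have Vpv := svalP pv; have Wpw := svalP pw.
have [_ [n [U [C [UC cover]]]] _] := X_proper.
have [l Ul] := cover k _ (sval pv); have [m Um] := cover k _ (sval pw).
have [chart_l C_l] := UC l; have [chart_m C_m] := UC m.
have [U_l [u [Uu u_univ]]] := proj1 (affine_openP _ _) chart_l.
have [U_m [u' [Uu' u'_univ]]] := proj1 (affine_openP _ _) chart_m.
have [hv [hvE _]] := u_univ _ _ Ul; have [hw [hwE _]] := u'_univ _ _ Um.
have WV_union : is_union W V by move=> Z Zc WZ VZ; apply: VW_union.
have lift_v := smooth_point_lifting V_closed W_closed VW_union U_l Uu u_univ pv_smooth
  (fun Wp => T_empty' _ Vpv Wp) hvE.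
have lift_w := smooth_point_lifting W_closed V_closed WV_union U_m Uu' u'_univ pw_smooth
  (fun Vp => T_empty' _ Vp Wpw) hwE.
have [D0 [i [j ten]]] := tensor_exists (C l) (C m).
have hvw r : hv (alg_map (C l) r) = hw (alg_map (C m) r) by rewrite !alg_hom_comm.
have [domD i_inj j_inj R_inj] := product_domain tau_inj tau_frac X_flat X_integral chart_l chart_m
  hvw ten.
pose D : algebra R := Alg (i \o alg_map (C l) : {rmorphism R -> D0}).
pose iD : alg_hom (C l) D := @AlgHom R (C l) D i (fun r => erefl).
pose jD : alg_hom (C m) D := @AlgHom R (C m) D j (fun r => esym (tensor_agree ten r)).
have [hD0 [hi hj]] := tensor_univ ten hvw.
have hDC r : hD0 (alg_map D r) = alg_map (restrict pi (alg_self k)) r.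
  by rewrite /= hi (alg_hom_comm hv).
pose hD : alg_hom D (restrict pi (alg_self k)) :=
  @AlgHom R D (restrict pi (alg_self k)) hD0 hDC.
have tenD : is_tensor iD jD by [].
have fgD : finitely_generated D by apply: (tensor_finitely_generated tenD C_l C_m).
have noethD : noetherian D by apply: finitely_generated_noetherian fgD.
have liftD : smooth_lifting pi hD by apply: (tensor_lifting tenD hi hj lift_v lift_w).
have [E [f [f_inj f_frac]]] := domain_generic_point (domD : is_domain D).
have D_inj : injective (alg_map D) by apply: inj_comp.
have [|phi phiE] := fraction_extend (f := f \o alg_map D) tau_inj _ tau_frac.
  exact: inj_comp.
pose psi : {rmorphism R -> E} := phi \o tau.
pose fD : alg_hom D (Alg psi) := @AlgHom R D (Alg psi) f (fun r => esym (phiE r)).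
have varpiD : alg_map D varpi <> 0 by rewrite -(rmorph0 (alg_map D)) => /D_inj.
have [kap [kphi [v [rho [g [pl v_surj fg Tk down]]]]]] := smooth_place (D := D) pi_surj pi_ker X_proper
  V_closed W_closed T_empty' domD noethD varpiD liftD f_inj f_frac.
pose kpt := restrict pi (Alg kphi).
have [Ov [io [res [val vi iv]]]] := place_ring pl.
have [io_inj _ _] := val.
have pv_inj z c c' : place_value v rho z c -> place_value v rho z c' -> c = c'.
  by case=> _ -> [_ ->].
have psi_val r : place_value v rho (psi r) (kphi (pi r)).
  have := fg (alg_map D r); rewrite (alg_hom_comm g r) /=.
  by rewrite -[f _](phiE r).
have centre (x : X D) : has_centre (place_value v rho) (fmap fD x) (fmap g x : X kpt).
  have [s sE] := lift_hom (f := f) io_inj (fun d => iv _ (proj1 (fg d))).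
  pose OvR : algebra R := Alg (s \o alg_map D : {rmorphism R -> Ov}).
  pose sD : alg_hom D OvR := @AlgHom R D OvR s (fun r => erefl).
  have ioC r : io (alg_map OvR r) = alg_map (Alg psi) r by rewrite /= sE; apply: esym (phiE r).
  have res_s d : res (s d) = g d.
    by apply: (pv_inj (f d)); [have := vi (s d); rewrite sE | apply: fg].
  have resC r : res (alg_map OvR r) = alg_map kpt r.
    by rewrite /= res_s; apply: (alg_hom_comm g).
  exists OvR, (@AlgHom R OvR (Alg psi) io ioC), (@AlgHom R OvR kpt res resC), (fmap sD x).
  split=> //.
  - by move=> z c [Oz _]; apply: iv.
  - by rewrite fmap_compE; apply: eq_fmap => d; apply: sE.
  - by rewrite fmap_compE; apply: eq_fmap => d; apply: res_s.
pose L (P : X (Alg psi)) := exists y : X kpt, has_centre (place_value v rho) P y /\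
  lies_in V (y : base_change pi X (Alg kphi)).
exists E, phi, (fmap (comp_hom fD iD) u), (fmap (comp_hom fD jD) u'), L; split.
- exists (fmap g (fmap iD u)); split; first by rewrite -fmap_compE; apply: centre.
  (* If the centre lay on [W], so would its specialization [pv], a point of [V]. *)
  have [//|Wy] := union_field V_closed W_closed VW_union
    (fmap g (fmap iD u) : base_change pi X (Alg kphi)).
  exfalso; apply: (T_empty' (sval pv)) => //; have := down W (fmap iD u) W_closed Wy.
  suff -> : fmap hD (fmap iD u) = sval pv by [].
  by rewrite -hvE fmap_compE; apply: eq_fmap => b; apply: hi.
- case=> y [yB Vy]; apply: (T_empty' (sval pw)) => //.
  have yE : y = fmap g (fmap jD u').
    by apply: (centre_unique X_proper pv_inj yB); rewrite -fmap_compE; apply: centre.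
  rewrite {}yE in Vy; have := down V (fmap jD u') V_closed Vy.
  suff -> : fmap hD (fmap jD u') = sval pw by [].
  by rewrite -hwE fmap_compE; apply: eq_fmap => b; apply: hj.
- move=> F iota x P Q iota_inj iota_frac xP xQ [y [Py Vy]].
  have [z Qz] := has_centre_exists X_proper Q val vi (fun z c zc => iv z (proj1 zc)) pv_inj psi_val.
  exists z; split=> //.
  apply/(linked_centres X_proper pi_surj V_closed W_closed VW_union Tk pl v_surj _ _ iota_inj
    iota_frac xP xQ Py Qz) => // r.
    by case: (psi_val r).
  by case: (psi_val r) => _ ->.
- move=> U' U'_open neU'; split.
  + have fi_inj : injective (comp_hom fD iD) by apply: inj_comp.
    exact: (@generic_point_lies R _ tau tau_frac X X_scheme X_integral _ _ u E phi _ U'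
      chart_l Uu u_univ fi_inj U'_open neU').
  + have fj_inj : injective (comp_hom fD jD) by apply: inj_comp.
    exact: (@generic_point_lies R _ tau tau_frac X X_scheme X_integral _ _ u' E phi _ U'
      chart_m Uu' u'_univ fj_inj U'_open neU').
Qed.

Lemma field_point_curve (E : fieldType) : exists (F : fieldType) (iota : {rmorphism {poly E} -> F}),
  injective iota /\ forall y, exists a b, iota b <> 0 /\ y = iota a / iota b.
Proof.
apply: domain_generic_point; split; first by apply/eqP; apply: oner_neq0.
by move=> x y /eqP; rewrite mulf_eq0 => /orP[/eqP|/eqP]; [left | right].
Qed.

Lemma clos_refl_trans_invariant (T : Type) (r : T -> T -> Prop) (L : T -> Prop) x y :
  (forall a b, r a b -> L a -> L b) -> clos_refl_trans T r x y -> L x -> L y.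
Proof. by move=> rL; elim=> // a b c _ ab _ bc /ab /bc. Qed.

Theorem proposition7p2 (R : idomainType) (R_dvr : is_dvr R)
    (k : fieldType) (pi : {rmorphism R -> k}) (pi_residue : is_residue_map pi)
    (X : functor R) (X_scheme : is_scheme X)
    (X_proper : proper_scheme X) (X_flat : flat X)
    (X_smooth : smooth (generic_fibre X))
    (X_integral : geometrically_integral (generic_fibre X))
    (V W : subfunctor (special_fibre pi X))
    (V_closed : closed_sub V) (W_closed : closed_sub W)
    (VW_union : is_union V W)
    (T_empty : ~ exists p : rational_point (special_fibre pi X),
       lies_in (inter V W) p)
    (V_smooth_point : exists p : rational_point (sub V), in_smooth_locus p)
    (W_smooth_point : exists p : rational_point (sub W), in_smooth_locus p) :
  ~ R_trivial (generic_fibre X) /\ ~ retract_rational (generic_fibre X).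
Proof.
have [E [phi [A [B [L [LA LB L_line generic]]]]]] := separated_points R_dvr pi_residue X_scheme
  X_proper X_flat X_integral V_closed W_closed VW_union T_empty V_smooth_point W_smooth_point.
have [F [iota [iota_inj iota_frac]]] := field_point_curve E.
pose tau : {rmorphism R -> {fraction R}} := @tofrac R.
pose psi : {rmorphism R -> E} := phi \o tau.
split.
- move=> triv.
  pose XE := base_change phi (generic_fibre X).
  pose ER := restrict tau (restrict phi (alg_self E)).
  pose fwd : alg_hom (Alg psi) ER := @AlgHom R (Alg psi) ER (idfun : {rmorphism E -> E}) (fun r => erefl).
  pose back : alg_hom ER (Alg psi) := @AlgHom R ER (Alg psi) (idfun : {rmorphism E -> E}) (fun r => erefl).
  pose A' : rational_point XE := fmap fwd A; pose B' : rational_point XE := fmap fwd B.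
  have backK (P : X (Alg psi)) : fmap back (fmap fwd P) = P.
    by rewrite fmap_compE; apply: fmap_id.
  have AB : R_equivalent A' B'.
    have [C [_ C_uniq]] := triv E phi.
    have -> : R_equivalent A' = R_equivalent B'.
      by rewrite -(C_uniq (R_equivalent A')) ?(C_uniq (R_equivalent B')) //; [exists B' | exists A'].
    exact: rt_refl.
  apply: LB; rewrite -[B]backK.
  apply: (clos_refl_trans_invariant (L := fun P : rational_point XE => L (fmap back P)) _ AB);
    last by rewrite backK.
  move=> P Q [U [h [U_open [a [b [<- <-]]]]]].
  (* A link is parametrized by an open part of the projective line. The line is reparametrized
     through [a] and [b], so that the two linked points are the values at 0 and infinity. *)
  have [->//|[x [xa xb]]] := @line_values _ (generic_fibre X) E E 1 phi idfun U h U_open F iota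
    iota_inj iota_frac a b.
  have phi_psi r : (idfun \o phi : {rmorphism _ -> E}) (tau r) = psi r by [].
  have const_psi r : const_map (idfun \o phi : {rmorphism _ -> E}) iota (tau r) =
    const_map psi iota r by [].
  have xa' := has_value_restrict phi_psi const_psi xa.
  have xb' := has_value_restrict phi_psi const_psi xb.
  have := L_line F iota _ _ _ iota_inj iota_frac xa' xb'.
  have E1 (p : XE (alg_self E)) : fmap (@AlgHom R
      (restrict tau (Alg (idfun \o phi : {rmorphism _ -> E}))) (Alg psi)
      (idfun : {rmorphism E -> E}) phi_psi) (p : X _) = fmap back p by apply: (@eq_fmap R X).
  by rewrite -!E1.
- case=> U [n [W' [f [g [U_open neU W'_open gf]]]]].
  have [UA UB] := generic U U_open neU.
  pose a : sub U (Alg phi) := exist _ A UA; pose b : sub U (Alg phi) := exist _ B UB.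
  pose incl : morphism (sub U) (generic_fibre X) :=
    @Morphism _ (sub U) (generic_fibre X) (fun _ p => sval p) (fun _ _ _ _ => erefl).
  (* As [g] undoes [f], the image under [h] of the line through the images of A and B by [f] has the
     end values A and B. *)
  pose h : morphism (sub W') (generic_fibre X) := @Morphism _ (sub W') (generic_fibre X)
    (fun C p => incl C (g C p)) (fun C D e p => congr1 sval (app_nat g e p)).
  have hf p : h _ (f (Alg phi) p) = sval p by rewrite /= gf.
  have [fab|[x [xa xb]]] := @line_values _ X _ E n tau phi W' h W'_open F iota
    iota_inj iota_frac (f _ a) (f _ b).
    by apply: LB; have := hf a; rewrite fab hf /= => ->.
  by apply: LB; move: xa xb; rewrite !hf => xa xb; apply: (L_line F iota x A B).
Qed.
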